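(* Let $(\mathbf X_1,\mathbf X_2)$ have marginal distributions $P_{\mathbf X_1}\in\mathcal P_{d_1}^{ac}$ and $P_{\mathbf X_2}\in\mathcal P_{d_2}^{ac}$. Let $f_k:(\mathbb R^{d_k})^m\to[0,\infty)$, $k=1,2$, be kernels, $H\subseteq\mathfrak S_m$ a subgroup containing an equal number of even and odd permutations, and $J_1,J_2$ score functions. Let $\mu_\pm=\mu_{\pm;J_1,J_2,f_1,f_2,H}$ be the rank-based GSC and $\widetilde W^{(n)}_\mu=\widetilde W^{(n)}_{J_1,J_2,\mu_{f_1,f_2,H}}$ its rank-based sample version; for $m\ge4$ let $\mu_{*\pm}=\mu_{\pm;J_1,J_2,f_1,f_2,H_*^m}$. Then: (i) (Exact distribution-freeness) Under independence of $\mathbf X_1$ and $\mathbf X_2$, the distribution of $\widetilde W^{(n)}_\mu$ does not depend on $P_{\mathbf X_1}$ nor $P_{\mathbf X_2}$. (ii) (Transformation invariance) If $f_1$ and $f_2$ are orthogonally invariant, then for any orthogonal matrices $\mathbf O_k\in\mathbb R^{d_k\times d_k}$, vectors $\mathbf v_k\in\mathbb R^{d_k}$ and scalars $a_k>0$, $k=1,2$, $\mu_\pm(\mathbf X_1,\mathbf X_2)=\mu_\pm(\mathbf v_1+a_1\mathbf O_1\mathbf X_1,\mathbf v_2+a_2\mathbf O_2\mathbf X_2)$. (iii) (I- and D-consistency) (a) $\mu_\pm$ is I-consistent in the family $\{P_{(\mathbf X_1,\mathbf X_2)}: P_{\mathbf X_k}\in\mathcal P_{d_k}^{ac}\text{ and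 }\mathrm E[f_k([\mathbf G_{k,\pm}(\mathbf X_{ki})]_{i=1}^m)]<\infty\text{ for }k=1,2\}$. (b) If the pair of kernels $(f_1,f_2)$ is D-consistent in the class $\{P_{(\mathbf X_1,\mathbf X_2)}\in\mathcal P_{d_1+d_2}^{ac}:\mathrm E[f_k(\mathbf X_{k1},\dots,\mathbf X_{km})]<\infty\text{ for }k=1,2\}$, then $\mu_{*\pm}$ is D-consistent in the family $\mathcal P^{ac}_{d_1,d_2,\infty}=\{P_{(\mathbf X_1,\mathbf X_2)}\in\mathcal P_{d_1+d_2}^{ac}:\mathrm E[f_k([\mathbf G_{k,\pm}(\mathbf X_{ki})]_{i=1}^m)]<\infty\text{ for }k=1,2\}$, provided that $J_1$ and $J_2$ are strictly monotone. (iv) (Strong consistency) If there exists a constant $C$ (depending on $f_k$, $J_k$ and $P_{\mathbf X_k}$) such that for any $n$ and $k=1,2$ (and all indices) $P\big(|f_k([\mathbf G^{(n)}_{k,\pm}(\mathbf X_{ki_\ell})]_{\ell=1}^m)|\le C\big)=1=P\big(|f_k([\mathbf G_{k,\pm}(\mathbf X_{ki_\ell})]_{\ell=1}^m)|\le C\big)$, and if for $k=1,2$ $$\frac{(n-m)!}{n!}\sum_{[i_1,\dots,i_m]\in I^n_m}\Big|f_k\big([\mathbf G^{(n)}_{k,\pm}(\mathbf X_{ki_\ell})]_{\ell=1}^m\big)-f_k\big([\mathbf G_{k,\pm}(\mathbf X_{ki_\ell})]_{\ell=1}^m\big)\Big|\to0\quad\text{a.s.},$$ then $\widetilde W^{(n)}_\mu\to\mu_\pm(\mathbf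 X_1,\mathbf X_2)$ almost surely.
   Context: **Generalized symmetric covariances.** For a subgroup $H$ of the symmetric group $\mathfrak S_m$ with equal numbers of even and odd permutations and kernels $f_k:(\mathbb R^{d_k})^m\to[0,\infty)$, put $f_{k,H}(\mathbf x_{k1},\dots,\mathbf x_{km})=\sum_{\sigma\in H}\mathrm{sgn}(\sigma)f_k(\mathbf x_{k\sigma(1)},\dots,\mathbf x_{k\sigma(m)})$ and $k_{f_1,f_2,H}((\mathbf x_{11},\mathbf x_{21}),\dots,(\mathbf x_{1m},\mathbf x_{2m}))=f_{1,H}(\mathbf x_{11},\dots,\mathbf x_{1m})\,f_{2,H}(\mathbf x_{21},\dots,\mathbf x_{2m})$. The GSC is $\mu_{f_1,f_2,H}(\mathbf X_1,\mathbf X_2)=\mathrm E[k_{f_1,f_2,H}((\mathbf X_{11},\mathbf X_{21}),\dots,(\mathbf X_{1m},\mathbf X_{2m}))]$ with $(\mathbf X_{1i},\mathbf X_{2i})$ i.i.d. copies of $(\mathbf X_1,\mathbf X_2)$. Its sample version is $\hat\mu^{(n)}([(\mathbf x_{1i},\mathbf x_{2i})]_{i=1}^n;f_1,f_2,H)=\binom nm^{-1}\sum_{i_1<\dots<i_m}\overline k_{f_1,f_2,H}((\mathbf x_{1i_1},\mathbf x_{2i_1}),\dots,(\mathbf x_{1i_m},\mathbf x_{2i_m}))$, where $\overline k$ is the average of $k$ over all $m!$ permutations of its $m$ arguments. For $m\ge4$, $H_*^m=\{(1),(1\,4),(2\,3),(1\,4)(2\,3)\}\subset\mathfrak S_m$.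 $I^n_m$ is the set of all $n!/(n-m)!$ sequences of $m$ distinct elements of $\{1,\dots,n\}$. A kernel $f:(\mathbb R^d)^m\to\mathbb R$ is orthogonally invariant if $f(\mathbf w_1,\dots,\mathbf w_m)=f(\mathbf O\mathbf w_1,\dots,\mathbf O\mathbf w_m)$ for all orthogonal $\mathbf O$ and all $\mathbf w_i$. A dependence measure $\nu$ is I-consistent in a family $\mathcal P$ of joint laws if independence of $\mathbf X_1,\mathbf X_2$ implies $\nu(\mathbf X_1,\mathbf X_2)=0$ whenever the joint law is in $\mathcal P$; it is D-consistent in $\mathcal P$ if $\nu(\mathbf X_1,\mathbf X_2)=0$ implies independence whenever the joint law is in $\mathcal P$. The pair $(f_1,f_2)$ is D-consistent in $\mathcal P$ if, for every law in $\mathcal P$, $\mathrm E[f_{1,H_*^m}(\mathbf X_{11},\dots,\mathbf X_{1m})f_{2,H_*^m}(\mathbf X_{21},\dots,\mathbf X_{2m})]$ is finite, nonnegative, and equal to $0$ only if $\mathbf X_1$ and $\mathbf X_2$ are independent. **Center-outward distribution functions.** $\mathcal P_d^{ac}$ is the set of probability measures on $\mathbb R^d$ absolutely continuous w.r.t. Lebesgue measure. $\mathbb S_d$ is the open unit ball and $\mathcal S_{d-1}$ the unit sphere of $\mathbb R^d$. $\mathrm U_d$ is the law of $RS$ with $R$ uniform on $[0,1)$ and $S$ uniform on $\mathcal S_{d-1}$, independent. For $P\in\mathcal P_d^{ac}$ the center-outward distribution function $\mathbf F_\pm$ is the $P$-a.s. unique map $\mathbb R^d\to\mathbb S_d$ that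 is the gradient of a convex function and pushes $P$ forward to $\mathrm U_d$. **Grid and sample version.** For $d\ge2$ write $n=n_Rn_S+n_0$ with $n_R,n_S\ge1$, $0\le n_0<\min\{n_R,n_S\}$. Let $\mathbf s^{(n_S)}_1,\dots,\mathbf s^{(n_S)}_{n_S}$ be distinct unit vectors (dividing the circle into equal arcs if $d=2$) whose empirical distribution converges weakly to the uniform law on $\mathcal S_{d-1}$ as $n_S\to\infty$. The grid $\mathfrak G^d_{\mathbf n}$ consists of the $n_Rn_S$ points $\frac r{n_R+1}\mathbf s_s^{(n_S)}$, $1\le r\le n_R$, $1\le s\le n_S$, plus, if $n_0\ge1$, the $n_0$ points $\frac1{2(n_R+1)}\mathbf s_s^{(n_S)}$, $s\in\mathcal S$, with $\mathcal S$ a random sample of size $n_0$ without replacement from $\{1,\dots,n_S\}$ (independent of the observations). For $d=1$: $n_S=2$, $n_R=\lfloor n/2\rfloor$, $n_0=n-2n_R$, and the grid is $\{\pm r/(n_R+1):1\le r\le n_R\}$ together with $0$ if $n_0=1$. Asymptotics are for $n\to\infty$ with $n_R,n_S\to\infty$ (for $d=1$, $n_R\to\infty$). Given distinct points $\mathbf z_1,\dots,\mathbf z_n$, $\mathbf F^{(n)}_\pm$ is the bijection $T$ from $\{\mathbf z_i\}$ onto $\mathfrak G^d_{\mathbf n}$ minimizing $\sum_i\|\mathbf z_i-T(\mathbf z_i)\|^2$. **Scores and rank-based quantities.** Score functions are continuous functions $J_k:[0,1)\to[0,\infty)$. $\mathbf J_k(\mathbf u)=J_k(\|\mathbf u\|)\mathbf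 u/\|\mathbf u\|$ for $\mathbf u\in\mathbb S_{d_k}\setminus\{\mathbf 0\}$, $\mathbf J_k(\mathbf 0)=\mathbf 0$. $(\mathbf X_{1i},\mathbf X_{2i})$, $i=1,\dots,n$, are i.i.d. copies of $(\mathbf X_1,\mathbf X_2)$; $\mathbf F_{k,\pm}$ is the center-outward distribution function of $\mathbf X_k$, $\mathbf F_{k,\pm}^{(n)}$ the sample version from $\{\mathbf X_{ki}\}_{i=1}^n$; $\mathbf G_{k,\pm}=\mathbf J_k\circ\mathbf F_{k,\pm}$, $\mathbf G^{(n)}_{k,\pm}=\mathbf J_k\circ\mathbf F^{(n)}_{k,\pm}$. The rank-based GSC is $\mu_{\pm;J_1,J_2,f_1,f_2,H}(\mathbf X_1,\mathbf X_2)=\mu_{f_1,f_2,H}(\mathbf G_{1,\pm}(\mathbf X_1),\mathbf G_{2,\pm}(\mathbf X_2))$ and its rank-based sample version is $\widetilde W^{(n)}_{J_1,J_2,\mu_{f_1,f_2,H}}=\hat\mu^{(n)}([(\mathbf G^{(n)}_{1,\pm}(\mathbf X_{1i}),\mathbf G^{(n)}_{2,\pm}(\mathbf X_{2i}))]_{i=1}^n;f_1,f_2,H)$.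
   Formalization: In (iii)(b) the scores J_1, J_2 are also assumed to pull Lebesgue-null sets back to null sets (J_k(R) has a.c. law for R uniform on [0,1)); without this the claim fails, e.g. for singular strictly increasing J_k and distance-covariance kernels set to 0 on a null set. *)

(* Defs.v *)
From HB Require Import structures.
From mathcomp Require Import all_boot all_order all_algebra all_fingroup.
From mathcomp Require Import all_classical all_reals all_analysis.

Set Implicit Arguments.
Unset Strict Implicit.
Unset Printing Implicit Defensive.

Import Order.TTheory GRing.Theory Num.Theory.
Import numFieldNormedType.Exports.

Local Open Scope classical_set_scope.
Local Open Scope ring_scope.

(* The sigma-algebra generated by the coordinates: the Borel sets of R^n when T
   is the real line. *)
Section measurable_row.
Context {d} {T : sigmaRingType d}.
Variable n : nat.

Let coords : 'I_n -> 'rV[T]_n -> T := fun i x => x ord0 i.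

Let row_set0 : g_sigma_preimage coords set0.
Proof. exact: sigma_algebra0. Qed.

Let row_setC A : g_sigma_preimage coords A -> g_sigma_preimage coords (~` A).
Proof. exact: sigma_algebraC. Qed.

Let row_bigcup (F : _^nat) : (forall i, g_sigma_preimage coords (F i)) ->
  g_sigma_preimage coords (\bigcup_i (F i)).
Proof. exact: sigma_algebra_bigcup. Qed.

HB.instance Definition _ := @isMeasurable.Build (measure_tuple_display d)
  'rV[T]_n (g_sigma_preimage coords) row_set0 row_setC row_bigcup.

End measurable_row.

HB.instance Definition _ d1 d2 (T1 : measurableType d1) (T2 : measurableType d2)
  := isMeasurableFun.Build _ _ _ _ (@fst T1 T2) measurable_fst.
HB.instance Definition _ d1 d2 (T1 : measurableType d1) (T2 : measurableType d2)
  := isMeasurableFun.Build _ _ _ _ (@snd T1 T2) measurable_snd.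

Section power_measure.
Context {d} {T : measurableType d} {R : realType}.

Fixpoint power_measure (mu : set T -> \bar R) (n : nat) :
    set (n.-tuple T) -> \bar R :=
  match n with
  | 0 => dirac [tuple]
  | n'.+1 => pushforward (mu \x power_measure mu (n := n'))%E
               (fun p => [tuple of p.1 :: p.2])
  end.

End power_measure.
Arguments power_measure {d T R} mu n.

Lemma pack_sigma_finite_measure d (T : measurableType d) (R : realType)
    (nu : set T -> \bar R) :
  nu set0 = 0%E -> (forall A, 0 <= nu A)%E -> semi_sigma_additive nu ->
  sigma_finite setT nu ->
  exists m : {sigma_finite_measure set T -> \bar R}, nu = m.
Proof.
move=> nu0 nu_ge0 nuD nuf.
pose H1 := isMeasure.Build _ _ _ nu nu0 nu_ge0 nuD.
pose m1 : {measure set T -> \bar R} := HB.pack nu H1.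
pose H2 := Measure_isSigmaFinite.Build _ _ _ m1 nuf.
pose m2 : {sigma_finite_measure set T -> \bar R} := HB.pack nu m1 H2.
by exists m2.
Qed.

Lemma pushforward_sigma_finite d d' (T : measurableType d)
    (T' : measurableType d') (R : realType) (m : {measure set T -> \bar R})
    (f : T -> T') (g : T' -> T) :
  measurable_fun setT f -> measurable_fun setT g -> cancel f g ->
  sigma_finite setT m ->
  exists m' : {sigma_finite_measure set T' -> \bar R}, pushforward m f = m'.
Proof.
move=> mf mg fK [F FT mF].
pose f_mfun : {mfun T >-> T'} := HB.pack f (isMeasurableFun.Build _ _ _ _ f mf).
apply: pack_sigma_finite_measure; first exact: measure0.
- by move=> A; exact: measure_ge0.
- have : semi_sigma_additive (pushforward m f_mfun).
    exact: measure_semi_sigma_additive.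
  exact.
- exists (fun k => g @^-1` F k).
    by rewrite -preimage_bigcup -FT preimage_setT.
  move=> k; have [mFk Fk] := mF k; split.
    by rewrite -[X in measurable X]setTI; exact: mg.
  rewrite /pushforward -comp_preimage (_ : g \o f = id)//.
  by apply/funext => x /=; rewrite fK.
Qed.

(* The library's sigma-finite instance on m1 \x m2 is shadowed by the one for
   probability measures. *)
Lemma sigma_finite_product d1 d2 (T1 : measurableType d1)
    (T2 : measurableType d2) (R : realType)
    (m1 : {sigma_finite_measure set T1 -> \bar R})
    (m2 : {sigma_finite_measure set T2 -> \bar R}) :
  sigma_finite setT (m1 \x m2)%E.
Proof.
have /sigma_finiteP[F [TF ndF Foo]] := sigma_finiteT m1.
have /sigma_finiteP[G [TG ndG Goo]] := sigma_finiteT m2.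
exists (fun n => F n `*` G n).
  rewrite -setXTT TF TG predeqE => -[x y]; split.
    move=> [/= [n _ Fnx] [k _ Gky]]; exists (maxn n k) => //; split.
    - by move: x Fnx; exact/subsetPset/ndF/leq_maxl.
    - by move: y Gky; exact/subsetPset/ndG/leq_maxr.
  by move=> [n _ []/= ? ?]; split; exists n.
move=> k; have [? ?] := Foo k; have [? ?] := Goo k.
split; first exact: measurableX.
by rewrite product_measure1E// lte_mul_pinfty// ge0_fin_numE.
Qed.

Section power_measure_instances.
Local Open Scope ereal_scope.
Context d (T : measurableType d) (R : realType).
Variable mu : {sigma_finite_measure set T -> \bar R}.

Let tupleT n := [the measurableType _ of n.-tuple T].

Let power_measureP n :
  exists m : {sigma_finite_measure set (tupleT n) -> \bar R},
    power_measure mu n = m.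
Proof.
elim: n => [|n [m mE]]; first by exists (dirac [tuple]).
rewrite /= mE.
apply: (@pushforward_sigma_finite _ _ _ _ _ _ _
  (fun t : tupleT n.+1 => (thead t, [tuple of behead t]))).
- exact: (measurable_cons measurable_fst measurable_snd).
- apply/measurable_fun_pair; [exact: measurable_tnth|exact: measurable_behead].
- by case=> x t /=; congr pair; exact: val_inj.
- exact: sigma_finite_product.
Qed.

Let power0 n : power_measure mu n set0 = 0.
Proof. by have [m ->] := power_measureP n; exact: measure0. Qed.

Let power_ge0 n A : 0 <= power_measure mu n A.
Proof. by have [m ->] := power_measureP n; exact: measure_ge0. Qed.

Let power_sigma_additive n : semi_sigma_additive (power_measure mu n).
Proof.
by have [m ->] := power_measureP n; exact: measure_semi_sigma_additive.
Qed.

Let power_sigma_finite n : sigma_finite setT (power_measure mu n).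
Proof. by have [m ->] := power_measureP n; exact: sigma_finiteT. Qed.

HB.instance Definition _ n := isMeasure.Build _ _ _ (power_measure mu n)
  (@power0 n) (@power_ge0 n) (@power_sigma_additive n).
HB.instance Definition _ n := Measure_isSigmaFinite.Build _ _ _
  (power_measure mu n) (@power_sigma_finite n).
End power_measure_instances.

Section measurable_row_fun.
Context d d' (T : sigmaRingType d) (T' : measurableType d').

Lemma measurable_coord n (i : 'I_n) :
  measurable_fun [set: 'rV[T]_n] (fun x => x ord0 i).
Proof.
move=> _ Y mY; rewrite setTI; apply: sub_sigma_algebra => /=.
rewrite -bigcup_seq/=; exists i => /=; first by rewrite mem_index_enum.
by exists Y => //; rewrite setTI.
Qed.

Lemma measurable_fun_row n (f : T' -> 'rV[T]_n) :
  (forall i, measurable_fun setT (fun x => f x ord0 i)) ->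
  measurable_fun setT f.
Proof.
move=> mf; suff : g_sigma_preimage (fun i x => f x ord0 i) `<=` measurable.
  rewrite (g_sigma_preimage_comp (fun i (x : 'rV[T]_n) => x ord0 i) f) => fS.
  by move=> _ A mA; apply: fS; exists A.
apply: smallest_sub; first exact: sigma_algebra_measurable.
case: n => [|n] in f mf *; first by rewrite big_ord0.
rewrite -bigcup_mkord_ord; apply: bigcup_sub => i Ii.
by move=> A [B mB <-]; exact: mf.
Qed.

End measurable_row_fun.

Definition lebesgue_rV {R : realType} (n : nat) : set 'rV[R]_n -> \bar R :=
  pushforward (power_measure (@lebesgue_measure R) n)
    (fun t : n.-tuple (measurableTypeR R) => (\row_i tnth t i) : 'rV[R]_n).
Arguments lebesgue_rV {R} n.

Section lebesgue_rV_instances.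
Local Open Scope ereal_scope.
Context (R : realType).

Let lebesgue_rVP n :
  exists m : {sigma_finite_measure set 'rV[R]_n -> \bar R}, lebesgue_rV n = m.
Proof.
apply: (@pushforward_sigma_finite _ _ _ _ _ _ _
  (fun x : 'rV[R]_n => [tuple x ord0 i | i < n] : n.-tuple (measurableTypeR R))).
- apply: measurable_fun_row => i.
  rewrite (_ : (fun x => _) = @tnth n (measurableTypeR R) ^~ i).
    exact: measurable_tnth.
  by apply/funext => t; rewrite mxE.
- apply/measurable_fun_tnthP => i.
  rewrite (_ : _ \o _ = fun x : 'rV[R]_n => x ord0 i).
    exact: measurable_coord.
  by apply/funext => x; rewrite /= tnth_mktuple.
- by move=> t; apply: eq_from_tnth => i; rewrite tnth_mktuple mxE.
- exact: sigma_finiteT.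
Qed.

Let lebesgue_rV0 n : lebesgue_rV n set0 = 0 :> \bar R.
Proof. by have [m ->] := lebesgue_rVP n; exact: measure0. Qed.

Let lebesgue_rV_ge0 n (A : set 'rV[R]_n) : 0 <= lebesgue_rV n A.
Proof. by have [m ->] := lebesgue_rVP n; exact: measure_ge0. Qed.

Let lebesgue_rV_sigma_additive n : semi_sigma_additive (@lebesgue_rV R n).
Proof. by have [m ->] := lebesgue_rVP n; exact: measure_semi_sigma_additive. Qed.

Let lebesgue_rV_sigma_finite n : sigma_finite setT (@lebesgue_rV R n).
Proof. by have [m ->] := lebesgue_rVP n; exact: sigma_finiteT. Qed.

HB.instance Definition _ n := isMeasure.Build _ _ _ (@lebesgue_rV R n)
  (@lebesgue_rV0 n) (@lebesgue_rV_ge0 n) (@lebesgue_rV_sigma_additive n).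
HB.instance Definition _ n := Measure_isSigmaFinite.Build _ _ _
  (@lebesgue_rV R n) (@lebesgue_rV_sigma_finite n).

End lebesgue_rV_instances.

Section euclidean.
Context {R : realType} {d : nat}.
Implicit Types x y g : 'rV[R]_d.

Definition dotv x y : R := \sum_i x ord0 i * y ord0 i.

(* `|x| on 'rV[R]_d is the sup norm; enorm is the Euclidean one. *)
Definition enorm x : R := Num.sqrt (dotv x x).

(* The image O x of a column vector x is the row x *m O^T here. *)
Definition orthogonal_mx (O : 'M[R]_d) : Prop := O *m O^T = 1%:M.

Definition is_gradient (phi : 'rV[R]_d -> R) x g : Prop :=
  differentiable phi x /\ forall h, 'd phi x h = dotv g h.

Definition convex_rV (phi : 'rV[R]_d -> R) : Prop :=
  convex_function (setT : set (convex_lmodType 'rV[R]_d)) phi.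

Definition open_unit_ball : set 'rV[R]_d := [set x | enorm x < 1].

(* Normalised surface measure of the unit sphere, as a measure on R^d: the law
   of V / |V| with V uniform on the unit ball. *)
Definition sphere_uniform : set 'rV[R]_d -> \bar R := fun A =>
  ((fine (lebesgue_rV d open_unit_ball))^-1%:E *
   lebesgue_rV d (open_unit_ball `&` [set x | A ((enorm x)^-1 *: x)]))%E.

Definition ball_uniform : set 'rV[R]_d -> \bar R :=
  pushforward (sphere_uniform \x uniform_prob (@ltr01 R))%E
    (fun sr => sr.2 *: sr.1).

Definition abs_cont (P : probability 'rV[R]_d R) : Prop := P `<< lebesgue_rV d.

Definition is_center_outward (P : probability 'rV[R]_d R)
    (F : 'rV[R]_d -> 'rV[R]_d) : Prop :=
  [/\ measurable_fun setT F,
      forall x, enorm (F x) < 1,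
      exists2 phi, convex_rV phi & {ae P, forall x, is_gradient phi x (F x)} &
      forall A, measurable A -> pushforward P F A = ball_uniform A].

(* A choice, for every absolutely continuous law, of a version of its
   center-outward distribution function; by McCann's theorem the function
   exists and is unique P-almost surely. *)
Definition center_outward_df
    (F : probability 'rV[R]_d R -> 'rV[R]_d -> 'rV[R]_d) : Prop :=
  forall P, abs_cont P -> is_center_outward P (F P).

(* Only the values of J on [0, 1[ are ever used. *)
Definition score_function (J : R -> R) : Prop :=
  (forall u, 0 <= u < 1 -> 0 <= J u) /\ {within `[0, 1[, continuous J}.

Definition strictly_monotone (J : R -> R) : Prop :=
  {in `[0, 1[ &, {homo J : u v / u < v}} \/
  {in `[0, 1[ &, {homo J : u v /~ u < v}}.

(* J pulls Lebesgue-null sets back to Lebesgue-null sets, i.e. the law of J(R)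
   for R uniform on [0, 1[ is absolutely continuous. *)
Definition nonsingular_score (J : R -> R) : Prop :=
  forall A : set R, measurable A -> lebesgue_measure A = 0%E ->
    lebesgue_measure (`[0, 1[ `&` J @^-1` A) = 0%E.

Definition score_map (J : R -> R) x : 'rV[R]_d :=
  if x == 0 then 0 else (J (enorm x) / enorm x) *: x.

End euclidean.

Section kernels.
Context {R : realType} {m : nat}.

Definition permute_tuple {T} (s : 'S_m) (x : m.-tuple T) : m.-tuple T :=
  [tuple tnth x (s i) | i < m].

Definition kernel_function {d} (f : m.-tuple 'rV[R]_d -> R) : Prop :=
  measurable_fun setT f /\ forall x, 0 <= f x.

Definition orthogonally_invariant {d} (f : m.-tuple 'rV[R]_d -> R) : Prop :=
  forall (O : 'M[R]_d) (w : m.-tuple 'rV[R]_d), orthogonal_mx O ->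
    f w = f (map_tuple (fun x => x *m O^T) w).

Definition balanced (H : {set 'S_m}) : Prop :=
  #|[set s in H | odd_perm s]| = #|[set s in H | ~~ odd_perm s]|.

Definition signed_sum {d} (f : m.-tuple 'rV[R]_d -> R) (H : {set 'S_m})
    (x : m.-tuple 'rV[R]_d) : R :=
  \sum_(s in H) (-1) ^+ s * f (permute_tuple s x).

Context {d1 d2 : nat}.
Local Notation V1 := 'rV[R]_d1.
Local Notation V2 := 'rV[R]_d2.
Variables (f1 : m.-tuple V1 -> R) (f2 : m.-tuple V2 -> R) (H : {set 'S_m}).

Definition gsc_kernel (z : m.-tuple (V1 * V2)) : R :=
  signed_sum f1 H (map_tuple fst z) * signed_sum f2 H (map_tuple snd z).

(* The m i.i.d. copies of (X1, X2) are realised on the m-th power of the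
   probability space on which (X1, X2) is defined. *)
Definition gsc {d} {T : measurableType d} (P : probability T R)
    (X1 : T -> V1) (X2 : T -> V2) : \bar R :=
  (\int[power_measure P m]_w
     (gsc_kernel (map_tuple (fun t => (X1 t, X2 t)) w))%:E)%E.

Definition sym_gsc_kernel (z : m.-tuple (V1 * V2)) : R :=
  (m`!)%:R^-1 * \sum_(s : 'S_m) gsc_kernel (permute_tuple s z).

Definition gsc_hat (n : nat) (z : 'I_n -> V1 * V2) : R :=
  'C(n, m)%:R^-1 *
  \sum_(t : m.-tuple 'I_n | sorted ltn (map val t))
     sym_gsc_kernel (map_tuple z t).

End kernels.

Definition kernel_mean {R : realType} {m d : nat} (f : m.-tuple 'rV[R]_d -> R)
    {d'} {T : measurableType d'} (P : probability T R) (X : T -> 'rV[R]_d) :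
    \bar R :=
  (\int[power_measure P m]_w (f (map_tuple X w))%:E)%E.

(* {(1), (1 4), (2 3), (1 4)(2 3)}, with indices shifted to start at 0 *)
Definition Hstar (m : nat) (m4 : (4 <= m)%N) : {set 'S_m} :=
  let ix k (k4 : (k < 4)%N) : 'I_m := Ordinal (leq_trans k4 m4) in
  let s14 := tperm (ix 0%N isT) (ix 3%N isT) in
  let s23 := tperm (ix 1%N isT) (ix 2%N isT) in
  [set 1%g; s14; s23; (s14 * s23)%g].

Section grids.
Context {R : realType}.

(* dirs q is the family of q unit vectors used when n_S = q. *)
Record grid_scheme (d : nat) := GridScheme {
  nR : nat -> nat;
  nS : nat -> nat;
  n0 : nat -> nat;
  dirs : forall q, 'I_q -> 'rV[R]_d
}.

Definition distinct_unit_vectors (d : nat) q (s : 'I_q -> 'rV[R]_d) : Prop :=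
  injective s /\ forall j, enorm (s j) = 1.

(* only used for d = 2 *)
Definition equal_arcs d q (s : 'I_q -> 'rV[R]_d) : Prop :=
  exists (theta : R) (p : 'S_q), forall (j : 'I_q) (i : 'I_d),
    let a := theta + 2 * pi * j%:R / q%:R in
    s (p j) ord0 i = if val i == 0%N then cos a else sin a.

Definition weakly_uniform d (s : forall q, 'I_q -> 'rV[R]_d) : Prop :=
  forall h : 'rV[R]_d -> R, continuous h ->
    (exists M : R, forall x, `|h x| <= M) ->
    (q%:R^-1 * \sum_(j < q) h (s q j))%:E @[q --> \oo] -->
      (\int[sphere_uniform]_x (h x)%:E)%E.

Definition admissible_grid d (g : grid_scheme d) : Prop :=
  [/\ nR g n @[n --> \oo] --> \oo,
      d = 1%N ->
        distinct_unit_vectors (dirs g (q := 2)) /\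
        forall n, [/\ nS g n = 2%N, nR g n = n./2 & n0 g n = (n - 2 * n./2)%N] &
      (2 <= d)%N ->
        [/\ nS g n @[n --> \oo] --> \oo,
            forall n, (0 < n)%N ->
              [/\ (1 <= nR g n)%N, (1 <= nS g n)%N,
                  (n0 g n < minn (nR g n) (nS g n))%N &
                  n = (nR g n * nS g n + n0 g n)%N],
            forall q, distinct_unit_vectors (dirs g (q := q)),
            d = 2%N -> forall q, equal_arcs (dirs g (q := q)) &
            weakly_uniform (dirs g)]].

Definition grid_seq d (g : grid_scheme d) n (A : {set 'I_(nS g n)}) :
    seq 'rV[R]_d :=
  [seq (r.+1%:R / (nR g n).+1%:R) *: dirs g j
     | r <- iota 0 (nR g n), j <- enum 'I_(nS g n)] ++
  (if d == 1%N then nseq (n0 g n) 0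
   else [seq (2 * (nR g n).+1%:R)^-1 *: dirs g j | j <- enum A]).

Definition grid_point d (g : grid_scheme d) n (A : {set 'I_(nS g n)})
    (i : 'I_n) : 'rV[R]_d := nth 0 (grid_seq A) i.

(* The bijection is z i |-> grid_point A (s i); [arg min] returns one of the
   minimisers s, unique for almost all z. *)
Definition empirical_df d (g : grid_scheme d) n (A : {set 'I_(nS g n)})
    (z : 'I_n -> 'rV[R]_d) (i : 'I_n) : 'rV[R]_d :=
  let cost (s : 'S_n) := \sum_i enorm (z i - grid_point A (s i)) ^+ 2 in
  grid_point A ([arg min_(s < (1%g : 'S_n)) cost s]%O i).

End grids.
Arguments grid_scheme R d : clear implicits.

Section pairs.
Context {R : realType} {d1 d2 : nat}.
Local Notation V1 := 'rV[R]_d1.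
Local Notation V2 := 'rV[R]_d2.
Local Notation law := (probability (V1 * V2)%type R).
Implicit Types (Q : law) (fam : set law).

Definition marg1 Q : probability V1 R := distribution Q fst.
Definition marg2 Q : probability V2 R := distribution Q snd.

Definition indep Q : Prop := forall A B, measurable A -> measurable B ->
  Q (A `*` B) = (marg1 Q A * marg2 Q B)%E.

Definition abs_cont_marginals Q : Prop :=
  abs_cont (marg1 Q) /\ abs_cont (marg2 Q).

Definition jointly_abs_cont Q : Prop :=
  pushforward Q (fun z => row_mx z.1 z.2 : 'rV[R]_(d1 + d2)) `<<
    lebesgue_rV (d1 + d2).

Definition I_consistent fam (nu : law -> \bar R) : Prop :=
  forall Q, fam Q -> indep Q -> nu Q = 0%E.

Definition D_consistent fam (nu : law -> \bar R) : Prop :=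
  forall Q, fam Q -> nu Q = 0%E -> indep Q.

Definition D_consistent_kernels m (m4 : (4 <= m)%N) fam
    (f1 : m.-tuple V1 -> R) (f2 : m.-tuple V2 -> R) : Prop :=
  forall Q, fam Q ->
    let E := gsc f1 f2 (Hstar m4) Q fst snd in
    [/\ E \is a fin_num, (0 <= E)%E & E = 0%E -> indep Q].

Variables (F1 : probability V1 R -> V1 -> V1) (F2 : probability V2 R -> V2 -> V2)
  (J1 J2 : R -> R).

Definition G1 Q (x : V1) : V1 := score_map J1 (F1 (marg1 Q) x).
Definition G2 Q (x : V2) : V2 := score_map J2 (F2 (marg2 Q) x).

Definition rank_gsc m (f1 : m.-tuple V1 -> R) (f2 : m.-tuple V2 -> R)
    (H : {set 'S_m}) Q : \bar R :=
  gsc f1 f2 H Q (fun z => G1 Q z.1) (fun z => G2 Q z.2).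

Definition finite_score_means m (f1 : m.-tuple V1 -> R) (f2 : m.-tuple V2 -> R)
    Q : Prop :=
  (kernel_mean f1 Q (fun z => G1 Q z.1) < +oo)%E /\
  (kernel_mean f2 Q (fun z => G2 Q z.2) < +oo)%E.

Definition finite_means m (f1 : m.-tuple V1 -> R) (f2 : m.-tuple V2 -> R)
    Q : Prop :=
  (kernel_mean f1 Q fst < +oo)%E /\ (kernel_mean f2 Q snd < +oo)%E.

End pairs.

Section samples.
Context {R : realType} {d1 d2 : nat}.
Local Notation V1 := 'rV[R]_d1.
Local Notation V2 := 'rV[R]_d2.
Context {dO} {Omega : measurableType dO} (P : probability Omega R).
Variables (g1 : grid_scheme R d1) (g2 : grid_scheme R d2).

(* (X_{1i}, X_{2i}) is (X1 i w, X2 i w), with i starting at 0; S1 n and S2 n are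
   the random subsets used in the grids of size n. *)
Record sample := Sample {
  X1 : nat -> Omega -> V1;
  X2 : nat -> Omega -> V2;
  S1 : forall n, Omega -> {set 'I_(nS g1 n)};
  S2 : forall n, Omega -> {set 'I_(nS g2 n)}
}.

Definition iid_copies (Q : probability (V1 * V2)%type R) (s : sample) : Prop :=
  [/\ forall i, measurable_fun setT (fun w => (X1 s i w, X2 s i w)),
      forall i A, measurable A -> P [set w | A (X1 s i w, X2 s i w)] = Q A &
      forall n (A : 'I_n -> set (V1 * V2)), (forall i, measurable (A i)) ->
        P [set w | forall i : 'I_n, A i (X1 s i w, X2 s i w)] =
        (\prod_(i < n) P [set w | A i (X1 s i w, X2 s i w)])%E].

(* S is uniform on the subsets of cardinality k. *)
Definition without_replacement q (k : nat) (S : Omega -> {set 'I_q}) : Prop :=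
  forall A : {set 'I_q},
    measurable (S @^-1` [set A]) /\
    (#|A| = k -> P (S @^-1` [set A]) = ('C(q, k)%:R^-1)%:E).

Definition independent_subsets (s : sample) : Prop :=
  forall n N (E : set (N.-tuple (V1 * V2)%type)) (A1 : {set 'I_(nS g1 n)})
      (A2 : {set 'I_(nS g2 n)}), measurable E ->
    let obs w := [tuple (X1 s i w, X2 s i w) | i < N] in
    P (obs @^-1` E `&` S1 s n @^-1` [set A1] `&` S2 s n @^-1` [set A2]) =
    (P (obs @^-1` E) * P (S1 s n @^-1` [set A1]) * P (S2 s n @^-1` [set A2]))%E.

Definition sampling_model (Q : probability (V1 * V2)%type R) (s : sample) :
    Prop :=
  [/\ iid_copies Q s,
      forall n, (0 < n)%N -> without_replacement (n0 g1 n) (S1 s n),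
      forall n, (0 < n)%N -> without_replacement (n0 g2 n) (S2 s n) &
      independent_subsets s].

Variables (J1 J2 : R -> R) (s : sample).

Definition G1n n w (i : 'I_n) : V1 :=
  score_map J1 (empirical_df (S1 s n w) (fun j => X1 s j w) i).
Definition G2n n w (i : 'I_n) : V2 :=
  score_map J2 (empirical_df (S2 s n w) (fun j => X2 s j w) i).

Definition rank_gsc_hat m (f1 : m.-tuple V1 -> R) (f2 : m.-tuple V2 -> R)
    (H : {set 'S_m}) n (w : Omega) : R :=
  gsc_hat f1 f2 H (fun i : 'I_n => (G1n w i, G2n w i)).

End samples.
Arguments sample {R d1 d2 dO} Omega g1 g2.
Arguments G1n {R d1 d2 dO Omega g1 g2} J1 s n w i.
Arguments G2n {R d1 d2 dO Omega g1 g2} J2 s n w i.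

(* Main.v *)
(* Independence enters through exchangeability: the optimal assignment is almost
   surely unique (ties lie on hyperplanes) and permuting the sample translates it
   by a permutation, so it is uniform on S_n whatever the continuous law is; the
   statistic is a function of the two assignments and of the two random subsets.

   Invariance and consistency of the population measure rest on McCann-type
   uniqueness: a subgradient map pushing P to the spherical uniform law is
   determined P-almost surely by Fenchel duality.  The similarity x -> v + a O x
   turns F into F O^T up to null sets, and orthogonal invariance of the kernels
   absorbs O.  Under independence, the integral factorises and balanced signed
   sums have mean 0.  For D-consistency, the conjugate of the potential gives a
   Borel left inverse of F, so that independence of the scores is independence
   of the observations, while the scores are again jointly absolutely continuous.

   For strong consistency, the boundedness reduces the statistic to the bounded
   U-statistic with kernel evaluated at the population scores, whose variance is
   O(1/n); it converges along the squares n = k^2, and between consecutive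
   squares it moves by O(1/k). *)

From HB Require Import structures.
Require Import Defs.
From mathcomp Require Import all_boot all_order all_algebra all_fingroup.
From mathcomp Require Import all_classical all_reals all_analysis.
From mathcomp Require Import measurable_realfun ring lra.

Set Implicit Arguments.
Unset Strict Implicit.
Unset Printing Implicit Defensive.

Import Order.TTheory GRing.Theory Num.Theory.
Import numFieldNormedType.Exports.

Local Open Scope classical_set_scope.
Local Open Scope ring_scope.

(** * Powers of a probability measure *)

Section tuple_laws.
Local Open Scope ereal_scope.
Context {R : realType}.

(** Null sets are followed instead of densities, because no change-of-variables formula is at hand
    for the center-outward map: only the law [ball_uniform] of its values is known. That law and the
    score control each marginal of the scores. The joint law is reached by showing that a jointly
    absolutely continuous [Q] is dominated by the product of its own marginals; Fubini then reduces
    null sets of pairs to the marginals.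

    The conjugate of the potential may be infinite and need not be differentiable. For each pair of
    rational slopes, a line parallel to an axis meets the bad set at most once, which makes it null
    by translation invariance. Uniqueness of the invariant measure also gives the effect of
    dilations and orthogonal maps on volumes without determinants.

    The assignment is an [arg min] whose tie-breaking need not commute with permutations, so the
    absence of ties has to come first. For strong consistency, the kernel is bounded only almost
    surely, while the variance estimate asks for a bound everywhere; clipping bridges the gap. *)

Definition box {T : Type} n (B : 'I_n -> set T) : set (n.-tuple T) :=
  [set t | forall i, B i (tnth t i)].

Lemma measurable_box d (T : measurableType d) n (B : 'I_n -> set T) :
  (forall i, measurable (B i)) -> measurable (box B).
Proof.
move=> mB; rewrite (_ : box B = \bigcap_(i in [set: 'I_n]) ((@tnth n T)^~ i @^-1` B i)).
  apply: fin_bigcap_measurable => // i _; rewrite -[X in measurable X]setTI.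
  exact: measurable_tnth.
by apply/seteqP; split => t /= Bt i; [move=> _|]; exact: Bt.
Qed.

Lemma boxI (T : Type) n (A B : 'I_n -> set T) :
  box A `&` box B = box (fun i => A i `&` B i).
Proof.
apply/seteqP; split=> t /=; first by move=> [At Bt] i; split.
by move=> ABt; split=> i; have [] := ABt i.
Qed.

(** Boxes form a pi-system generating the sigma-algebra of tuples; as the total mass is finite, the
    constant sequence [setT] serves as the exhausting sequence. *)
Lemma tuple_measure_unique d (T : measurableType d) n
    (m1 m2 : {measure set (n.-tuple T) -> \bar R}) :
  (forall B, (forall i, measurable (B i)) -> m1 (box B) = m2 (box B)) ->
  m1 setT < +oo ->
  forall A, measurable A -> m1 A = m2 A.
Proof.
move=> m12 m1T A mA.
pose G : set (set (n.-tuple T)) :=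
  [set A | exists2 B, (forall i, measurable (B i)) & A = box B].
apply: (measure_unique G (fun=> setT)) => //.
- apply/seteqP; split.
    apply: smallest_sub; first exact: smallest_sigma_algebra.
    move=> C; rewrite -bigcup_seq/= => -[i _] [B mB <-]; rewrite setTI.
    apply: sub_sigma_algebra; exists (fun j => if j == i then B else setT).
      by move=> j; case: ifP.
    apply/seteqP; split => t /=.
      by move=> Bt j; case: eqP => [->|].
    by move=> /(_ i); rewrite eqxx.
  apply: smallest_sub; first exact: sigma_algebra_measurable.
  by move=> _ [B mB ->]; exact: measurable_box.
- move=> _ _ [B mB ->] [C mC ->]; exists (fun i => B i `&` C i).
    by move=> i; exact: measurableI.
  exact: boxI.
- by move=> _; exists (fun=> setT) => //; apply/seteqP; split.
- by apply/seteqP; split => // t _; exists 0%N.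
- by move=> _ [B mB ->]; exact: m12.
Qed.

Lemma power_measure_box d (T : measurableType d)
    (mu : {sigma_finite_measure set T -> \bar R}) n (B : 'I_n -> set T) :
  (forall i, measurable (B i)) ->
  power_measure mu n (box B) = \prod_(i < n) mu (B i).
Proof.
elim: n B => [|n IHn] B mB.
  rewrite big_ord0 /= diracE mem_set//= => -[]//.
rewrite big_ord_recl /= /pushforward.
rewrite (_ : _ @^-1` _ = B ord0 `*` box (fun i => B (lift ord0 i))); last first.
  apply/seteqP; split => -[x t] /=.
    move=> Bt; split; first exact: (Bt ord0).
    by move=> i /=; have := Bt (lift ord0 i); rewrite tnthS.
  move=> [Bx Bt] i; case: (unliftP ord0 i) => [j|] ->; last exact: Bx.
  by rewrite tnthS; exact: Bt.
rewrite product_measure1E//; last exact: measurable_box.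
by congr (_ * _); exact: IHn.
Qed.

Lemma power_measure_setT d (T : measurableType d) (P : probability T R) n :
  power_measure P n setT = 1.
Proof.
rewrite (_ : setT = box (fun=> setT)); last by apply/seteqP; split.
rewrite power_measure_box// big1// => i _; exact: probability_setT.
Qed.

Lemma power_measureP d (T : measurableType d) (P : probability T R) n :
  exists p : probability (n.-tuple T) R, power_measure P n = p.
Proof.
pose H := Measure_isProbability.Build _ _ _ (power_measure P n)
  (power_measure_setT P n).
pose p : probability (n.-tuple T) R := HB.pack (power_measure P n) H.
by exists p.
Qed.

Lemma pushforward_measureP d d' (T : measurableType d) (T' : measurableType d')
    (m : {measure set T -> \bar R}) (f : T -> T') :
  measurable_fun setT f ->
  exists m' : {measure set T' -> \bar R}, pushforward m f = m'.
Proof.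
by move=> mf; unshelve eexists (pushforward m f).
Qed.

Lemma pushforward_probabilityP d d' (T : measurableType d)
    (T' : measurableType d') (m : probability T R) (f : T -> T') :
  measurable_fun setT f ->
  exists m' : probability T' R, pushforward m f = m'.
Proof.
move=> mf; pose g : {mfun T >-> T'} := HB.pack f (isMeasurableFun.Build _ _ _ _ f mf).
by exists (distribution m g).
Qed.

(** The product formula on boxes is the form in which i.i.d. data arrive, and it already determines
    the whole law. Marginals, images and samples are identified with powers of a probability through
    it. *)
Lemma law_tuple d dO (T : measurableType d) (O : measurableType dO)
    (P : {measure set O -> \bar R}) (Q : probability T R) n (z : O -> n.-tuple T) :
  measurable_fun setT z ->
  (forall B, (forall i, measurable (B i)) ->
    P (z @^-1` box B) = \prod_(i < n) Q (B i)) ->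
  forall A, measurable A -> P (z @^-1` A) = power_measure Q n A.
Proof.
move=> mz zB A mA.
have [p pE] := pushforward_measureP P mz.
rewrite -[LHS]/(pushforward P z A) pE.
apply: tuple_measure_unique => //.
  move=> B mB; rewrite -pE /pushforward zB//.
  by apply/esym; exact: power_measure_box.
rewrite -pE (_ : setT = box (fun=> setT)); last by apply/seteqP; split.
by rewrite /pushforward zB// big1 ?ltry// => i _; exact: probability_setT.
Qed.

(* Coordinates outside the range of t are unconstrained and contribute
   Q setT = 1. *)
Lemma box_subtuple d (T : measurableType d) (Q : probability T R) m n
    (t : 'I_m -> 'I_n) (B : 'I_m -> set T) :
  injective t -> (forall i, measurable (B i)) ->
  exists2 C : 'I_n -> set T, (forall i, measurable (C i)) &
    (forall z : n.-tuple T, (forall i, B i (tnth z (t i))) <-> box C z) /\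
    \prod_(i < n) Q (C i) = \prod_(i < m) Q (B i).
Proof.
move=> tI mB.
pose C j := if [pick i | t i == j] is Some i then B i else setT.
have CE i : C (t i) = B i.
  rewrite /C; case: pickP => [k /eqP /tI -> //|/(_ i)].
  by rewrite eqxx.
exists C; first by move=> i; rewrite /C; case: pickP.
split.
  move=> z; split=> [Bz j|Cz i]; last by rewrite -CE; exact: Cz.
  by rewrite /C; case: pickP => // i /eqP <-.
transitivity (\prod_(j in codom t) Q (C j)).
  rewrite [LHS](bigID (mem (codom t)))/= [X in _ * X]big1 ?mule1//.
  move=> j jt; rewrite /C; case: pickP => [i /eqP ij|_]; last exact: probability_setT.
  by rewrite -ij codom_f in jt.
transitivity (\prod_(j <- codom t) Q (C j)).
  rewrite -big_uniq//.
  by rewrite /codom /image_mem map_inj_uniq// enum_uniq.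
by rewrite big_map big_enum; apply: eq_bigr => i _; rewrite CE.
Qed.

(** The extension from boxes goes one factor at a time: the second set is kept a box while the first
    becomes arbitrary, then the first is kept fixed. Each stage compares a restriction of [P] with a
    scalar multiple of a power by [tuple_measure_unique]. *)
Lemma law_product d1 d2 dO (T1 : measurableType d1) (T2 : measurableType d2)
    (O : measurableType dO) (P : {measure set O -> \bar R})
    (Q1 : probability T1 R) (Q2 : probability T2 R) m n
    (z1 : O -> m.-tuple T1) (z2 : O -> n.-tuple T2) :
  measurable_fun setT z1 -> measurable_fun setT z2 ->
  (forall B C, (forall i, measurable (B i)) -> (forall i, measurable (C i)) ->
    P (z1 @^-1` box B `&` z2 @^-1` box C) =
    \prod_(i < m) Q1 (B i) * \prod_(i < n) Q2 (C i)) ->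
  forall A, measurable A -> P ((fun w => (z1 w, z2 w)) @^-1` A) =
    (power_measure Q1 m \x power_measure Q2 n) A.
Proof.
move=> mz1 mz2 zBC.
have mz : measurable_fun setT (fun w => (z1 w, z2 w)).
  exact/measurable_fun_pair.
have [p pE] := pushforward_measureP P mz.
have PT : P setT < +oo.
  have := zBC (fun=> setT) (fun=> setT) (fun=> measurableT) (fun=> measurableT).
  rewrite (_ : box _ = setT); last by apply/seteqP; split.
  rewrite (_ : box _ = setT); last by apply/seteqP; split.
  rewrite !preimage_setT setTI => ->.
  rewrite !big1 ?mule1 ?ltry// => i _; exact: probability_setT.
have mpre d' (T' : measurableType d') (f : O -> T') A :
    measurable_fun setT f -> measurable A -> measurable (f @^-1` A).
  by move=> mf mA; rewrite -[X in measurable X]setTI; exact: mf.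
have step C : (forall i, measurable (C i)) -> forall A, measurable A ->
    P (z1 @^-1` A `&` z2 @^-1` box C) = power_measure Q1 m A * \prod_(i < n) Q2 (C i).
  move=> mC A mA.
  have mbC : measurable (z2 @^-1` box C) by apply: mpre => //; exact: measurable_box.
  have [q qE] := pushforward_measureP (mrestr P mbC) mz1.
  have c0 : (0%R <= fine (\prod_(i < n) Q2 (C i)))%R.
    by apply: fine_ge0; apply: prode_ge0 => i _; exact: measure_ge0.
  have cE : \prod_(i < n) Q2 (C i) = (fine (\prod_(i < n) Q2 (C i)))%:E.
    by rewrite fineK//; apply: prode_fin_num => i _; exact: fin_num_measure.
  pose c : {nonneg R} := NngNum c0.
  have -> : P (z1 @^-1` A `&` z2 @^-1` box C) = q A by rewrite -qE.
  rewrite cE muleC -[RHS]/(mscale c (power_measure Q1 m) A).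
  apply: tuple_measure_unique => //.
  - move=> B mB; rewrite -qE -[LHS]/(P (z1 @^-1` box B `&` z2 @^-1` box C)) zBC//.
    by rewrite muleC; congr (_ * _); [|apply/esym; exact: power_measure_box].
  - rewrite -qE -[X in X < _]/(P (z1 @^-1` setT `&` z2 @^-1` box C)).
    rewrite preimage_setT setTI; apply: le_lt_trans PT.
    by apply: le_measure; rewrite ?inE.
have step2 A B : measurable A -> measurable B ->
    p (A `*` B) = power_measure Q1 m A * power_measure Q2 n B.
  move=> mA mB.
  have mbA : measurable (z1 @^-1` A) by exact: mpre.
  have [q qE] := pushforward_measureP (mrestr P mbA) mz2.
  have [q1 q1E] := power_measureP Q1 m.
  have c0 : (0%R <= fine (q1 A))%R by exact: fine_ge0.
  have cE : q1 A = (fine (q1 A))%:E by rewrite fineK// fin_num_measure.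
  pose c : {nonneg R} := NngNum c0.
  have -> : p (A `*` B) = q B by rewrite -pE -qE /pushforward/= /mrestr setIC.
  rewrite q1E cE -[RHS]/(mscale c (power_measure Q2 n) B).
  apply: tuple_measure_unique => //.
  - move=> C mC; rewrite -qE -[LHS]/(P (z2 @^-1` box C `&` z1 @^-1` A)) setIC step//.
    rewrite q1E cE; congr (_ * _).
    by apply/esym; exact: power_measure_box.
  - rewrite -qE -[X in X < _]/(P (z2 @^-1` setT `&` z1 @^-1` A)).
    rewrite preimage_setT setTI; apply: le_lt_trans PT.
    by apply: le_measure; rewrite ?inE.
move=> A mA; rewrite -[LHS]/(pushforward P (fun w => (z1 w, z2 w)) A) pE.
by apply/esym/product_measure_unique.
Qed.

Definition subtuple {T : Type} m n (t : 'I_m -> 'I_n) (z : n.-tuple T) :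
  m.-tuple T := [tuple tnth z (t i) | i < m].

Lemma measurable_subtuple d (T : measurableType d) m n (t : 'I_m -> 'I_n) :
  measurable_fun setT (subtuple t : n.-tuple T -> m.-tuple T).
Proof.
apply/measurable_fun_tnthP => i.
rewrite (_ : _ \o _ = (@tnth _ T)^~ (t i)); first exact: measurable_tnth.
by apply/funext => z /=; rewrite tnth_mktuple.
Qed.

Lemma measurable_map_tuple d d' (T : measurableType d) (T' : measurableType d')
    n (f : T -> T') : measurable_fun setT f ->
  measurable_fun setT (map_tuple f : n.-tuple T -> n.-tuple T').
Proof.
move=> mf; apply/measurable_fun_tnthP => i.
rewrite (_ : _ \o _ = f \o (@tnth _ T)^~ i).
  by apply: measurableT_comp => //; exact: measurable_tnth.
by apply/funext => z /=; rewrite tnth_map.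
Qed.

(** Used with permutations [t], where it expresses the exchangeability of i.i.d. coordinates. *)
Lemma power_measure_subtuple d (T : measurableType d) (Q : probability T R) m n
    (t : 'I_m -> 'I_n) : injective t -> forall A, measurable A ->
  power_measure Q n (subtuple t @^-1` A) = power_measure Q m A.
Proof.
move=> tI; apply: law_tuple => [|B mB]; first exact: measurable_subtuple.
have [C mC [CE <-]] := box_subtuple Q tI mB.
rewrite -power_measure_box//; congr (power_measure _ _ _); apply/seteqP.
split=> z /= zB; first by apply/CE => i; have := zB i; rewrite tnth_mktuple.
by move=> i; rewrite tnth_mktuple; exact: (CE z).2.
Qed.

Lemma power_measure_subtuple2 d (T : measurableType d) (Q : probability T R)
    m m' n (t : 'I_m -> 'I_n) (t' : 'I_m' -> 'I_n) :
  injective t -> injective t' -> (forall i j, t i != t' j) ->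
  forall A, measurable A ->
  power_measure Q n ((fun z => (subtuple t z, subtuple t' z)) @^-1` A) =
  (power_measure Q m \x power_measure Q m') A.
Proof.
move=> tI tI' tt'; apply: law_product => [||B B' mB mB'];
  [exact: measurable_subtuple|exact: measurable_subtuple|].
(* Gluing [t] and [t'] into one injective index map turns independence of two disjoint blocks into a
   single instance of [box_subtuple]. *)
pose u (i : 'I_(m + m')) := match fintype.split i with inl a => t a | inr b => t' b end.
pose D (i : 'I_(m + m')) := match fintype.split i with inl a => B a | inr b => B' b end.
have uI : injective u.
  move=> i j; rewrite /u.
  case: (splitP i) => a ia; case: (splitP j) => b jb.
  - by move/tI => ab; apply/val_inj; rewrite /= ia jb ab.
  - by move/eqP; rewrite (negbTE (tt' _ _)).
  - by move/esym/eqP; rewrite (negbTE (tt' _ _)).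
  - by move/tI' => ab; apply/val_inj; rewrite /= ia jb ab.
have mD i : measurable (D i) by rewrite /D; case: (fintype.split i).
have [C mC [CE]] := box_subtuple Q uI mD.
rewrite big_split_ord/=.
rewrite (eq_bigr (fun i => Q (B i))); last first.
  by move=> i _; rewrite /D (unsplitK (inl i : 'I_m + 'I_m')).
rewrite [X in _ * X](eq_bigr (fun i => Q (B' i))); last first.
  by move=> i _; rewrite /D (unsplitK (inr i : 'I_m + 'I_m')).
move=> <-; rewrite -power_measure_box//; congr (power_measure _ _ _).
apply/seteqP; split=> z /=.
  move=> [Bz Bz']; apply/CE => i; rewrite /D /u; case: (fintype.split i) => j.
    by have := Bz j; rewrite tnth_mktuple.
  by have := Bz' j; rewrite tnth_mktuple.
move=> /CE Dz; split => i; rewrite tnth_mktuple.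
  by have := Dz (lshift m' i); rewrite /D /u (unsplitK (inl i : 'I_m + 'I_m')).
by have := Dz (rshift m i); rewrite /D /u (unsplitK (inr i : 'I_m + 'I_m')).
Qed.

(** A sample of independent pairs is a pair of independent samples: on boxes, both sides are the
    same product of marginal masses, grouped by index or by component. *)
Lemma power_measure_unzip d1 d2 (T1 : measurableType d1)
    (T2 : measurableType d2) (Q : probability (T1 * T2)%type R)
    (P1 : probability T1 R) (P2 : probability T2 R) n :
  (forall A B, measurable A -> measurable B -> Q (A `*` B) = P1 A * P2 B) ->
  forall A, measurable A ->
  power_measure Q n ((fun z => (map_tuple fst z, map_tuple snd z)) @^-1` A) =
  (power_measure P1 n \x power_measure P2 n) A.
Proof.
move=> QE; apply: law_product => [||B C mB mC];
  [exact: measurable_map_tuple|exact: measurable_map_tuple|].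
rewrite -big_split/= (eq_bigr (fun i => Q (B i `*` C i))); last first.
  by move=> i _; rewrite QE.
rewrite -power_measure_box; last by move=> i; exact: measurableX.
congr (power_measure _ _ _); apply/seteqP; split=> z /=.
  by move=> [Bz Cz] i; have := Bz i; have := Cz i; rewrite !tnth_map.
by move=> BCz; split=> i; rewrite tnth_map; have [] := BCz i.
Qed.

Lemma power_measure_pushforward d1 d2 (T1 : measurableType d1)
    (T2 : measurableType d2) (P1 : probability T1 R) (P2 : probability T2 R)
    (f : T1 -> T2) n : measurable_fun setT f ->
  (forall A, measurable A -> P2 A = P1 (f @^-1` A)) ->
  forall A, measurable A ->
  power_measure P1 n (map_tuple f @^-1` A) = power_measure P2 n A.
Proof.
move=> mf P2E; apply: law_tuple => [|B mB]; first exact: measurable_map_tuple.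
rewrite [RHS](eq_bigr (fun i => P1 (f @^-1` B i))); last by move=> i _; rewrite P2E.
rewrite -power_measure_box; last first.
  by move=> i; rewrite -[X in measurable X]setTI; exact: mf.
congr (power_measure _ _ _); apply/seteqP; split=> z /= Bz i.
  by have := Bz i; rewrite tnth_map.
by rewrite tnth_map; exact: Bz.
Qed.

Lemma ae_power_measure d (T : measurableType d) (P : probability T R) n
    (p : T -> Prop) : {ae P, forall x, p x} ->
  {ae power_measure P n, forall z, forall i, p (tnth z i)}.
Proof.
move=> [N [mN PN Np]].
have PNc : P (~` N) = 1 by rewrite probability_setC// PN sube0.
exists (~` box (fun=> ~` N)); split.
- by apply: measurableC; apply: measurable_box => _; exact: measurableC.
- have [q qE] := power_measureP P n.
  rewrite qE probability_setC; last by apply: measurable_box => _; exact: measurableC.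
  have : q (box (fun=> ~` N)) = 1.
    rewrite -qE power_measure_box; last by move=> _; exact: measurableC.
    by rewrite big1// => i _; exact: PNc.
  by move=> ->; rewrite subee.
- move=> z /= pz zN; apply: pz => i.
  by apply: contrapT => pi; exact: (zN i (Np _ pi)).
Qed.

End tuple_laws.

(** * Lebesgue measure *)

Section borel_rV.
Context {R : realType}.

Definition rbox {T : Type} n (B : 'I_n -> set T) : set 'rV[T]_n :=
  [set x | forall i, B i (x ord0 i)].

Lemma measurable_preimage d d' (T : measurableType d) (T' : measurableType d')
    (f : T -> T') A :
  measurable_fun setT f -> measurable A -> measurable (f @^-1` A).
Proof. by move=> mf mA; rewrite -[X in measurable X]setTI; exact: mf. Qed.

Lemma measurable_rbox d (T : measurableType d) n (B : 'I_n -> set T) :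
  (forall i, measurable (B i)) -> measurable (rbox B).
Proof.
move=> mB.
rewrite (_ : rbox B =
    \bigcap_(i in [set: 'I_n]) ((fun x : 'rV[T]_n => x ord0 i) @^-1` B i)).
  apply: fin_bigcap_measurable => // i _.
  by apply: measurable_preimage => //; exact: measurable_coord.
by apply/seteqP; split => t /= Bt i; [move=> _|]; exact: Bt.
Qed.

(** Rows carry the sigma-algebra of coordinates and the sup-norm topology; the two are linked
    because an open set is the union of the countably many boxes with rational corners that it
    contains. *)
Lemma open_measurable_rV n (U : set 'rV[R]_n) : open U -> measurable U.
Proof.
move=> oU.
pose D (q : 'rV[rat]_n * 'rV[rat]_n) : set 'rV[R]_n :=
  rbox (fun i => `](ratr (q.1 ord0 i) : R), ratr (q.2 ord0 i)[%classic).
have mD q : measurable (D q) by apply: measurable_rbox => i.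
rewrite (_ : U = \bigcup_(q in [set q | D q `<=` U]) D q); last first.
  apply/seteqP; split; last by move=> x [q /= qU Dqx]; exact: qU.
  move=> x Ux; have /nbhs_ballP[e /= e0 xeU] := oU x Ux.
  have q1 i : exists q : rat, (ratr q : R) \in `]x ord0 i - e, x ord0 i[.
    by apply: rat_in_itvoo; rewrite ltrBlDr ltrDl.
  have q2 i : exists q : rat, (ratr q : R) \in `]x ord0 i, x ord0 i + e[.
    by apply: rat_in_itvoo; rewrite ltrDl.
  have [f fP] := choice q1; have [g gP] := choice q2.
  exists (\row_i f i, \row_i g i) => /=.
    move=> y Dy; apply: xeU; split => // i j; rewrite (ord1 i) /ball/=.
    have := Dy j; rewrite /= !mxE in_itv/= => /andP[fy yg].
    have := fP j; have := gP j; rewrite !in_itv/= => /andP[_ ge] /andP[fe _].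
    rewrite ltr_distlC.
    by rewrite (lt_trans fe fy) (lt_trans yg ge).
  move=> i; rewrite /= !mxE in_itv/=.
  by have := fP i; have := gP i; rewrite !in_itv/= => /andP[-> _] /andP[_ ->].
rewrite bigcup_mkcond; apply: countable_bigcupT_measurable => [|q].
  exact: countableP.
by case: ifP.
Qed.

End borel_rV.


Section lebesgue_rV_theory.
Local Open Scope ereal_scope.
Context {R : realType}.
Local Notation mu1 := (@lebesgue_measure R).

Lemma lebesgue_rV_box n (B : 'I_n -> set R) : (forall i, measurable (B i)) ->
  lebesgue_rV n (rbox B) = \prod_(i < n) mu1 (B i).
Proof.
move=> mB; rewrite -[RHS](@power_measure_box _ _ (measurableTypeR R) mu1)//.
congr (power_measure _ _ _); apply/seteqP.
by split=> t /= Bt i; have := Bt i; rewrite mxE.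
Qed.

Lemma lebesgue_rV_unique n (m : {measure set 'rV[R]_n -> \bar R}) :
  (forall B, (forall i, measurable (B i)) -> m (rbox B) = \prod_(i < n) mu1 (B i)) ->
  forall A, measurable A -> m A = lebesgue_rV n A.
Proof.
move=> mE A mA.
pose G : set (set 'rV[R]_n) :=
  [set A | exists2 B, (forall i, measurable (B i)) & A = rbox B].
pose g k : set 'rV[R]_n := rbox (fun=> `]- k%:R, k%:R[%classic)%R.
apply: (measure_unique G g) => //.
- apply/seteqP; split.
    apply: smallest_sub; first exact: smallest_sigma_algebra.
    move=> C; rewrite -bigcup_seq/= => -[i _] [B mB <-]; rewrite setTI.
    apply: sub_sigma_algebra; exists (fun j => if j == i then B else setT).
      by move=> j; case: ifP.
    apply/seteqP; split => t /=.
      by move=> Bt j; case: eqP => [->|].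
    by move=> /(_ i); rewrite eqxx.
  apply: smallest_sub; first exact: sigma_algebra_measurable.
  by move=> _ [B mB ->]; exact: measurable_rbox.
- move=> _ _ [B mB ->] [C mC ->]; exists (fun i => B i `&` C i).
    by move=> i; exact: measurableI.
  apply/seteqP; split=> t /=; first by move=> [At Bt] i; split.
  by move=> ABt; split=> i; have [] := ABt i.
- by move=> k; exists (fun=> `]- k%:R, k%:R[%classic)%R => // i; exact: measurable_itv.
- apply/seteqP; split => // x _.
  exists (Num.truncn (\big[Num.max/0%R]_(i < n) `|x ord0 i|%R)).+1 => // i.
  rewrite /= in_itv/= -ltr_norml.
  apply: le_lt_trans (truncnS_gt _).
  exact: (le_bigmax _ (fun i => `|x ord0 i|%R)).
- by move=> _ [B mB ->]; rewrite mE//; apply/esym; exact: lebesgue_rV_box.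
- move=> k; rewrite mE; last by move=> i; exact: measurable_itv.
  rewrite ltey_eq prode_fin_num// => i _.
  by rewrite lebesgue_measure_itv/=; case: ifP.
Qed.

Lemma lebesgue_measure_shift (v : R) (A : set R) : measurable A ->
  mu1 ((fun x => x + v)%R @^-1` A) = mu1 A.
Proof.
move=> mA.
pose f (x : measurableTypeR R) : measurableTypeR R := (x + v)%R.
have mf : measurable_fun setT f by apply: measurable_funD.
have [m mE] := pushforward_measureP mu1 mf.
rewrite -[LHS]/(pushforward mu1 f A) mE.
apply/esym/lebesgue_measure_unique => // _ [[a b] _ <-].
rewrite -mE /pushforward/=.
rewrite (_ : _ @^-1` _ = `](a - v), (b - v)]%classic)%R.
  by rewrite !lebesgue_measure_itv/= !lte_fin ltrD2r -!EFinB opprB addrA subrK.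
by apply/seteqP; split => x /=; rewrite !in_itv/= ltrBlDr lerBrDr.
Qed.

Lemma lebesgue_rV_shift n (v : 'rV[R]_n) A : measurable A ->
  lebesgue_rV n ((fun x => x + v)%R @^-1` A) = lebesgue_rV n A.
Proof.
move=> mA.
have mf : measurable_fun setT (fun x : 'rV[R]_n => x + v)%R.
  apply: measurable_fun_row => i; under eq_fun do rewrite mxE.
  by apply: measurable_funD => //; exact: measurable_coord.
have [m mE] := pushforward_measureP (lebesgue_rV n) mf.
rewrite -[LHS]/(pushforward (lebesgue_rV n) (fun x => x + v)%R A) mE.
apply: lebesgue_rV_unique => // B mB; rewrite -mE /pushforward.
rewrite (_ : _ @^-1` _ = rbox (fun i => (fun x => x + v ord0 i)%R @^-1` B i)).
  transitivity (\prod_(i < n) mu1 ((fun x => x + v ord0 i)%R @^-1` B i)).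
    apply: lebesgue_rV_box => i; apply: measurable_preimage => //.
    exact: measurable_funD.
  by apply: eq_bigr => i _; exact: lebesgue_measure_shift.
by apply/seteqP; split=> x /= Bx i; have := Bx i; rewrite mxE.
Qed.

(** It has measure one, hence serves to normalise translation-invariant measures. *)
Definition unit_cube n : set 'rV[R]_n := rbox (fun=> `]0%R, 1%R[%classic).

Lemma lebesgue_rV_unit_cube n : lebesgue_rV n (@unit_cube n) = 1.
Proof.
rewrite lebesgue_rV_box; last by move=> i; exact: measurable_itv.
by rewrite big1// => i _; rewrite lebesgue_measure_itv/= lte01 oppr0 adde0.
Qed.

Lemma measure_section_swap d1 d2 (T1 : measurableType d1)
    (T2 : measurableType d2) (m1 : {sigma_finite_measure set T1 -> \bar R})
    (m2 : {sigma_finite_measure set T2 -> \bar R}) (E : set (T1 * T2)) :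
  measurable E ->
  \int[m1]_x m2 [set y | E (x, y)] = \int[m2]_y m1 [set x | E (x, y)].
Proof.
move=> mE; have := indic_fubini_tonelli m1 m2 mE.
rewrite indic_fubini_tonelli_FE// indic_fubini_tonelli_GE//.
move=> h; transitivity (\int[m1]_x (m2 \o xsection E) x).
  by apply: eq_integral => x _; congr (m2 _); apply/seteqP; split=> y /=;
    rewrite /xsection/= inE.
rewrite h; apply: eq_integral => y _; congr (m1 _); apply/seteqP.
by split=> x /=; rewrite /ysection/= inE.
Qed.

Lemma measurable_shift n (v : 'rV[R]_n) (A : set 'rV[R]_n) : measurable A ->
  measurable ((fun x => x + v)%R @^-1` A).
Proof.
move=> mA; apply: measurable_preimage => //.
apply: measurable_fun_row => i; under eq_fun do rewrite mxE.
by apply: measurable_funD => //; exact: measurable_coord.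
Qed.

(* Both sides are the mass of {(x, y) | x \in A, x + y \in B}, computed by
   integrating over y first, resp. over x first after the shift x -> x - y. *)
Lemma shift_invariant_swap n
    (mu nu : {sigma_finite_measure set 'rV[R]_n -> \bar R}) A B :
  (forall (v : 'rV[R]_n) (C : set 'rV[R]_n), measurable C ->
    mu ((fun x => x + v)%R @^-1` C) = mu C) ->
  (forall (v : 'rV[R]_n) (C : set 'rV[R]_n), measurable C ->
    nu ((fun x => x + v)%R @^-1` C) = nu C) ->
  measurable A -> measurable B ->
  mu A * nu B = mu B * nu ((fun x => - x)%R @^-1` A).
Proof.
move=> muS nuS mA mB.
have mD : measurable_fun setT (fun z : 'rV[R]_n * 'rV[R]_n => z.1 + z.2)%R.
  apply: measurable_fun_row => i; under eq_fun do rewrite mxE.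
  by apply: measurable_funD => //; apply: measurableT_comp (measurable_coord i) _.
have mN : measurable_fun setT (fun z : 'rV[R]_n => - z)%R.
  apply: measurable_fun_row => i; under eq_fun do rewrite mxE.
  by apply: measurableT_comp => //; exact: measurable_coord.
have mNA := measurable_preimage mN mA.
have mfst C : measurable C -> measurable [set z : 'rV[R]_n * 'rV[R]_n | C z.1].
  by move=> mC; exact: (measurable_preimage measurable_fst).
have int_cst (m : {sigma_finite_measure set 'rV[R]_n -> \bar R}) C (c : \bar R) :
    measurable C -> 0 <= c -> \int[m]_x ((\1_C x)%:E * c) = m C * c.
  move=> mC c0; rewrite ge0_integralZr//.
  - by rewrite integral_indic// setIT.
  - by apply/measurable_EFinP; exact: measurable_indic.
transitivity (\int[mu]_x nu [set y | A x /\ B (x + y)%R]).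
  rewrite -int_cst//; apply: eq_integral => x _; rewrite indicE.
  have [xA|xA] := pselect (A x).
    rewrite mem_set// mul1e -(nuS x)//; congr (nu _); apply/seteqP.
    by split => y /=; rewrite addrC; [|case].
  rewrite memNset// mul0e (_ : [set _ | _] = set0) ?measure0//.
  by apply/seteqP; split => y //= -[].
have mE1 : measurable [set z : 'rV[R]_n * 'rV[R]_n | A z.1 /\ B (z.1 + z.2)%R].
  by apply: measurableI; [exact: mfst|exact: (measurable_preimage mD)].
rewrite (measure_section_swap mu nu mE1)/=.
have mE2 : measurable [set z : 'rV[R]_n * 'rV[R]_n | B z.1 /\ A (z.1 - z.2)%R].
  apply: measurableI; first exact: mfst.
  have mS : measurable_fun setT (fun z : 'rV[R]_n * 'rV[R]_n => (z.1, - z.2)%R).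
    by apply/measurable_fun_pair => //; exact: measurableT_comp.
  exact: (measurable_preimage (measurableT_comp mD mS)).
transitivity (\int[nu]_y mu [set x | B x /\ A (x - y)%R]).
  apply: eq_integral => y _; rewrite -[RHS](muS y).
    by congr (mu _); apply/seteqP; split=> x /=; rewrite addrK => -[].
  apply: measurableI => //; exact: measurable_shift.
rewrite -(measure_section_swap mu nu mE2)/= -int_cst//.
apply: eq_integral => x _; rewrite indicE.
have [xB|xB] := pselect (B x).
  rewrite mem_set// mul1e -(nuS (- x)%R)//; congr (nu _); apply/seteqP.
  by split => y /=; rewrite opprB; [case|].
rewrite memNset// mul0e (_ : [set _ | _] = set0) ?measure0//.
by apply/seteqP; split => y //= -[].
Qed.

(** Uniqueness of the translation-invariant measure up to a factor. The swap identity with the unit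
    cube expresses [mu A] by the volume of the reflection of [A]; the same identity with Lebesgue
    measure on both sides removes the reflection. *)
Lemma shift_invariantE n (mu : {sigma_finite_measure set 'rV[R]_n -> \bar R}) A :
  (forall (v : 'rV[R]_n) (C : set 'rV[R]_n), measurable C ->
    mu ((fun x => x + v)%R @^-1` C) = mu C) ->
  measurable A -> mu A = mu (@unit_cube n) * lebesgue_rV n A.
Proof.
move=> muS mA.
have mC : measurable (@unit_cube n).
  by apply: measurable_rbox => i; exact: measurable_itv.
have := shift_invariant_swap muS (@lebesgue_rV_shift n) mA mC.
have := shift_invariant_swap (@lebesgue_rV_shift n) (@lebesgue_rV_shift n) mA mC.
by rewrite /= !lebesgue_rV_unit_cube mul1e !mule1 => -> ->.
Qed.

(** The translates of [E] along [v] all have the measure of [E]. Integrated over all real [t] they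
    give infinity times that measure, whereas Tonelli in the other order integrates null lines. *)
Lemma lines_null n (v : 'rV[R]_n) (E : set 'rV[R]_n) : measurable E ->
  (forall x, mu1 [set t | E (x + t *: v)%R] = 0) -> lebesgue_rV n E = 0.
Proof.
move=> mE lE.
have mf : measurable_fun setT (fun z : measurableTypeR R * 'rV[R]_n => z.2 + z.1 *: v)%R.
  apply: measurable_fun_row => i; under eq_fun do rewrite !mxE.
  apply: measurable_funD; last exact: measurable_funM.
  by apply: measurableT_comp (measurable_coord i) _.
have := measure_section_swap mu1 (lebesgue_rV n) (measurable_preimage mf mE).
rewrite /= [RHS]integral0_eq; last by move=> x _; exact: lE.
rewrite (eq_integral (cst (lebesgue_rV n E))); last first.
  by move=> t _; exact: (lebesgue_rV_shift (t *: v)).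
rewrite integral_cst//.
rewrite [X in _ * X](_ : _ = +oo); last first.
  by rewrite -[RHS](lebesgue_measure_itv `]-oo, +oo[) set_itvNyy.
have := measure_ge0 (lebesgue_rV n) E; rewrite le_eqVlt => /orP[/eqP <-//|E0].
by rewrite gt0_muley.
Qed.

End lebesgue_rV_theory.

Section euclidean_theory.
Context {R : realType} {n : nat}.
Implicit Types (x y : 'rV[R]_n) (O : 'M[R]_n).

Lemma dotvC x y : dotv x y = dotv y x.
Proof. by apply: eq_bigr => i _; rewrite mulrC. Qed.

Lemma dotvDl x y z : dotv (x + y) z = dotv x z + dotv y z.
Proof. by rewrite /dotv -big_split/=; apply: eq_bigr => i _; rewrite mxE mulrDl. Qed.

Lemma dotvZl a x y : dotv (a *: x) y = a * dotv x y.
Proof. by rewrite /dotv mulr_sumr; apply: eq_bigr => i _; rewrite mxE mulrA. Qed.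

Lemma dotvNl x y : dotv (- x) y = - dotv x y.
Proof. by rewrite -scaleN1r dotvZl mulN1r. Qed.

Lemma dotvBl x y z : dotv (x - y) z = dotv x z - dotv y z.
Proof. by rewrite dotvDl dotvNl. Qed.

Lemma dotvDr x y z : dotv x (y + z) = dotv x y + dotv x z.
Proof. by rewrite ![dotv x _]dotvC dotvDl. Qed.

Lemma dotvZr a x y : dotv x (a *: y) = a * dotv x y.
Proof. by rewrite ![dotv x _]dotvC dotvZl. Qed.

Lemma dotvBr x y z : dotv x (y - z) = dotv x y - dotv x z.
Proof. by rewrite ![dotv x _]dotvC dotvBl. Qed.

Lemma dotv_delta x i : dotv x (delta_mx ord0 i) = x ord0 i.
Proof.
rewrite /dotv (bigD1 i)//= mxE !eqxx mulr1 big1 ?addr0// => j ji.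
by rewrite mxE (negbTE ji) andbF mulr0.
Qed.

Lemma dotv_mulmx O x y : dotv (x *m O) y = dotv x (y *m O^T).
Proof.
have E (u v : 'rV[R]_n) : dotv u v = (u *m v^T) ord0 ord0.
  by rewrite mxE; apply: eq_bigr => i _; rewrite mxE.
by rewrite !E trmx_mul trmxK mulmxA.
Qed.

Lemma dotv_ge0 x : 0 <= dotv x x.
Proof. by apply: sumr_ge0 => i _; rewrite -expr2 sqr_ge0. Qed.

Lemma dotv_eq0 x : (dotv x x == 0) = (x == 0).
Proof.
apply/eqP/eqP => [x0|->]; last by rewrite /dotv big1// => i _; rewrite mxE mulr0.
apply/rowP => i; rewrite mxE.
have := x0 => /eqP; rewrite psumr_eq0; last by move=> j _; rewrite -expr2 sqr_ge0.
by move=> /allP/(_ i); rewrite mem_index_enum => /(_ isT); rewrite mulf_eq0 orbb => /eqP.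
Qed.

Lemma enorm_ge0 x : 0 <= enorm x.
Proof. exact: sqrtr_ge0. Qed.

Lemma sqr_enorm x : enorm x ^+ 2 = dotv x x.
Proof. by rewrite sqr_sqrtr// dotv_ge0. Qed.

Lemma enorm_eq0 x : (enorm x == 0) = (x == 0).
Proof. by rewrite -sqrf_eq0 sqr_enorm dotv_eq0. Qed.

Lemma enorm0 : enorm (0 : 'rV[R]_n) = 0.
Proof. by apply/eqP; rewrite enorm_eq0. Qed.

Lemma enormZ a x : enorm (a *: x) = `|a| * enorm x.
Proof.
by rewrite /enorm dotvZl dotvZr mulrA -expr2 sqrtrM ?sqr_ge0// sqrtr_sqr.
Qed.

Lemma ler_enorm x i : `|x ord0 i| <= enorm x.
Proof.
rewrite -sqrtr_sqr ler_wsqrtr// expr2 /dotv (bigD1 i)//= lerDl.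
by apply: sumr_ge0 => j _; rewrite -expr2 sqr_ge0.
Qed.

Lemma orthogonal_mxV O : orthogonal_mx O -> O^T *m O = 1%:M.
Proof. exact: mulmx1C. Qed.

Lemma orthogonal_mx_tr O : orthogonal_mx O -> orthogonal_mx O^T.
Proof. by move=> /orthogonal_mxV; rewrite /orthogonal_mx trmxK. Qed.

Lemma enorm_orthogonal O x : orthogonal_mx O -> enorm (x *m O) = enorm x.
Proof. by move=> oO; rewrite /enorm dotv_mulmx -mulmxA oO mulmx1. Qed.

Lemma measurable_dotv d (T : measurableType d) (f g : T -> 'rV[R]_n) :
  measurable_fun setT f -> measurable_fun setT g ->
  measurable_fun setT (fun t => dotv (f t) (g t)).
Proof.
move=> mf mg; apply: measurable_sum => i.
by apply: measurable_funM; apply: measurableT_comp (measurable_coord i) _.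
Qed.

Lemma measurable_enorm : measurable_fun setT (@enorm R n).
Proof.
apply: measurableT_comp; last exact: measurable_dotv.
by apply: continuous_measurable_fun; exact: sqrt_continuous.
Qed.

Lemma measurable_rVZ d (T : measurableType d) (a : T -> R) (f : T -> 'rV[R]_n) :
  measurable_fun setT a -> measurable_fun setT f ->
  measurable_fun setT (fun t => a t *: f t).
Proof.
move=> ma mf; apply: measurable_fun_row => i; under eq_fun do rewrite mxE.
by apply: measurable_funM => //; apply: measurableT_comp (measurable_coord i) _.
Qed.

Lemma measurable_rVD d (T : measurableType d) (f g : T -> 'rV[R]_n) :
  measurable_fun setT f -> measurable_fun setT g ->
  measurable_fun setT (fun t => f t + g t).
Proof.
move=> mf mg; apply: measurable_fun_row => i; under eq_fun do rewrite mxE.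
by apply: measurable_funD; apply: measurableT_comp (measurable_coord i) _.
Qed.

Lemma measurable_rVM d (T : measurableType d) p (f : T -> 'rV[R]_n)
    (M : 'M[R]_(n, p)) :
  measurable_fun setT f -> measurable_fun setT (fun t => f t *m M).
Proof.
move=> mf; apply: measurable_fun_row => i; under eq_fun do rewrite mxE.
apply: measurable_sum => j; apply: measurable_funM => //.
by apply: measurableT_comp (measurable_coord j) _.
Qed.

Lemma measurable_ball_rV : measurable (@open_unit_ball R n).
Proof.
rewrite (_ : open_unit_ball = @enorm R n @^-1` `]-oo, 1[%classic).
  by apply: measurable_preimage; [exact: measurable_enorm|exact: measurable_itv].
by apply/seteqP; split => x /=; rewrite in_itv.
Qed.

End euclidean_theory.

(** * Lebesgue measure under linear maps *)

Section linear_images.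
Local Open Scope ereal_scope.
Context {R : realType} {n : nat}.
Implicit Types (O M N : 'M[R]_n).

(** A linear image of Lebesgue measure is again translation invariant. The factor is left as the
    volume of the preimage of the unit cube; it is found from the cube for dilations and from the
    ball for orthogonal maps. *)
Lemma lebesgue_rV_linear M N (A : set 'rV[R]_n) : M *m N = 1%:M -> measurable A ->
  lebesgue_rV n ((mulmx^~ M : 'rV[R]_n -> 'rV[R]_n) @^-1` A) =
  lebesgue_rV n ((mulmx^~ M : 'rV[R]_n -> 'rV[R]_n) @^-1` @unit_cube R n)
    * lebesgue_rV n A.
Proof.
move=> MN mA; have NM := mulmx1C MN.
have mM K : measurable_fun setT (mulmx^~ K : 'rV[R]_n -> 'rV[R]_n).
  exact: measurable_rVM.
have [m mE] := @pushforward_sigma_finite _ _ _ _ _ (lebesgue_rV n) _ _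
  (mM M) (mM N) (fun x => etrans (esym (mulmxA x M N))
    (etrans (congr1 (mulmx x) MN) (mulmx1 x))) (sigma_finiteT _).
have := @shift_invariantE _ _ m A.
rewrite -mE /pushforward; apply => // v C mC.
rewrite -[RHS](lebesgue_rV_shift (v *m N)); last exact: measurable_preimage.
by congr (lebesgue_rV _ _); apply/seteqP; split=> x /=;
  rewrite mulmxDl -(mulmxA v) NM mulmx1.
Qed.

Lemma lebesgue_rV_linear_null M N (A : set 'rV[R]_n) : M *m N = 1%:M ->
  measurable A -> lebesgue_rV n A = 0 ->
  lebesgue_rV n ((mulmx^~ M : 'rV[R]_n -> 'rV[R]_n) @^-1` A) = 0.
Proof. by move=> MN mA A0; rewrite (lebesgue_rV_linear MN)// A0 mule0. Qed.

Lemma lebesgue_rV_scale (a : R) (A : set 'rV[R]_n) : (0 < a)%R -> measurable A ->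
  lebesgue_rV n ((fun x => a *: x)%R @^-1` A) = ((a ^- n)%:E * lebesgue_rV n A).
Proof.
move=> a0 mA.
have aE : (fun x : 'rV[R]_n => a *: x)%R = (mulmx^~ a%:M).
  by apply/funext => x; rewrite mul_mx_scalar.
have aV : (a%:M *m (a^-1)%:M = 1%:M :> 'M[R]_n)%R.
  by rewrite -scalar_mxM divff// gt_eqF.
rewrite aE (lebesgue_rV_linear aV)// -aE; congr (_ * _).
rewrite (_ : _ @^-1` _ = rbox (fun=> `]0%R, (a^-1)%R[%classic)); last first.
  apply/seteqP; split=> x /= xa i; have := xa i; rewrite /= !mxE !in_itv/=.
    by move=> /andP[]; rewrite pmulr_rgt0// => ->/=; rewrite -ltr_pdivlMl// mulr1.
  by move=> /andP[]; rewrite pmulr_rgt0// => ->/=; rewrite -ltr_pdivlMl// mulr1.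
rewrite lebesgue_rV_box; last by move=> i; exact: measurable_itv.
rewrite (eq_bigr (fun=> (a^-1)%:E)); last first.
  by move=> i _; rewrite lebesgue_measure_itv/= lte_fin invr_gt0 a0 oppr0 adde0.
by rewrite prodEFin prodr_const card_ord exprVn.
Qed.

(** The dilates of the ball by positive integers cover the space, so a null ball would make
    everything null, even the unit cube. *)
Lemma lebesgue_rV_ball_gt0 : 0 < lebesgue_rV n (@open_unit_ball R n).
Proof.
rewrite lt_neqAle measure_ge0 andbT; apply/negP => /eqP/esym B0.
have : lebesgue_rV n [set: 'rV[R]_n] = 0.
  rewrite (_ : setT = \bigcup_k ((fun x : 'rV[R]_n => (k.+1%:R^-1 *: x)%R) @^-1` open_unit_ball)).
    have mk k : measurable ((fun x : 'rV[R]_n => (k.+1%:R^-1 *: x)%R) @^-1` open_unit_ball).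
      by apply: measurable_preimage; [exact: measurable_rVZ|exact: measurable_ball_rV].
    apply/negligibleP; first exact: bigcup_measurable.
    apply: negligible_bigcup => k; apply/negligibleP; first exact: mk.
    have k0 : (0 < k.+1%:R^-1 :> R)%R by rewrite invr_gt0.
    by apply: etrans (lebesgue_rV_scale k0 measurable_ball_rV) _; rewrite B0 mule0.
  apply/seteqP; split => // x _; exists (Num.truncn (enorm x)) => //=.
  rewrite /open_unit_ball/= enormZ ger0_norm// ltr_pdivrMl// mulr1.
  exact: truncnS_gt.
move=> T0; have : lebesgue_rV n (@unit_cube R n) <= 0.
  rewrite -T0; apply: le_measure; rewrite ?inE//.
  by apply: measurable_rbox => i; exact: measurable_itv.
by rewrite lebesgue_rV_unit_cube lee_fin ler10.
Qed.

Lemma lebesgue_rV_ball_lty : lebesgue_rV n (@open_unit_ball R n) < +oo.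
Proof.
apply: (@le_lt_trans _ _ (lebesgue_rV n (rbox (fun=> `](-1)%R, 1%R[%classic)))).
  apply: le_measure; rewrite ?inE//.
  - exact: measurable_ball_rV.
  - by apply: measurable_rbox => i; exact: measurable_itv.
  - move=> x /= x1 i /=; rewrite in_itv/= -ltr_norml.
    by apply: le_lt_trans x1; exact: ler_enorm.
rewrite lebesgue_rV_box; last by move=> i; exact: measurable_itv.
rewrite ltey_eq prode_fin_num// => i _.
by rewrite lebesgue_measure_itv/=; case: ifP.
Qed.

(** The factor of [lebesgue_rV_linear] must be one because the unit ball is its own preimage and has
    positive finite volume. *)
Lemma lebesgue_rV_orthogonal O (A : set 'rV[R]_n) : orthogonal_mx O -> measurable A ->
  lebesgue_rV n ((mulmx^~ O : 'rV[R]_n -> 'rV[R]_n) @^-1` A) = lebesgue_rV n A.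
Proof.
move=> oO mA; rewrite (lebesgue_rV_linear oO)//.
have := lebesgue_rV_linear oO (@measurable_ball_rV R n).
rewrite (_ : _ @^-1` open_unit_ball = open_unit_ball); last first.
  by apply/seteqP; split=> x; rewrite /open_unit_ball/= enorm_orthogonal.
have := lebesgue_rV_ball_gt0; have := lebesgue_rV_ball_lty.
case: (lebesgue_rV n open_unit_ball) => [r||]//.
set c := lebesgue_rV n _; rewrite lte_fin => _ r0.
suff c1 : r%:E = c * r%:E -> c = 1 by move=> /c1 ->; rewrite mul1e.
have : 0 <= c by exact: measure_ge0.
case: c => [c||]//; last by rewrite gt0_mulye.
move=> _; rewrite -EFinM => -[] /esym/(canRL (mulfK _))->; rewrite ?gt_eqF//.
by rewrite divff// gt_eqF.
Qed.

Lemma lebesgue_rV_row_mx p (A : set 'rV[R]_(n + p)) : measurable A ->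
  (lebesgue_rV n \x lebesgue_rV p) ((fun z => row_mx z.1 z.2) @^-1` A) =
  lebesgue_rV (n + p) A.
Proof.
move=> mA.
have mf : measurable_fun setT
    (fun z : 'rV[R]_n * 'rV[R]_p => row_mx z.1 z.2 : 'rV[R]_(n + p)).
  apply: measurable_fun_row => i; case: (splitP i) => j ij.
    have -> : i = lshift p j by exact: val_inj.
    under eq_fun do rewrite row_mxEl.
    by apply: measurableT_comp (measurable_coord j) _.
  have -> : i = rshift n j by exact: val_inj.
  under eq_fun do rewrite row_mxEr.
  by apply: measurableT_comp (measurable_coord j) _.
have [m mE] := pushforward_measureP (lebesgue_rV n \x lebesgue_rV p) mf.
rewrite -[LHS]/(pushforward _ _ A) mE; apply: lebesgue_rV_unique => // B mB.
rewrite -mE /pushforward.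
rewrite (_ : _ @^-1` _ = rbox (fun i => B (lshift p i)) `*` rbox (fun i => B (rshift n i))).
  transitivity (lebesgue_rV n (rbox (fun i => B (lshift p i))) *
                lebesgue_rV p (rbox (fun i => B (rshift n i)))).
    by apply: product_measure1E; exact: measurable_rbox.
  by rewrite big_split_ord; congr (_ * _); exact: lebesgue_rV_box.
apply/seteqP; split=> -[x y] /=.
  by move=> Bxy; split=> i /=; [have := Bxy (lshift p i); rewrite row_mxEl|
    have := Bxy (rshift n i); rewrite row_mxEr].
move=> [Bx By] i; case: (splitP i) => j ij.
  by have -> : i = lshift p j; [exact: val_inj|rewrite row_mxEl; exact: Bx].
by have -> : i = rshift n j; [exact: val_inj|rewrite row_mxEr; exact: By].
Qed.

End linear_images.

(** * Gradients of convex functions *)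

Section subgradients.
Context {R : realType} {n : nat}.
Implicit Types (phi : 'rV[R]_n -> R) (x y g : 'rV[R]_n).

Definition subgradient phi x g := forall z, phi x + dotv g (z - x) <= phi z.

Lemma is_gradient_cvg phi x g h : is_gradient phi x g ->
  t^-1 * (phi (x + t *: h) - phi x) @[t --> 0^'+] --> dotv g h.
Proof.
move=> [dphi <-]; apply: cvg_dnbhs_at_right; rewrite -deriveE//.
have /(_ h) := diff_derivable dphi.
rewrite /derivable /derive => /cvg_ex[l fl].
rewrite (cvg_lim _ fl)//; move: fl; apply: cvg_trans; apply: near_eq_cvg.
by near=> t; rewrite /= [t *: h + x]addrC.
Unshelve. all: by end_near. Qed.

(** By convexity the difference quotient of step [t] in direction [z - x] is at most [phi z - phi x]
    for small [t > 0], and the bound passes to the limit. *)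
Lemma gradient_subgradient phi x g :
  convex_rV phi -> is_gradient phi x g -> subgradient phi x g.
Proof.
move=> cphi gphi z; rewrite -lerBrDl.
apply: (cvgr_to_le (is_gradient_cvg (h := z - x) gphi)).
near=> t.
have t0 : 0 < t by near: t; exact: nbhs_right_gt.
have t1 : t <= 1 by near: t; exact: nbhs_right_le.
have := cphi (Itv01 (ltW t0) t1) z x; rewrite !inE => /(_ I I).
rewrite -[X in phi X]/(t *: z + (1 - t) *: x).
rewrite -[X in _ <= X -> _]/(t * phi z + (1 - t) * phi x).
rewrite (_ : x + t *: (z - x) = t *: z + (1 - t) *: x); last first.
  by apply/rowP => i; rewrite !mxE; ring.
move=> c; rewrite ler_pdivrMl// mulrBr; lra.
Unshelve. all: by end_near. Qed.

(** A subgradient lies below the derivative in every direction; applied to a direction and its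
    opposite, the bound becomes an equality. *)
Lemma subgradient_unique phi x g g' :
  is_gradient phi x g -> subgradient phi x g' -> g' = g.
Proof.
move=> gphi sphi.
have le h : dotv g' h <= dotv g h.
  apply: (cvgr_to_ge (is_gradient_cvg (h := h) gphi)); near=> t.
  have t0 : 0 < t by near: t; exact: nbhs_right_gt.
  have := sphi (x + t *: h); rewrite [x + _]addrC addrK dotvZr.
  by rewrite ler_pdivlMl// lerBrDl.
apply/rowP => i; rewrite -!dotv_delta; apply/eqP; rewrite eq_le le/=.
by have := le (- delta_mx ord0 i); rewrite ![dotv _ (- _)]dotvC
  !dotvNl lerN2 ![dotv (delta_mx _ _) _]dotvC.
Unshelve. all: by end_near. Qed.

(** The Legendre-Fenchel transform, with extended values since the supremum can be infinite. *)
Definition conjugate phi y : \bar R :=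
  ereal_sup (range (fun x => (dotv x y - phi x)%:E)).

Lemma conjugate_ge phi x y : ((dotv x y - phi x)%:E <= conjugate phi y)%E.
Proof. by apply: ereal_sup_ubound; exists x. Qed.

(** Equality case of the Fenchel-Young inequality [conjugate_ge]: it trades a condition on all [z]
    for one value of the conjugate. *)
Lemma conjugate_subgradient phi x g :
  subgradient phi x g <-> conjugate phi g = (dotv x g - phi x)%:E.
Proof.
split=> [sphi|cphi z].
  apply/eqP; rewrite eq_le conjugate_ge andbT; apply: ge_ereal_sup.
  move=> _ [z _ <-]; rewrite lee_fin.
  by have := sphi z; rewrite dotvBr ![dotv g _]dotvC; lra.
have := conjugate_ge phi z g; rewrite cphi lee_fin.
by rewrite dotvBr ![dotv g _]dotvC; lra.
Qed.

Lemma continuous_dotv x : continuous (dotv x).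
Proof.
apply: continuous_big => [|i _]; first exact: add_continuous.
move=> y; apply: (@continuous_comp _ _ _ (fun y : 'rV[R]_n => y ord0 i) ( *%R (x ord0 i))).
  exact: coord_continuous.
exact: mulrl_continuous.
Qed.

(** The supremum runs over uncountably many [x], but the set where it exceeds a level is a union of
    open sets, hence open. *)
Lemma measurable_conjugate phi : measurable_fun setT (conjugate phi).
Proof.
apply: (measurability _ (ErealGenOInfty.measurableE R)).
move=> _ [_ [a ->] <-]; rewrite setTI.
rewrite (_ : _ @^-1` _ = \bigcup_x [set y | a < dotv x y - phi x]); last first.
  apply/seteqP; split=> y /=; rewrite in_itv/= andbT.
    move=> ay; apply: contrapT => nx.
    move: ay; apply/negP; rewrite -leNgt; apply: ge_ereal_sup => _ [x _ <-].
    rewrite lee_fin leNgt; apply/negP => ax.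
    by apply: nx; exists x.
  by move=> [x _ /= ax]; apply: lt_le_trans (conjugate_ge _ x _); rewrite lte_fin.
apply: open_measurable_rV; apply: bigcup_open => x _.
rewrite (_ : [set _ | _] = (fun y => dotv x y - phi x) @^-1` [set t | a < t])//.
apply: open_comp; last exact: open_gt.
by move=> y _; apply: continuousB; [exact: continuous_dotv|exact: cst_continuous].
Qed.

End subgradients.

Lemma negligible_bigcup_count d (T : measurableType d) (R : realType)
    (mu : {measure set T -> \bar R}) (I : countType) (F : I -> set T) :
  (forall i, mu.-negligible (F i)) -> mu.-negligible (\bigcup_i F i).
Proof.
move=> F0; pose G k := if unpickle k is Some i then F i else set0.
have FG : \bigcup_i F i `<=` \bigcup_k G k.
  by move=> x [i _ Fx]; exists (pickle i) => //; rewrite /G pickleK.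
apply: negligibleS FG _; apply: negligible_bigcup => k; rewrite /G.
by case: unpickle => [i|]; [exact: F0|exact: negligible_set0].
Qed.

(** * Uniqueness of a gradient map with prescribed image law *)

Section same_law.
Local Open Scope ereal_scope.
Context {R : realType} d (T : measurableType d) (P : probability T R).

Lemma ae_and (p q : T -> Prop) : {ae P, forall x, p x} -> {ae P, forall x, q x} ->
  {ae P, forall x, p x /\ q x}.
Proof. by apply: filterS2 => x; split. Qed.

Lemma ae_imp (p q : T -> Prop) : {ae P, forall x, p x} -> (forall x, p x -> q x) ->
  {ae P, forall x, q x}.
Proof. by move=> aep pq; move: aep; apply: filterS. Qed.

Lemma ae_measure_le (A B : set T) : measurable A -> measurable B ->
  {ae P, forall x, A x -> B x} -> P A <= P B.
Proof.
move=> mA mB [N [mN PN AB]]; rewrite -[P B]adde0 -PN.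
apply: le_trans (measureU2 _ mB mN).
apply: le_measure; rewrite ?inE//; first exact: measurableU.
move=> x Ax; have [Bx|nBx] := pselect (B x); [by left|right; apply: AB => /=].
by apply: contra_not nBx; exact.
Qed.

Lemma ae_measure_eq (A B : set T) : measurable A -> measurable B ->
  {ae P, forall x, A x <-> B x} -> P A = P B.
Proof.
move=> mA mB AB; apply/eqP; rewrite eq_le !ae_measure_le//.
  by apply: filterS AB => x [].
by apply: filterS AB => x [].
Qed.

(** Comparing means would ask for integrability. Instead, for each rational [q] the event
    [V <= q < W] is null, as the difference of two events of equal probability, one almost surely
    inside the other; these countably many events cover [V < W]. *)
Lemma same_law_le_ae_eq (V W : T -> R) :
  measurable_fun setT V -> measurable_fun setT W ->
  (forall A, measurable A -> P (V @^-1` A) = P (W @^-1` A)) ->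
  {ae P, forall x, (V x <= W x)%R} -> {ae P, forall x, V x = W x}.
Proof.
move=> mV mW VW leVW.
pose I (q : rat) : set R := `](ratr q), +oo[%classic.
have mI q : measurable (I q) by exact: measurable_itv.
have mVI q : measurable (V @^-1` I q) by exact: measurable_preimage.
have mWI q : measurable (W @^-1` I q) by exact: measurable_preimage.
have E0 q : P.-negligible (W @^-1` I q `\` V @^-1` I q).
  apply/negligibleP; first exact: measurableD.
  rewrite measureD//; last by rewrite -ge0_fin_numE// fin_num_measure.
  rewrite [X in _ - X](_ : _ = P (W @^-1` I q)); first by rewrite subee// fin_num_measure.
  rewrite -[RHS]VW//; apply: ae_measure_eq => //; first exact: measurableI.
  apply: filterS leVW => x VWx; rewrite /I/= !in_itv/= !andbT.
  by split=> [[]//|qV]; split=> //; exact: lt_le_trans VWx.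
have nE : {ae P, forall x, ~ (\bigcup_q (W @^-1` I q `\` V @^-1` I q)) x}.
  by apply: negligibleS (negligible_bigcup_count E0) => x /= /contrapT.
move: leVW nE; apply: filterS2 => x VWx nEx; apply/eqP; rewrite eq_le VWx/= leNgt.
apply/negP => VltW; have [q] := rat_in_itvoo VltW.
rewrite in_itv/= => /andP[Vq qW]; apply: nEx; exists q => //; split.
  by rewrite /I/= in_itv/= qW.
by rewrite /I/= in_itv/= andbT; apply/negP; rewrite -leNgt ltW.
Qed.

End same_law.

Section gradient_uniqueness.
Context {R : realType} {n : nat} (P : probability 'rV[R]_n R).

(* With u = phi - phi' and v = phi'^* - phi^*, Fenchel's inequality gives
   v (F' x) <= u x <= v (F x) almost surely; as v \o F and v \o F' have the same
   law they coincide, so equality holds and F' x is a subgradient of phi. *)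
Lemma gradient_pushforward_unique (F F' : 'rV[R]_n -> 'rV[R]_n) phi phi' :
  measurable_fun setT F -> measurable_fun setT F' -> convex_rV phi ->
  {ae P, forall x, is_gradient phi x (F x)} ->
  {ae P, forall x, subgradient phi' x (F' x)} ->
  (forall A, measurable A -> P (F @^-1` A) = P (F' @^-1` A)) ->
  {ae P, forall x, F' x = F x}.
Proof.
move=> mF mF' cphi gF gF' FF'.
have sF : {ae P, forall x, subgradient phi x (F x)}.
  by apply: (ae_imp gF) => x; exact: gradient_subgradient.
pose v y := fine (conjugate phi' y) - fine (conjugate phi y).
have mfine (psi : 'rV[R]_n -> R) : measurable_fun setT (fun y => fine (conjugate psi y) : R).
  apply: measurableT_comp; last exact: measurable_conjugate.
  exact: fine_measurable.
have mv : measurable_fun setT v by apply: measurable_funB.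
pose Fin (psi : 'rV[R]_n -> R) := [set y | conjugate psi y \is a fin_num].
have mFin psi : measurable (Fin psi).
  rewrite -[Fin psi]setTI; apply: emeasurable_fin_num => //.
  exact: measurable_conjugate.
(* [v] is built with [fine], so both conjugates must be finite at [F x] and at [F' x]. Each is
   finite along its own map by the equality case, and equality in law carries this over to the other
   map. *)
have transfer psi (G G' : 'rV[R]_n -> 'rV[R]_n) : measurable_fun setT G ->
    measurable_fun setT G' ->
    (forall A, measurable A -> P (G @^-1` A) = P (G' @^-1` A)) ->
    {ae P, forall x, Fin psi (G x)} -> {ae P, forall x, Fin psi (G' x)}.
  move=> mG mG' GG' [N [mN PN GN]].
  have mC (K : 'rV[R]_n -> 'rV[R]_n) : measurable_fun setT K ->
      measurable (K @^-1` ~` Fin psi).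
    by move=> mK; apply: measurable_preimage => //; exact: measurableC.
  exists (G' @^-1` ~` Fin psi); split => //; first exact: mC.
  rewrite -GG'; last exact: measurableC.
  by apply: subset_measure0 PN => //; exact: mC.
have fin psi G : {ae P, forall x, subgradient psi x (G x)} ->
    {ae P, forall x, Fin psi (G x)}.
  move=> sG; apply: (ae_imp sG) => x.
  by rewrite conjugate_subgradient /Fin/= => ->.
have f1 := transfer _ _ _ mF mF' FF' (fin _ _ sF).
have f2 := transfer _ _ _ mF' mF (fun A mA => esym (FF' A mA)) (fin _ _ gF').
have ineq : {ae P, forall x, v (F' x) <= phi x - phi' x <= v (F x)}.
  move: (ae_and f1 f2) (ae_and sF gF'); apply: filterS2 => x [].
  move=> finF' finF [/conjugate_subgradient cF /conjugate_subgradient cF'].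
  have := conjugate_ge phi x (F' x); have := conjugate_ge phi' x (F x).
  rewrite /v cF cF' /= -(fineK finF) -(fineK finF') !lee_fin/=; lra.
have vFF' : {ae P, forall x, v (F' x) = v (F x)}.
  apply: same_law_le_ae_eq; [exact: measurableT_comp|exact: measurableT_comp|..].
    move=> A mA; apply/esym/(FF' (v @^-1` A)); exact: measurable_preimage.
  by apply: filterS ineq => x /andP[]; exact: le_trans.
move: (ae_and f1 ineq) (ae_and vFF' (ae_and gF gF')); apply: filterS2.
move=> x [finF' /andP[vu uv]] [vE [gFx /conjugate_subgradient cF']].
apply: subgradient_unique gFx _; apply/conjugate_subgradient.
rewrite -(fineK finF'); congr EFin; move: vu uv; rewrite -vE /v cF'/=; lra.
Qed.

End gradient_uniqueness.

(** * A Borel left inverse of a subgradient map *)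

Section subgradient_inverse.
Context {R : realType} {n : nat} (phi : 'rV[R]_n -> R).
Local Notation psi := (conjugate phi).
Local Notation e i := (delta_mx ord0 i : 'rV[R]_n).
Local Notation h k := (k.+1%:R^-1 : R).

Lemma conjugate_convex s t a : 0 <= a <= 1 ->
  psi s \is a fin_num -> psi t \is a fin_num ->
  (psi ((1 - a) *: s + a *: t) <= ((1 - a) * fine (psi s) + a * fine (psi t))%:E)%E.
Proof.
move=> /andP[a0 a1] fs ft; apply: ge_ereal_sup => _ [x _ <-].
have := conjugate_ge phi x s; have := conjugate_ge phi x t.
rewrite -{1}(fineK fs) -{1}(fineK ft) !lee_fin dotvDr !dotvZr => xt xs.
have : a * (dotv x t - phi x) <= a * fine (psi t) by rewrite ler_wpM2l.
have : (1 - a) * (dotv x s - phi x) <= (1 - a) * fine (psi s).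
  by rewrite ler_wpM2l// subr_ge0.
lra.
Qed.

(* The points where the left slopes of psi in direction i are at most p and the
   right slopes are at least q. *)
Definition kink i (p q : R) := [set y | psi y \is a fin_num /\
  forall k, ((fine (psi y) - p * h k)%:E <= psi (y - h k *: e i))%E /\
            ((fine (psi y) + q * h k)%:E <= psi (y + h k *: e i))%E].

Lemma measurable_conjugate_shift (v : 'rV[R]_n) :
  measurable_fun setT (fun y : 'rV[R]_n => psi (y + v)).
Proof.
apply: measurableT_comp; first exact: measurable_conjugate.
by apply: measurable_rVD.
Qed.

Lemma measurable_kink i p q : measurable (kink i p q).
Proof.
have mfin c : measurable_fun setT (fun y : 'rV[R]_n => (fine (psi y) + c)%:E).
  apply/measurable_EFinP; apply: measurable_funD => //.
  by apply: measurableT_comp; [exact: fine_measurable|exact: measurable_conjugate].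
rewrite (_ : kink i p q = [set y | psi y \is a fin_num] `&`
   \bigcap_k ([set y | ((fine (psi y) - p * h k)%:E <= psi (y - h k *: e i))%E] `&`
     [set y | ((fine (psi y) + q * h k)%:E <= psi (y + h k *: e i))%E])); last first.
  apply/seteqP; split=> y [fy yk]; split => // k; last exact: yk.
  by move=> _; exact: yk.
apply: measurableI.
  rewrite -[X in measurable X]setTI; apply: emeasurable_fin_num => //.
  exact: measurable_conjugate.
apply: bigcap_measurable => [|k _]; first by exists 0%N.
apply: measurableI; rewrite -[X in measurable X]setTI;
  by apply: measurable_lee => //; exact: measurable_conjugate_shift.
Qed.

(** Convexity puts the mean slope between two kinks above the right slope of the first, thus at
    least [q], and below the left slope of the second, thus at most [p], against [p < q]. *)
Lemma kink_line i p q y t : p < q -> 0 < t ->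
  kink i p q y -> ~ kink i p q (y + t *: e i).
Proof.
move=> pq t0 [fy ky] [ft kt].
(* The tested steps are [1 / (k + 1)]; this [k] gives one that fits between the two points, and [a]
   is its barycentric weight. *)
pose k := Num.truncn t^-1.
have ht : h k <= t.
  by rewrite -[leRHS]invrK lef_pV2 ?posrE ?invr_gt0// ltW// truncnS_gt.
have h0 : 0 < h k by rewrite invr_gt0.
pose a := h k / t.
have a01 : 0 <= a <= 1 by rewrite divr_ge0 ?(ltW h0) ?(ltW t0)//= ler_pdivrMr ?mul1r.
have a01' : 0 <= 1 - a <= 1 by rewrite subr_ge0 gerBl andbC.
have at_ : a * t = h k by rewrite /a divfK ?gt_eqF.
have := conjugate_convex a01 fy ft; have := conjugate_convex a01' fy ft.
rewrite subKr.
rewrite (_ : (1 - a) *: y + a *: (y + t *: e i) = y + h k *: e i); last first.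
  by rewrite -at_; apply/rowP => j; rewrite !mxE; ring.
rewrite (_ : a *: y + (1 - a) *: (y + t *: e i) = y + t *: e i - h k *: e i); last first.
  by rewrite -at_; apply/rowP => j; rewrite !mxE; ring.
move=> u1 u2; have := le_trans (kt k).1 u1; have := le_trans (ky k).2 u2.
rewrite !lee_fin; have : 0 < (q - p) * h k by rewrite mulr_gt0// subr_gt0.
move: (h k) (fine _) (fine _) => H b c; lra.
Qed.

Lemma kink_null i p q : p < q -> lebesgue_rV n (kink i p q) = 0%E.
Proof.
move=> pq; apply: (@lines_null _ _ (e i)); first exact: measurable_kink.
move=> x; set K := [set t | _].
have K1 s t : K s -> K t -> ~ s < t.
  move=> Ks Kt st; apply: (kink_line pq _ Ks (t := t - s)); first by rewrite subr_gt0.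
  by rewrite -addrA -scalerDl [s + _]addrC subrK.
have [[s Ks]|nK] := pselect (exists s, K s).
  rewrite (_ : K = [set s]) ?lebesgue_measure_set1//.
  apply/seteqP; split=> [t Kt|t ->//].
  by have [ts|st|//] := ltgtP t s; [have := K1 _ _ Kt Ks|have := K1 _ _ Ks Kt].
rewrite (_ : K = set0) ?measure0//.
by apply/seteqP; split=> // t Kt; apply: nK; exists t.
Qed.

(** If [y] is a subgradient of [phi] at [x], then [x] is a subgradient of the conjugate at [y], so
    its coordinates lie between the left and the right slopes there. [T] takes the infimum of the
    right slopes, which outside the kinks cannot exceed the coordinate. *)
Lemma subgradient_inverse : exists (T : 'rV[R]_n -> 'rV[R]_n) (N : set 'rV[R]_n),
  [/\ measurable_fun setT T, measurable N, lebesgue_rV n N = 0%E &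
      forall x y, subgradient phi x y -> ~ N y -> T y = x].
Proof.
pose slope i k (y : 'rV[R]_n) := ((h k)^-1%:E * (psi (y + h k *: e i) - psi y))%E.
pose T y : 'rV[R]_n := \row_i fine (einfs (fun k => slope i k y) 0%N).
pose N := \bigcup_i \bigcup_(z : rat * rat)
  (if z.1 < z.2 then kink i (ratr z.1) (ratr z.2) else set0).
have mk i (z : rat * rat) :
    measurable (if z.1 < z.2 then kink i (ratr z.1) (ratr z.2) else set0).
  by case: ifP => // _; exact: measurable_kink.
have mN1 i : measurable (\bigcup_(z : rat * rat)
    (if z.1 < z.2 then kink i (ratr z.1) (ratr z.2) else set0)).
  by apply: countable_bigcupT_measurable; [exact: countableP|exact: mk].
have mN : measurable N by apply: countable_bigcupT_measurable; [exact: countableP|].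
exists T, N; split => //.
- apply: measurable_fun_row => i; under eq_fun do rewrite mxE.
  apply: measurableT_comp; first exact: fine_measurable.
  apply: measurable_fun_einfs => k; apply: measurable_funeM.
  apply: emeasurable_funB; first exact: measurable_conjugate_shift.
  exact: measurable_conjugate.
- apply/eqP; rewrite eq_le measure_ge0 andbT.
  have /negligibleP -> // : (lebesgue_rV n).-negligible N.
  apply: negligible_bigcup_count => i; apply: negligible_bigcup_count => z.
  case: ifP => zz; last exact: negligible_set0.
  by apply/negligibleP; [exact: measurable_kink|apply: kink_null; rewrite ltr_rat].
- move=> x y sxy nNy; apply/rowP => i; rewrite mxE.
  have cy : psi y = (dotv x y - phi x)%:E by apply/conjugate_subgradient.
  suff -> : einfs (slope i ^~ y) 0%N = (x ord0 i)%:E by [].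
  apply/eqP; rewrite eq_le; apply/andP; split; last first.
    apply: le_ereal_inf_tmp => _ [k _ <-].
    have H0 : 0 < h k by rewrite invr_gt0.
    rewrite /slope cy; move: (h k) H0 => H H0.
    have := conjugate_ge phi x (y + H *: e i); rewrite dotvDr dotvZr dotv_delta.
    case: (psi _) => [r||]//=; last by rewrite gt0_muley ?leey// lte_fin invr_gt0.
    rewrite lee_fin -EFinD -EFinM lee_fin ler_pdivlMl// => ?; lra.
  rewrite leNgt; apply/negP => xlt.
  (* A real above the coordinate and below all right slopes: the infimum itself, or [x ord0 i + 1]
     when the infimum is infinite. Two rationals between [x ord0 i] and [c] then exhibit [y] as a
     kink. *)
  have [c xc cs] : exists2 c, x ord0 i < c & forall k, (c%:E <= slope i k y)%E.
    have ge k : (einfs (slope i ^~ y) 0%N <= slope i k y)%E.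
      by apply: ereal_inf_lbound; exists k.
    case E : (einfs (slope i ^~ y) 0%N) xlt ge => [c||]//.
      by rewrite lte_fin; exists c.
    move=> _ ge; exists (x ord0 i + 1) => [|k]; first by rewrite ltrDl.
    by apply: le_trans (ge k); rewrite leey.
  have [p] := rat_in_itvoo xc; rewrite in_itv/= => /andP[xp pc].
  have [q] := rat_in_itvoo pc; rewrite in_itv/= => /andP[pq qc].
  apply: nNy; exists i => //; exists (p, q) => //=.
  rewrite -(@ltr_rat R) pq; split; first by rewrite cy.
  move=> k; rewrite cy/=; have h0 : 0 < h k by rewrite invr_gt0.
  split.
    apply: le_trans (conjugate_ge _ x _); rewrite lee_fin dotvBr dotvZr dotv_delta.
    have : h k * x ord0 i <= h k * ratr p by rewrite ler_pM2l// ltW.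
    by move: (h k) => H; lra.
  have := cs k; rewrite /slope cy; move: (h k) h0 => H H0.
  case: (psi _) => [r||].
  - rewrite -EFinD -EFinM !lee_fin ler_pdivlMl// => ck.
    have : H * ratr q <= H * c by rewrite ler_pM2l// ltW.
    lra.
  - by rewrite leey.
  - by rewrite addNye gt0_muleNy// lte_fin invr_gt0.
Qed.
End subgradient_inverse.

(** * The spherical uniform law *)

Section sections.
Local Open Scope ereal_scope.
Context d1 d2 (T1 : measurableType d1) (T2 : measurableType d2) (R : realType).
Context (m1 : {sigma_finite_measure set T1 -> \bar R}).
Context (m2 : {sigma_finite_measure set T2 -> \bar R}).

Lemma measurable_section1 (E : set (T1 * T2)) : measurable E ->
  measurable_fun setT (fun x => m2 [set y | E (x, y)]).
Proof.
move=> mE; rewrite (_ : (fun _ => _) = m2 \o xsection E).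
  exact: measurable_fun_xsection.
apply/funext => x /=; congr (m2 _); apply/seteqP.
by split=> y /=; rewrite /xsection/= inE.
Qed.

Lemma measurable_section2 (E : set (T1 * T2)) : measurable E ->
  measurable_fun setT (fun y => m1 [set x | E (x, y)]).
Proof.
move=> mE; rewrite (_ : (fun _ => _) = m1 \o ysection E).
  exact: measurable_fun_ysection.
apply/funext => y /=; congr (m1 _); apply/seteqP.
by split=> x /=; rewrite /ysection/= inE.
Qed.

Lemma product_measure_sectionE (E : set (T1 * T2)) : measurable E ->
  (m1 \x m2) E = \int[m1]_x m2 [set y | E (x, y)].
Proof.
move=> mE; rewrite /product_measure1; apply: eq_integral => x _ /=.
by congr (m2 _); apply/seteqP; split=> y /=; rewrite /xsection/= inE.
Qed.

(** Each side says that a nonnegative section function has integral zero, and the two integrals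
    agree by Tonelli. *)
Lemma section_null (E : set (T1 * T2)) : measurable E ->
  {ae m1, forall x, m2 [set y | E (x, y)] = 0} <->
  {ae m2, forall y, m1 [set x | E (x, y)] = 0}.
Proof.
move=> mE; have := measure_section_swap m1 m2 mE.
have i1 : \int[m1]_x m2 [set y | E (x, y)] = 0 <->
    {ae m1, forall x, m2 [set y | E (x, y)] = 0}.
  rewrite (eq_integral (fun x => `|m2 [set y | E (x, y)]|)); last first.
    by move=> x _; rewrite gee0_abs.
  have -> := ae_eq_integral_abs m1 measurableT (measurable_section1 mE).
  by split; apply: filterS => x; [exact|].
have i2 : \int[m2]_x m1 [set y | E (y, x)] = 0 <->
    {ae m2, forall x, m1 [set y | E (y, x)] = 0}.
  rewrite (eq_integral (fun x => `|m1 [set y | E (y, x)]|)); last first.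
    by move=> x _; rewrite gee0_abs.
  have -> := ae_eq_integral_abs m2 measurableT (measurable_section2 mE).
  by split; apply: filterS => x; [exact|].
by move=> swapE; rewrite -i1 -i2 swapE.
Qed.

End sections.

Section ball_law.
Local Open Scope ereal_scope.
Context {R : realType} {n : nat}.
Local Notation V := 'rV[R]_n.
Local Notation mu1 := (@lebesgue_measure R).
Local Notation U := (uniform_prob (@ltr01 R)).
Implicit Types (A : set V) (O : 'M[R]_n).

(** At the origin the value is 0. *)
Definition direction (x : V) : V := ((enorm x)^-1 *: x)%R.

Lemma measurable_direction : measurable_fun setT direction.
Proof.
apply: measurable_rVZ => //.
rewrite (_ : (fun _ => _) = (@powR R)^~ (-1)%R \o enorm).
  by apply: measurableT_comp; [exact: measurable_powR|exact: measurable_enorm].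
by apply/funext => x /=; rewrite powR_inv1// enorm_ge0.
Qed.

Lemma measurable_ball_direction A : measurable A ->
  measurable (open_unit_ball `&` (direction @^-1` A)).
Proof.
move=> mA; apply: measurableI; first exact: measurable_ball_rV.
by apply: measurable_preimage => //; exact: measurable_direction.
Qed.

Lemma sphere_uniformP : exists p : probability V R, sphere_uniform = p.
Proof.
have b0 := @lebesgue_rV_ball_gt0 R n; have boo := @lebesgue_rV_ball_lty R n.
have bE : lebesgue_rV n (@open_unit_ball R n) = (fine (lebesgue_rV n (@open_unit_ball R n)))%:E.
  by rewrite fineK// ge0_fin_numE// ltW.
set b := fine (lebesgue_rV n (@open_unit_ball R n)) in bE.
have b0' : (0 < b)%R by rewrite -lte_fin -bE.
have c0 : (0 <= b^-1)%R by rewrite invr_ge0 ltW.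
have [m mE] := pushforward_measureP (mrestr (lebesgue_rV n) (@measurable_ball_rV R n))
  measurable_direction.
pose q := mscale (NngNum c0) m.
have qE : sphere_uniform = q.
  apply/funext => A; rewrite /q /mscale/= -[m A]/((m : set V -> \bar R) A) -mE.
  by rewrite /sphere_uniform setIC.
have qT : q setT = 1.
  rewrite -qE /sphere_uniform (_ : [set x | _] = setT); last by apply/seteqP; split.
  by rewrite setIT bE -/b /= -EFinM mulVf// gt_eqF.
pose H := Measure_isProbability.Build _ _ _ q qT.
by exists (HB.pack q H : probability V R).
Qed.

Let sphere_uniform0 : @sphere_uniform R n set0 = 0.
Proof. by have [p ->] := sphere_uniformP; exact: measure0. Qed.

Let sphere_uniform_ge0 A : 0 <= sphere_uniform A.
Proof. by have [p ->] := sphere_uniformP; exact: measure_ge0. Qed.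

Let sphere_uniform_sigma_additive : semi_sigma_additive (@sphere_uniform R n).
Proof.
by have [p ->] := sphere_uniformP; exact: measure_semi_sigma_additive.
Qed.

HB.instance Definition _ := isMeasure.Build _ _ _ (@sphere_uniform R n)
  sphere_uniform0 sphere_uniform_ge0 sphere_uniform_sigma_additive.

Let sphere_uniformT : sphere_uniform [set: V] = 1.
Proof. by have [p ->] := sphere_uniformP; exact: probability_setT. Qed.

HB.instance Definition _ := Measure_isProbability.Build _ _ _
  (@sphere_uniform R n) sphere_uniformT.

Lemma sphere_uniform_orthogonal O A : orthogonal_mx O -> measurable A ->
  sphere_uniform ((mulmx^~ O : V -> V) @^-1` A) = sphere_uniform A.
Proof.
move=> oO mA; rewrite /sphere_uniform; congr (_ * _).
rewrite -[RHS](lebesgue_rV_orthogonal oO); last exact: measurable_ball_direction.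
congr (lebesgue_rV _ _); apply/seteqP.
by split=> x; rewrite /open_unit_ball/= enorm_orthogonal// scalemxAl.
Qed.

Lemma measurable_polar : measurable_fun setT
  (fun sr : V * measurableTypeR R => (sr.2 *: sr.1)%R : V).
Proof. by apply: measurable_rVZ. Qed.

(** The radius is put outermost because a score acts on the radius alone; facts about the sphere are
    then used at fixed [r]. *)
Lemma ball_uniformE A : measurable A ->
  ball_uniform A = \int[U]_r sphere_uniform [set s | A (r *: s)%R].
Proof.
move=> mA; have mE := measurable_preimage measurable_polar mA.
rewrite /ball_uniform /pushforward (product_measure_sectionE (@sphere_uniform R n) U mE).
exact: (measure_section_swap (@sphere_uniform R n) U mE).
Qed.

Lemma ball_uniform_orthogonal O A : orthogonal_mx O -> measurable A ->
  ball_uniform ((mulmx^~ O : V -> V) @^-1` A) = ball_uniform A.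
Proof.
move=> oO mA; rewrite !ball_uniformE//; last first.
  by apply: measurable_preimage => //; exact: measurable_rVM.
apply: eq_integral => r _; rewrite -[RHS](sphere_uniform_orthogonal oO); last first.
  by apply: (measurable_preimage (f := fun s : V => (r *: s)%R)) => //; exact: measurable_rVZ.
by congr sphere_uniform; apply/seteqP; split=> s /=; rewrite scalemxAl.
Qed.

Lemma lebesgue_measure_scale (a : R) (Z : set R) : (0 < a)%R -> measurable Z ->
  mu1 [set t | Z (a * t)%R] = a^-1%:E * mu1 Z.
Proof.
move=> a0 mZ.
have mZa : measurable [set t | Z (a * t)%R].
  exact: (measurable_preimage (mulrl_measurable _)).
have E (Y : set R) : measurable Y -> mu1 Y = lebesgue_rV 1 (rbox (fun=> Y)).
  by move=> mY; rewrite lebesgue_rV_box// big_ord1.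
rewrite !E// -[a^-1%R]expr1 exprVn -lebesgue_rV_scale//; last exact: measurable_rbox.
by congr (lebesgue_rV _ _); apply/seteqP; split=> x /= Zx i; have := Zx i; rewrite mxE.
Qed.

(* A null set A is met by almost every ray {t x | t > 0} in a null set of
   parameters t, hence so is it by almost every ray from the sphere; exchanging the two
   variables, almost every sphere of positive radius meets A in a null set. *)
Lemma sphere_uniform_scale_null A : measurable A -> lebesgue_rV n A = 0 ->
  {ae mu1, forall r, (0 < r)%R -> sphere_uniform [set s | A (r *: s)%R] = 0}.
Proof.
move=> mA A0.
pose D : set (V * measurableTypeR R) := [set z | (0 < z.2)%R /\ A (z.2 *: z.1)%R].
have mD : measurable D.
  apply: measurableI.
    rewrite (_ : (fun _ => _) = snd @^-1` `]0%R, +oo[%classic); last first.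
      by apply/seteqP; split => z /=; rewrite in_itv/= andbT.
    by apply: (@measurable_preimage _ _ _ (measurableTypeR R)) => //; exact: measurable_itv.
  exact: (measurable_preimage measurable_polar).
have ray0 : {ae lebesgue_rV n, forall x, mu1 [set t | D (x, t)] = 0}.
  apply/(section_null (lebesgue_rV n) mu1 mD); apply: aeW => t.
  have [t0|t0] := ltP 0%R t; last first.
    rewrite (_ : [set _ | _] = set0) ?measure0//.
    by apply/seteqP; split => // x [/=]; rewrite ltNge t0.
  rewrite (_ : [set _ | _] = (fun x : V => (t *: x)%R) @^-1` A).
    by apply: etrans (lebesgue_rV_scale t0 mA) _; rewrite A0 mule0.
  by apply/seteqP; split => x //= [].
pose p : probability V R := @sphere_uniform R n.
have sray0 : {ae p, forall s, mu1 [set t | D (s, t)] = 0}.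
  move: ray0 => [N [mN N0 DN]].
  exists [set s | mu1 [set t | D (s, t)] != 0]; split.
  - rewrite -[X in measurable X]setTI; apply: emeasurable_neq => //.
    exact: (measurable_section1 mu1).
  - rewrite -[LHS]/((fine (lebesgue_rV n (@open_unit_ball R n)))^-1%:E * lebesgue_rV n
      (open_unit_ball `&` (direction @^-1` [set s | mu1 [set t | D (s, t)] != 0]))).
    rewrite [X in _ * X](_ : _ = 0) ?mule0//.
    apply: subset_measure0 N0 => //.
      apply: measurable_ball_direction; rewrite -[X in measurable X]setTI.
      by apply: emeasurable_neq => //; exact: (measurable_section1 mu1).
    move=> x [_ /= Dx]; apply: DN => /= Dx0; move/eqP: Dx; apply.
    have [x0|x0] := eqVneq (enorm x) 0%R.
      move/eqP: x0; rewrite enorm_eq0 => /eqP x0.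
      by move: Dx0; rewrite x0 /direction scaler0.
    have ix0 : (0 < (enorm x)^-1)%R by rewrite invr_gt0 lt_neqAle eq_sym x0 enorm_ge0.
    rewrite (_ : [set _ | _] = [set t | [set t | D (x, t)] ((enorm x)^-1 * t)%R]).
      rewrite lebesgue_measure_scale ?Dx0 ?mule0//.
      exact: (measurable_preimage (measurable_fun_pair (measurable_cst x)
        (@measurable_id _ _ _)) mD).
    by apply/seteqP; split => t /=; rewrite /D/= pmulr_rgt0// scalerA mulrC.
  - by move=> s /= /eqP.
have := (section_null p mu1 mD).1 sray0; apply: filterS => r /= Dr r0.
by rewrite -[RHS]Dr; congr (p _); apply/seteqP; split => s //= [].
Qed.

Lemma uniform_prob_itv : {ae U, forall r, (0 < r < 1)%R}.
Proof.
exists (~` `]0%R, 1%R[%classic); split.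
- by apply: measurableC; exact: measurable_itv.
- rewrite probability_setC; last exact: measurable_itv.
  rewrite [X in _ - X](_ : _ = 1) ?subee//.
  rewrite -[LHS]/(\int[mu1]_(x in `]0%R, 1%R[) (uniform_pdf 0 1 x)%:E).
  rewrite integral_uniform_pdf.
  rewrite (eq_integral (cst 1)); last first.
    by move=> x; rewrite inE => -[_ /=]; rewrite in_itv/= /uniform_pdf => ->; rewrite subr0 invr1.
  rewrite integral_cst; last by apply: measurableI; exact: measurable_itv.
  rewrite mul1e (_ : _ `&` _ = `]0%R, 1%R[%classic).
    apply: etrans (lebesgue_measure_itv `]0%R, 1%R[) _.
    by rewrite /= lte01 oppr0 adde0.
  apply/seteqP; split => [x []//|x /= x01]; split => //.
  by move: x01; rewrite !in_itv/= => /andP[/ltW -> /ltW ->].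
- by move=> r /= r01; rewrite in_itv.
Qed.

Lemma measurable_score (J : R -> R) : score_function J ->
  measurable_fun (`[0%R, 1%R[%classic : set R) J.
Proof.
move=> [_ cJ]; exact: subspace_continuous_measurable_fun.
Qed.

Hypothesis n0 : (0 < n)%N.

Lemma lebesgue_rV_set0 : lebesgue_rV n [set (0%R : V)] = 0.
Proof.
rewrite (_ : [set 0%R] = rbox (fun=> [set 0%R])).
  rewrite lebesgue_rV_box//.
  by rewrite (bigD1 (Ordinal n0))//= lebesgue_measure_set1 mul0e.
apply/seteqP; split=> [x -> i|x /= x0]; first by rewrite /= mxE.
by apply/rowP => i; rewrite mxE; exact: x0.
Qed.

Lemma sphere_uniform_enorm1 : {ae @sphere_uniform R n, forall s, enorm s = 1%R}.
Proof.
exists [set s | enorm s != 1%R]; split.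
- rewrite (_ : [set _ | _] = ~` (@enorm R n @^-1` [set 1%R])).
    by apply/measurableC/measurable_preimage; [exact: measurable_enorm|].
  by apply/seteqP; split=> s /= /eqP.
- rewrite /sphere_uniform [X in _ * X](_ : _ = 0) ?mule0//.
  apply/eqP; rewrite eq_le measure_ge0 andbT -lebesgue_rV_set0.
  apply: le_measure; rewrite ?inE.
  + apply: (@measurable_ball_direction [set s | enorm s != 1%R]).
    rewrite (_ : [set _ | _] = ~` (@enorm R n @^-1` [set 1%R])).
      by apply/measurableC/measurable_preimage; [exact: measurable_enorm|].
    by apply/seteqP; split=> s /= /eqP.
  + rewrite (_ : [set 0%R] = @enorm R n @^-1` [set 0%R]).
      by apply: measurable_preimage => //; exact: measurable_enorm.
    by apply/seteqP; split=> s /=; [move=> ->; exact: enorm0|move/eqP; rewrite enorm_eq0 => /eqP].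
  + move=> x [_ /=]; rewrite enormZ ger0_norm ?invr_ge0 ?enorm_ge0// => x1.
    apply/eqP; rewrite -enorm_eq0; apply/negPn/negP => x0.
    by move: x1; rewrite mulVf// eqxx.
- by move=> s /= /eqP.
Qed.

Lemma score_map_polar (J : R -> R) r (s : V) : (0 < r)%R -> enorm s = 1%R ->
  score_map J (r *: s) = (J r *: s)%R.
Proof.
move=> r0 s1; rewrite /score_map.
have s0 : s != 0%R by rewrite -enorm_eq0 s1 oner_eq0.
rewrite scaler_eq0 (gt_eqF r0) (negbTE s0)/= enormZ s1 mulr1 gtr0_norm//.
by rewrite scalerA divfK ?gt_eqF.
Qed.

(** In polar form the score replaces the radius [r] by [J r], so [sphere_uniform_scale_null] applies
    unless [J r] is an exceptional radius; [nonsingular_score] makes such [r] negligible. The set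
    [B] appears because the score map is known to be measurable only on the open unit ball. *)
Lemma ball_uniform_score_null (J : R -> R) A : score_function J ->
  nonsingular_score J -> measurable A -> lebesgue_rV n A = 0 ->
  forall B, measurable B ->
    B `<=` [set y | A (score_map J y)] -> ball_uniform B = 0.
Proof.
move=> sJ nJ mA A0 B mB BA; rewrite ball_uniformE//.
have [N [mN N0 gN]] := sphere_uniform_scale_null mA A0.
(* Radius 0 is not covered by [sphere_uniform_scale_null], so it joins the exceptional radii. *)
pose N' := N `|` [set 0%R].
have mN' : measurable (N' : set R) by apply: measurableU.
have N'0 : mu1 N' = 0.
  have E : mu1 N + mu1 [set 0%R] = 0 by rewrite N0 lebesgue_measure_set1 adde0.
  have N'le : mu1 N' <= mu1 N + mu1 [set 0%R] := measureU2 mu1 mN (measurable_set1 0%R).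
  rewrite E in N'le.
  by apply/eqP; rewrite eq_le measure_ge0 andbT.
have JN'0 := nJ _ mN' N'0.
have mJN' : measurable (`[0%R, 1%R[%classic `&` J @^-1` N').
  by apply: (measurable_score sJ) => //; exact: measurable_itv.
have aeJ : {ae U, forall r, ~ (`[0%R, 1%R[%classic `&` J @^-1` N') r}.
  exists (`[0%R, 1%R[%classic `&` J @^-1` N'); split => //.
    exact: (null_content_dominatesP _ _).1 (dominates_uniform_prob _) _ mJN' JN'0.
  by move=> r /= /contrapT.
rewrite (ge0_ae_eq_integral (g := cst 0))//=; first exact: integral0.
- exact: (measurable_section2 (@sphere_uniform R n) (measurable_preimage measurable_polar mB)).
- apply: (ae_imp (ae_and aeJ uniform_prob_itv)) => r [NJr /andP[r0 r1]] _ /=.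
  have rI : `[0%R, 1%R[%classic r by rewrite /= in_itv/= (ltW r0).
  have Jr0 : (0 < J r)%R.
    rewrite lt_neqAle (sJ.1 r) ?r1 ?(ltW r0)// andbT; apply/negP => /eqP Jr.
    by apply: NJr; split => //; right.
  have gJ : sphere_uniform [set s | A (J r *: s)%R] = 0.
    by apply: contrapT => gJ; apply: NJr; split => //; left; apply: gN => /(_ Jr0).
  apply/eqP; rewrite eq_le measure_ge0 andbT -gJ; apply: ae_measure_le.
  + by apply: (@measurable_preimage _ _ _ _ (fun s : V => (r *: s)%R)) => //; exact: measurable_rVZ.
  + apply: (@measurable_preimage _ _ _ _ (fun s : V => (J r *: s)%R)) => //.
    exact: measurable_rVZ.
  + apply: filterS sphere_uniform_enorm1 => s s1 /= /BA.
    by rewrite /= score_map_polar.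
Qed.

Lemma ball_uniform_null A : measurable A -> lebesgue_rV n A = 0 -> ball_uniform A = 0.
Proof.
move=> mA A0; rewrite ball_uniformE//.
have [N [mN N0 gN]] := sphere_uniform_scale_null mA A0.
have aeN : {ae U, forall r, ~ N r}.
  exists N; split => //; last by move=> r /= /contrapT.
  exact: (null_content_dominatesP _ _).1 (dominates_uniform_prob _) _ mN N0.
rewrite (ge0_ae_eq_integral (g := cst 0))//=; first exact: integral0.
- exact: (measurable_section2 (@sphere_uniform R n) (measurable_preimage measurable_polar mA)).
- apply: (ae_imp (ae_and aeN uniform_prob_itv)) => r [Nr /andP[r0 r1]] _ /=.
  by apply: contrapT => gr; apply: Nr; apply: gN => /(_ r0).
Qed.

Lemma measurable_score_map (J : R -> R) : score_function J ->
  measurable_fun (@open_unit_ball R n) (@score_map R n J).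
Proof.
move=> sJ.
pose J' := patch (fun=> 0%R) (`[0%R, 1%R[%classic : set R) J.
have mJ' : measurable_fun setT J'.
  by apply/(measurable_restrictT _ _).1; [exact: measurable_itv|exact: measurable_score].
apply: (@eq_measurable_fun _ _ _ _ _ (fun x : V => (J' (enorm x) *: direction x)%R)).
  move=> x; rewrite inE /open_unit_ball/= => x1.
  rewrite /J' patchE (_ : enorm x \in _); last by rewrite inE/= in_itv/= enorm_ge0.
  rewrite /score_map; case: eqVneq => [->|x0]; last by rewrite /direction scalerA.
  by rewrite /direction !scaler0.
apply: measurable_funTS; apply: measurable_rVZ; last exact: measurable_direction.
by apply: measurableT_comp; [exact: mJ'|exact: measurable_enorm].
Qed.

End ball_law.

(** * Transformation invariance, I- and D-consistency *)

Section center_outward.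
Context {R : realType} {n : nat}.
Local Notation V := 'rV[R]_n.
Implicit Types (P : probability V R) (F : V -> V).

(** Everything is pulled back to [P]: the map [K] has the law of [F], since the spherical uniform
    law is orthogonally invariant, and its values are subgradients of a function built from [psi];
    uniqueness of gradient maps identifies both. *)
Lemma center_outward_affine_unique P P' F F' (O : 'M[R]_n) (v : V) (a : R) :
  orthogonal_mx O -> 0 < a ->
  (forall A, measurable A -> P' A = P ((fun x => v + a *: (x *m O^T)) @^-1` A)) ->
  is_center_outward P F -> is_center_outward P' F' ->
  {ae P, forall x, F' (v + a *: (x *m O^T)) = F x *m O^T}.
Proof.
move=> oO a0 P'E [mF _ [phi cphi gphi] FE] [mF' _ [psi cpsi gpsi] F'E].
set g := fun x => v + a *: (x *m O^T).
have mg : measurable_fun setT g.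
  by apply: measurable_rVD => //; apply: measurable_rVZ => //; exact: measurable_rVM.
pose K x := F' (g x) *m O.
have mK : measurable_fun setT K.
  by apply: measurable_rVM; exact: measurableT_comp.
have ae_g (p : V -> Prop) : {ae P', forall y, p y} -> {ae P, forall x, p (g x)}.
  move=> [N [mN PN Np]]; exists (g @^-1` N); split.
  - exact: measurable_preimage.
  - by rewrite -P'E.
  - by move=> x px; exact: Np.
have KF : {ae P, forall x, K x = F x}.
  (* The factor [a^-1] cancels the [a] that the chain rule produces from the dilation in [g]. *)
  apply: (@gradient_pushforward_unique _ _ P F K phi (fun x => a^-1 * psi (g x))) => //.
    have := ae_g _ gpsi; apply: filterS => x /(gradient_subgradient cpsi) sx z.
    have := sx (g z); rewrite (_ : g z - g x = a *: ((z - x) *m O^T)); last first.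
      by rewrite /g opprD addrACA subrr add0r -scalerBr mulmxBl.
    rewrite dotvZr -dotv_mulmx -/(K x) => h.
    by rewrite -(ler_pM2l a0) mulrDr !mulVKf ?gt_eqF.
  move=> A mA; rewrite -[LHS]/(pushforward P F A) FE//.
  rewrite -[LHS](ball_uniform_orthogonal oO)//.
  rewrite -F'E; last by apply: measurable_preimage => //; exact: measurable_rVM.
  rewrite /pushforward P'E//; apply: measurable_preimage => //.
  by apply: measurable_preimage => //; exact: measurable_rVM.
apply: (ae_imp KF) => x <-; rewrite /K -mulmxA oO mulmx1.
by [].
Qed.

Lemma measurable_score_comp (J : R -> R) F : score_function J ->
  measurable_fun setT F -> (forall x, enorm (F x) < 1) ->
  measurable_fun setT (fun x => score_map J (F x)).
Proof.
move=> sJ mF F1; apply: (measurable_comp (F := open_unit_ball)) => //.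
- exact: measurable_ball_rV.
- by move=> _ [x _ <-]; exact: F1.
- exact: measurable_score_map.
Qed.

Lemma score_map_orthogonal (J : R -> R) (O : 'M[R]_n) x : orthogonal_mx O ->
  score_map J (x *m O) = score_map J x *m O.
Proof.
move=> oO; rewrite /score_map enorm_orthogonal// -!(enorm_eq0 (_ *m _)) enorm_orthogonal//.
by rewrite enorm_eq0; case: ifP; rewrite ?mul0mx// scalemxAl.
Qed.

End center_outward.

(** * Transport of the integrals that define the GSC *)

Section integrals.
Local Open Scope ereal_scope.
Context {R : realType}.

(** Positive and negative parts are transported separately, so the identity also covers integrands
    that are not integrable, for which the GSC is still an extended real. *)
Lemma integral_law d1 d2 (T1 : measurableType d1) (T2 : measurableType d2)
    (m1 : {measure set T1 -> \bar R}) (m2 : {measure set T2 -> \bar R})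
    (f : T1 -> T2) (h : T2 -> \bar R) :
  measurable_fun setT f -> measurable_fun setT h ->
  (forall A, measurable A -> m2 A = m1 (f @^-1` A)) ->
  \int[m2]_y h y = \int[m1]_x h (f x).
Proof.
move=> mf mh m2E; have [m mE] := pushforward_measureP m1 mf.
rewrite (eq_measure_integral m); last by move=> A mA _; rewrite -mE; exact: m2E.
have ge0 k : measurable_fun setT k -> (forall y, 0 <= k y) ->
    \int[m]_y k y = \int[m1]_x k (f x).
  by move=> mk k0; rewrite -mE ge0_integral_pushforward// preimage_setT.
rewrite integralE [RHS]integralE; congr (_ - _).
  transitivity (\int[m1]_x h^\+ (f x)); last by apply: eq_integral => x _; rewrite !funeposE.
  by apply: ge0; [exact: measurable_funepos|exact: funepos_ge0].
transitivity (\int[m1]_x h^\- (f x)); last by apply: eq_integral => x _; rewrite !funenegE.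
by apply: ge0; [exact: measurable_funeneg|exact: funeneg_ge0].
Qed.

End integrals.

Section gsc_theory.
Context {R : realType} {m d1 d2 : nat}.
Local Notation V1 := 'rV[R]_d1.
Local Notation V2 := 'rV[R]_d2.

Lemma measurable_permute_tuple d (T : measurableType d) (s : 'S_m) :
  measurable_fun setT (permute_tuple s : m.-tuple T -> m.-tuple T).
Proof. exact: (measurable_subtuple s). Qed.

Lemma measurable_signed_sum n (f : m.-tuple 'rV[R]_n -> R) (H : {set 'S_m}) :
  measurable_fun setT f -> measurable_fun setT (signed_sum f H).
Proof.
move=> mf; rewrite /signed_sum.
rewrite (_ : (fun _ => _) = (fun x => \sum_s
    if s \in H then (-1) ^+ s * f (permute_tuple s x) else 0)); last first.
  by apply/funext => x; rewrite big_mkcond.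
apply: measurable_sum => s; case: (s \in H) => //; apply: measurable_funM => //.
by apply: measurableT_comp => //; exact: measurable_permute_tuple.
Qed.

Lemma measurable_gsc_kernel (f1 : m.-tuple V1 -> R) (f2 : m.-tuple V2 -> R)
    (H : {set 'S_m}) :
  measurable_fun setT f1 -> measurable_fun setT f2 ->
  measurable_fun setT (gsc_kernel f1 f2 H).
Proof.
move=> mf1 mf2; apply: measurable_funM.
  apply: measurableT_comp; first exact: measurable_signed_sum.
  exact: measurable_map_tuple.
apply: measurableT_comp; first exact: measurable_signed_sum.
exact: measurable_map_tuple.
Qed.

Lemma map_permute_tuple T T' (g : T -> T') (s : 'S_m) (x : m.-tuple T) :
  map_tuple g (permute_tuple s x) = permute_tuple s (map_tuple g x).
Proof. by apply: eq_from_tnth => i; rewrite tnth_map !tnth_mktuple tnth_map. Qed.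

Lemma signed_sum_invariant n (f : m.-tuple 'rV[R]_n -> R) (H : {set 'S_m})
    (g : 'rV[R]_n -> 'rV[R]_n) (x : m.-tuple 'rV[R]_n) :
  (forall w, f (map_tuple g w) = f w) ->
  signed_sum f H (map_tuple g x) = signed_sum f H x.
Proof.
by move=> fg; apply: eq_bigr => s _; rewrite -map_permute_tuple fg.
Qed.

Lemma balanced_sum (H : {set 'S_m}) : balanced H ->
  \sum_(s in H) ((-1) ^+ s : R) = 0.
Proof.
move=> bH; rewrite (bigID (@odd_perm _))/=.
rewrite (eq_bigr (fun=> -1)); last by move=> s /andP[_ ->]; rewrite expr1.
rewrite [X in _ + X](eq_bigr (fun=> 1)); last first.
  by move=> s /andP[_ /negbTE ->]; rewrite expr0.
rewrite !sumr_const; apply/eqP; rewrite mulNrn addrC subr_eq0; apply/eqP.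
congr (1 *+ _); rewrite -[RHS](eq_card (A := mem [set s in H | odd_perm s])).
  by rewrite bH; apply: eq_card => s; rewrite !inE.
by move=> s; rewrite !inE.
Qed.

Section law.
Local Open Scope ereal_scope.
Context d (T : measurableType d) (Q : probability T R).

Lemma gsc_law d' (T' : measurableType d') (Q' : probability T' R) (g : T -> T')
    (f1 : m.-tuple V1 -> R) (f2 : m.-tuple V2 -> R) (H : {set 'S_m})
    (X1 : T' -> V1) (X2 : T' -> V2) :
  measurable_fun setT f1 -> measurable_fun setT f2 ->
  measurable_fun setT X1 -> measurable_fun setT X2 -> measurable_fun setT g ->
  (forall A, measurable A -> Q' A = Q (g @^-1` A)) ->
  gsc f1 f2 H Q' X1 X2 = gsc f1 f2 H Q (X1 \o g) (X2 \o g).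
Proof.
move=> mf1 mf2 mX1 mX2 mg Q'E; rewrite /gsc.
rewrite (@integral_law _ _ _ _ _ (power_measure Q m) _ (map_tuple g)).
- apply: eq_integral => w _; congr (gsc_kernel _ _ _ _)%:E.
  by apply: eq_from_tnth => i; rewrite !tnth_map.
- exact: measurable_map_tuple.
- apply/measurable_EFinP; apply: measurableT_comp; first exact: measurable_gsc_kernel.
  by apply: measurable_map_tuple; exact/measurable_fun_pair.
- by move=> A mA; apply/esym; exact: power_measure_pushforward.
Qed.

Lemma kernel_mean_law n d' (T' : measurableType d') (Q' : probability T' R)
    (g : T -> T') (f : m.-tuple 'rV[R]_n -> R) (X : T' -> 'rV[R]_n) :
  measurable_fun setT f -> measurable_fun setT X -> measurable_fun setT g ->
  (forall A, measurable A -> Q' A = Q (g @^-1` A)) ->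
  kernel_mean f Q' X = kernel_mean f Q (X \o g).
Proof.
move=> mf mX mg Q'E; rewrite /kernel_mean.
rewrite (@integral_law _ _ _ _ _ (power_measure Q m) _ (map_tuple g)).
- apply: eq_integral => w _; congr (f _)%:E.
  by apply: eq_from_tnth => i; rewrite !tnth_map.
- exact: measurable_map_tuple.
- by apply/measurable_EFinP/measurableT_comp => //; exact: measurable_map_tuple.
- by move=> A mA; apply/esym; exact: power_measure_pushforward.
Qed.

Lemma gsc_ae_eq (f1 : m.-tuple V1 -> R) (f2 : m.-tuple V2 -> R)
    (H : {set 'S_m}) (X1 Y1 : T -> V1) (X2 Y2 : T -> V2) :
  measurable_fun setT f1 -> measurable_fun setT f2 ->
  measurable_fun setT X1 -> measurable_fun setT X2 ->
  measurable_fun setT Y1 -> measurable_fun setT Y2 ->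
  {ae Q, forall x, X1 x = Y1 x} -> {ae Q, forall x, X2 x = Y2 x} ->
  gsc f1 f2 H Q X1 X2 = gsc f1 f2 H Q Y1 Y2.
Proof.
move=> mf1 mf2 mX1 mX2 mY1 mY2 XY1 XY2.
have mh (Z1 : T -> V1) (Z2 : T -> V2) : measurable_fun setT Z1 -> measurable_fun setT Z2 ->
    measurable_fun setT (fun w : m.-tuple T =>
      (gsc_kernel f1 f2 H (map_tuple (fun t => (Z1 t, Z2 t)) w))%:E).
  move=> mZ1 mZ2; apply/measurable_EFinP; apply: measurableT_comp.
    exact: measurable_gsc_kernel.
  by apply: measurable_map_tuple; exact/measurable_fun_pair.
apply: ae_eq_integral => //; [exact: mh|exact: mh|].
have := ae_power_measure m (ae_and XY1 XY2); apply: filterS => w XY _.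
congr (gsc_kernel _ _ _ _)%:E; apply: eq_from_tnth => i; rewrite !tnth_map.
by have [-> ->] := XY i.
Qed.

(** Permuting i.i.d. coordinates preserves their law, hence the mean; nonnegativity of [f] turns a
    finite mean into integrability. *)
Lemma signed_sum_integrable n (f : m.-tuple 'rV[R]_n -> R) (H : {set 'S_m})
    (X : T -> 'rV[R]_n) :
  kernel_function f -> measurable_fun setT X -> kernel_mean f Q X < +oo ->
  forall s : 'S_m, (power_measure Q m).-integrable setT
    (fun w => (f (map_tuple X (permute_tuple s w)))%:E) /\
  \int[power_measure Q m]_w (f (map_tuple X (permute_tuple s w)))%:E = kernel_mean f Q X.
Proof.
move=> [mf f0] mX fX s.
have mfX : measurable_fun setT (fun w : m.-tuple T => (f (map_tuple X w))%:E).
  by apply/measurable_EFinP/measurableT_comp => //; exact: measurable_map_tuple.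
have E : \int[power_measure Q m]_w (f (map_tuple X (permute_tuple s w)))%:E = kernel_mean f Q X.
  apply/esym/(@integral_law _ _ _ _ _ (power_measure Q m) _ (permute_tuple s)) => //.
    exact: measurable_permute_tuple.
  by move=> A mA; apply/esym; apply: power_measure_subtuple => //; exact: perm_inj.
split => //; apply/integrableP; split.
  by apply: measurableT_comp mfX _; exact: measurable_permute_tuple.
by under eq_integral do rewrite gee0_abs ?lee_fin//; rewrite E.
Qed.

(** All terms have the same finite mean up to sign, so the integral is this mean times the sum of
    the signs over [H], which vanishes for balanced [H]. *)
Lemma integral_signed_sum n (f : m.-tuple 'rV[R]_n -> R) (H : {set 'S_m})
    (X : T -> 'rV[R]_n) :
  kernel_function f -> measurable_fun setT X -> kernel_mean f Q X < +oo ->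
  balanced H ->
  (power_measure Q m).-integrable setT (fun w => (signed_sum f H (map_tuple X w))%:E) /\
  \int[power_measure Q m]_w (signed_sum f H (map_tuple X w))%:E = 0.
Proof.
move=> kf mX fX bH.
have E w : (signed_sum f H (map_tuple X w))%:E =
    \sum_(s in H) (((-1) ^+ s : R)%:E * (f (map_tuple X (permute_tuple s w)))%:E).
  by rewrite /signed_sum -sumEFin; apply: eq_bigr => s _; rewrite -map_permute_tuple.
have I (s : 'S_m) : (power_measure Q m).-integrable setT
    (fun w => ((-1) ^+ s : R)%:E * (f (map_tuple X (permute_tuple s w)))%:E).
  by apply: integrableZl => //; exact: (signed_sum_integrable H kf mX fX s).1.
have {}E := funext E; rewrite /= in E *; rewrite E.
split; first exact: integrable_sum.
rewrite integral_sum//.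
have M0 : 0 <= kernel_mean f Q X.
  by apply: integral_ge0 => w _; rewrite lee_fin; exact: kf.2.
rewrite (eq_bigr (fun s : 'S_m => (((-1) ^+ s : R)%:E * kernel_mean f Q X))); last first.
  move=> s _; have [Is <-] := signed_sum_integrable H kf mX fX s.
  by rewrite integralZl.
rewrite -(fineK (_ : kernel_mean f Q X \is a fin_num)); last by rewrite ge0_fin_numE.
under eq_bigr do rewrite -EFinM.
by rewrite sumEFin -mulr_suml balanced_sum// mul0r.
Qed.

End law.

Lemma gsc_indep (Q : probability (V1 * V2)%type R) (f1 : m.-tuple V1 -> R)
    (f2 : m.-tuple V2 -> R) (H : {set 'S_m}) (X1 : V1 -> V1) (X2 : V2 -> V2) :
  indep Q -> balanced H -> kernel_function f1 -> kernel_function f2 ->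
  measurable_fun setT X1 -> measurable_fun setT X2 ->
  (kernel_mean f1 Q (fun z => X1 z.1) < +oo)%E ->
  (kernel_mean f2 Q (fun z => X2 z.2) < +oo)%E ->
  gsc f1 f2 H Q (fun z => X1 z.1) (fun z => X2 z.2) = 0%E.
Proof.
move=> iQ bH kf1 kf2 mX1 mX2 fX1 fX2.
pose P1 := marg1 Q; pose P2 := marg2 Q.
have fX1' : (kernel_mean f1 P1 X1 < +oo)%E.
  by rewrite (kernel_mean_law (Q := Q) (g := fst)) //; exact: kf1.1.
have fX2' : (kernel_mean f2 P2 X2 < +oo)%E.
  by rewrite (kernel_mean_law (Q := Q) (g := snd)) //; exact: kf2.1.
have [I1 E1] := integral_signed_sum kf1 mX1 fX1' bH.
have [I2 E2] := integral_signed_sum kf2 mX2 fX2' bH.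
pose a (x : m.-tuple V1) := signed_sum f1 H (map_tuple X1 x).
pose b (x : m.-tuple V2) := signed_sum f2 H (map_tuple X2 x).
pose h (z : m.-tuple V1 * m.-tuple V2) := (a z.1 * b z.2)%:E.
have ma : measurable_fun setT a.
  by apply: measurableT_comp; [exact: measurable_signed_sum kf1.1|exact: measurable_map_tuple].
have mb : measurable_fun setT b.
  by apply: measurableT_comp; [exact: measurable_signed_sum kf2.1|exact: measurable_map_tuple].
have mh : measurable_fun setT h.
  by apply/measurable_EFinP/measurable_funM; apply: measurableT_comp.
have [p pE] : exists p : probability (m.-tuple V1 * m.-tuple V2)%type R,
    (power_measure P1 m \x power_measure P2 m)%E = p.
  have [q1 ->] := power_measureP P1 m; have [q2 ->] := power_measureP P2 m.
  by exists (q1 \x q2)%E.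
have -> : gsc f1 f2 H Q (fun z => X1 z.1) (fun z => X2 z.2) = (\int[p]_z h z)%E.
  rewrite (@integral_law _ _ _ _ _ (power_measure Q m) p
    (fun z => (map_tuple fst z, map_tuple snd z)))//.
  - apply: eq_integral => w _; rewrite /h /gsc_kernel/=; congr (_ * _)%:E.
      by congr (signed_sum _ _ _); apply: eq_from_tnth => i; rewrite !tnth_map.
    by congr (signed_sum _ _ _); apply: eq_from_tnth => i; rewrite !tnth_map.
  - by apply/measurable_fun_pair; exact: measurable_map_tuple.
  - by move=> A mA; rewrite -[LHS]/((p : set _ -> \bar R) A) -pE; exact/esym/power_measure_unzip.
rewrite -pE -integral12_prod_meas1.
  rewrite /fubini_F integral0_eq// => x _; rewrite /h/=.
  under eq_integral do rewrite EFinM.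
  by rewrite integralZl// E2 mule0.
(* Fubini asks for integrability of the product; its absolute value factorises by Tonelli into two
   finite integrals. *)
apply/integrable12ltyP => //.
rewrite /h/=.
under eq_integral => x _.
  under eq_integral => y _ do rewrite normrM EFinM.
  rewrite ge0_integralZl//; last by apply/measurable_EFinP; exact: measurableT_comp.
  over.
rewrite /= ge0_integralZr//.
- have [_ I1'] := integrableP _ _ _ I1; have [_ I2'] := integrableP _ _ _ I2.
  by rewrite lte_mul_pinfty// ?integral_ge0// ge0_fin_numE// integral_ge0.
- by apply/measurable_EFinP; exact: measurableT_comp.
- by apply: integral_ge0.
Qed.

End gsc_theory.

(** * Domination by the product of the marginals *)

Section absolute_continuity.
Local Open Scope ereal_scope.

(** [S] is the set where the Radon-Nikodym density does not vanish. Domination is reversed there: if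
    the density has integral zero over [B], it vanishes almost everywhere on [B], so [B] meets [S]
    in a [mu]-null set. *)
Lemma carrier_set d (T : measurableType d) (R : realType)
    (mu : {sigma_finite_measure set T -> \bar R}) (P : probability T R) :
  P `<< mu -> exists S, [/\ measurable S, P (~` S) = 0 &
    forall B, measurable B -> P B = 0 -> mu (B `&` S) = 0].
Proof.
move=> Pmu; have [f [f0 ffin If Pf]] := radon_nikodym_sigma_finite Pmu.
have mf : measurable_fun setT f by exact: measurable_int If.
have mS : measurable [set x | f x != 0].
  by rewrite -[X in measurable X]setTI; exact: emeasurable_neq.
exists [set x | f x != 0]; split => //.
  rewrite Pf; last exact: measurableC.
  by apply: integral0_eq => x /= /negP; rewrite negbK => /eqP.
move=> B mB; rewrite Pf// => intB0.
have : \int[mu]_(x in B) `|f x| = 0.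
  by rewrite -[RHS]intB0; apply: eq_integral => x _; rewrite gee0_abs.
move=> /(ae_eq_integral_abs mu mB (measurable_funTS mf))[N [mN N0 BN]].
apply: subset_measure0 N0 => //; first exact: measurableI.
by move=> x [Bx /= fx]; apply: BN => /= /(_ Bx); apply/eqP.
Qed.

Context d1 d2 (T1 : measurableType d1) (T2 : measurableType d2) (R : realType).

(** Up to a [Q]-null set, [E] lies in the product of the carriers of the marginals. There marginal
    null sets are null for [m1] and [m2], so a set negligible for the product of the marginals is
    negligible for the product of [m1] and [m2], hence for [Q]. *)
Lemma dominates_product_marginals
    (m1 : {sigma_finite_measure set T1 -> \bar R})
    (m2 : {sigma_finite_measure set T2 -> \bar R})
    (Q : probability (T1 * T2)%type R) (P1 : probability T1 R)
    (P2 : probability T2 R) :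
  (forall A, measurable A -> (m1 \x m2) A = 0 -> Q A = 0) ->
  (forall A, measurable A -> P1 A = Q (fst @^-1` A)) ->
  (forall A, measurable A -> P2 A = Q (snd @^-1` A)) ->
  P1 `<< m1 -> P2 `<< m2 ->
  forall E, measurable E -> {ae P1, forall x, P2 [set y | E (x, y)] = 0} -> Q E = 0.
Proof.
move=> Qm P1E P2E P1m P2m E mE E0.
have [S1 [mS1 S10 P1S1]] := carrier_set P1m.
have [S2 [mS2 S20 P2S2]] := carrier_set P2m.
have mE2 : measurable (E `&` (snd @^-1` S2)).
  by apply: measurableI => //; exact: measurable_preimage measurable_snd mS2.
pose E' := E `&` (snd @^-1` S2) `&` (fst @^-1` S1).
have mE' : measurable E'.
  by apply: measurableI => //; exact: measurable_preimage measurable_fst mS1.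
have E'0 : Q E' = 0.
  apply: Qm => //; rewrite (product_measure_sectionE m1 m2 mE').
  pose B := [set x | m2 [set y | (E `&` (snd @^-1` S2)) (x, y)] != 0].
  have mB : measurable B.
    rewrite -[X in measurable X]setTI; apply: emeasurable_neq => //.
    exact: (measurable_section1 m2).
  have PB0 : P1 B = 0.
    have [N [mN N0 NE]] := E0; apply: subset_measure0 N0 => // x /= Bx.
    apply: NE => /= ex0; move/eqP: Bx; apply.
    rewrite -(P2S2 [set y | E (x, y)])//.
    exact: (measurable_preimage (measurable_fun_pair (measurable_cst x) (@measurable_id _ _ _)) mE).
  have m1B : {ae m1, forall x, ~ (B `&` S1) x}.
    exists (B `&` S1); split; [exact: measurableI|exact: P1S1|].
    by move=> x /= /contrapT.
  rewrite (ge0_ae_eq_integral (g := cst 0))//=; first exact: integral0.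
    exact: (measurable_section1 m2).
  apply: filterS m1B => x nBx _ /=.
  have [S1x|S1x] := pselect (S1 x); last first.
    rewrite (_ : [set _ | _] = set0) ?measure0//.
    by apply/seteqP; split => // y [_ /=].
  have : ~ B x by move=> Bx; apply: nBx.
  move=> /negP; rewrite negbK => /eqP <-; congr (m2 _); apply/seteqP.
  by split=> y [].
have EU : E `<=` E' `|` (fst @^-1` (~` S1) `|` snd @^-1` (~` S2)).
  move=> z Ez; have [z1|z1] := pselect (S1 z.1); last by right; left.
  by have [z2|z2] := pselect (S2 z.2); [left|right; right].
apply/negligibleP => //; apply: negligibleS EU _; apply: negligibleU.
  exact/negligibleP.
apply: negligibleU; apply/negligibleP.
- by apply: measurable_preimage measurable_fst _; exact: measurableC.
- by apply: etrans (esym (P1E _ _)) S10; exact: measurableC.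
- by apply: measurable_preimage measurable_snd _; exact: measurableC.
- by apply: etrans (esym (P2E _ _)) S20; exact: measurableC.
Qed.

End absolute_continuity.

(** * Recovering the observations from their scores *)

Section monotone_inverse.
Context {R : realType}.

(** The generalised inverse, a supremum of the [r] with [J r <= c], is defined for all [c] and
    nondecreasing, hence Borel. *)
Lemma increasing_inverse (J : R -> R) :
  {in `[0, 1[ &, {homo J : u v / u < v}} ->
  exists2 L : R -> R, measurable_fun setT L & forall r, 0 <= r < 1 -> L (J r) = r.
Proof.
move=> incJ.
(* The point 0 keeps the set nonempty when [c] is below all values of [J]. *)
pose E c := [set r | r = 0 \/ (0 <= r < 1 /\ J r <= c)].
pose L c := sup (E c).
have E0 c : E c !=set0 by exists 0; left.
have Eub c : has_sup (E c).
  by split => //; exists 1 => r [->//|[/andP[_ /ltW]]].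
have LE c c' : c <= c' -> L c <= L c'.
  move=> cc'; apply: le_sup; [|exact: E0|exact: Eub].
  move=> r Er; apply/downP; exists r => //; case: Er => [->|[r01 Jr]]; first by left.
  by right; split => //; exact: le_trans cc'.
exists L.
  apply: (measurability _ (RGenOInfty.measurableE R)).
  move=> _ [_ [a ->] <-]; rewrite setTI.
  apply: is_interval_measurable => x y; rewrite /= !in_itv/= !andbT => ax ay z /andP[xz _].
  by rewrite in_itv/= andbT; apply: lt_le_trans ax _; exact: LE.
move=> r r01; apply/eqP; rewrite eq_le; apply/andP; split.
  apply: ge_sup => // s [->|[s01 Js]]; first by case/andP: r01.
  rewrite leNgt; apply/negP => rs.
  have := incJ r s; rewrite !in_itv/= => /(_ r01 s01 rs); rewrite ltNge.
  by rewrite Js.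
by apply: ub_le_sup; [exact: (Eub _).2|right].
Qed.

Lemma strictly_monotone_inverse (J : R -> R) : strictly_monotone J ->
  exists2 L : R -> R, measurable_fun setT L & forall r, 0 <= r < 1 -> L (J r) = r.
Proof.
move=> [/increasing_inverse//|decJ].
have [|L mL LJ] := @increasing_inverse (fun r => - J r).
  by move=> u v u01 v01 uv; rewrite ltrN2; exact: decJ.
exists (fun c => L (- c)) => //.
by apply: measurableT_comp mL _; exact: oppr_measurable.
Qed.

(** An increasing score is compared with its value at 0, a decreasing one with its value at the
    midpoint of [r] and 1; both values are nonnegative. *)
Lemma strictly_monotone_gt0 (J : R -> R) r : score_function J ->
  strictly_monotone J -> 0 < r < 1 -> 0 < J r.
Proof.
move=> [J0 _] sJ /andP[r0 r1].
have r01 : r \in `[0, 1[ by rewrite in_itv/= r1 ltW.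
case: sJ => sJ.
  apply: le_lt_trans (J0 0 _) (sJ 0 r _ r01 r0); first by rewrite lexx ltr01.
  by rewrite in_itv/= lexx ltr01.
pose s := (r + 1) / 2.
have rs : r < s by rewrite /s; lra.
have s01 : 0 <= s < 1 by rewrite /s; lra.
apply: le_lt_trans (J0 s s01) (sJ s r _ r01 rs).
by rewrite in_itv.
Qed.

End monotone_inverse.

Section score_law.
Context {R : realType} {n : nat}.
Local Notation V := 'rV[R]_n.
Hypothesis n0 : (0 < n)%N.
Implicit Types (P : probability V R) (F : V -> V).

Lemma measurable_score_preimage (J : R -> R) (A : set V) : score_function J ->
  measurable A -> measurable (open_unit_ball `&` [set y | A (score_map J y)]).
Proof.
by move=> sJ mA; apply: (measurable_score_map sJ) => //; exact: measurable_ball_rV.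
Qed.

Lemma score_law_null P F (J : R -> R) (A : set V) :
  is_center_outward P F -> score_function J -> nonsingular_score J ->
  measurable A -> lebesgue_rV n A = 0%E ->
  P [set x | A (score_map J (F x))] = 0%E.
Proof.
move=> [mF F1 _ FE] sJ nJ mA A0.
have mB := measurable_score_preimage sJ mA.
rewrite (_ : [set x | _] = F @^-1` (open_unit_ball `&` [set y | A (score_map J y)])).
  rewrite -[LHS]/(pushforward P F _) FE//.
  by apply: (ball_uniform_score_null n0 sJ nJ mA A0 mB) => y [].
by apply/seteqP; split => x /=; [move=> ?; split => //; exact: F1|case].
Qed.

Lemma center_outward_inverse P F :
  is_center_outward P F ->
  exists2 T : V -> V, measurable_fun setT T & {ae P, forall x, T (F x) = x}.
Proof.
move=> [mF _ [phi cphi gphi] FE].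
have [T [N [mT mN N0 TN]]] := subgradient_inverse phi.
exists T => //.
have nN : {ae P, forall x, ~ N (F x)}.
  exists (F @^-1` N); split; first exact: measurable_preimage.
    by rewrite -[LHS]/(pushforward P F N) FE// ball_uniform_null.
  by move=> x /= /contrapT.
move: nN gphi; apply: filterS2 => x nNx /(gradient_subgradient cphi) sx.
exact: TN sx nNx.
Qed.

(** The norm of the score is [J (enorm y)], which the left inverse of [J] undoes; since it is
    positive, normalising the score returns the direction of [y]. *)
Lemma score_map_inverse (J : R -> R) : score_function J -> strictly_monotone J ->
  exists2 K : V -> V, measurable_fun setT K &
    forall y, y != 0 -> enorm y < 1 -> K (score_map J y) = y.
Proof.
move=> sJ mJ; have [L mL LJ] := strictly_monotone_inverse mJ.
exists (fun u => L (enorm u) *: direction u).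
  apply: measurable_rVZ; last exact: measurable_direction.
  by apply: measurableT_comp mL _; exact: measurable_enorm.
move=> y y0 y1; have ey0 : 0 < enorm y by rewrite lt_neqAle eq_sym enorm_eq0 y0 enorm_ge0.
have Jy0 : 0 < J (enorm y) by apply: strictly_monotone_gt0 => //; rewrite ey0.
have eJ : enorm (score_map J y) = J (enorm y).
  by rewrite /score_map (negbTE y0) enormZ ger0_norm ?divfK ?gt_eqF// divr_ge0 ?enorm_ge0// ltW.
rewrite eJ LJ ?y1 ?ltW// /direction eJ /score_map (negbTE y0) !scalerA.
rewrite (_ : _ * _ * _ = 1) ?scale1r//.
rewrite mulrA -[_ * _^-1 * _]mulrA mulVf ?gt_eqF// mulr1 divff// gt_eqF//.
Qed.

Lemma score_inverse P F (J : R -> R) :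
  is_center_outward P F -> score_function J -> strictly_monotone J ->
  exists2 T : V -> V, measurable_fun setT T &
    {ae P, forall x, T (score_map J (F x)) = x}.
Proof.
move=> cF sJ mJ; have [T mT TF] := center_outward_inverse cF.
have [K mK KJ] := score_map_inverse sJ mJ.
exists (T \o K); first exact: measurableT_comp.
(* The origin is null for [ball_uniform], so the case left out of [score_map_inverse] has
   probability zero. *)
have F0 : {ae P, forall x, F x != 0}.
  have [mF _ _ FE] := cF; exists (F @^-1` [set 0]); split.
  - apply: measurable_preimage => //.
    rewrite (_ : [set 0] = @enorm R n @^-1` [set 0%R]).
      by apply: measurable_preimage => //; exact: measurable_enorm.
    by apply/seteqP; split=> s /=; [move=> ->; exact: enorm0|move/eqP; rewrite enorm_eq0 => /eqP].
  - rewrite -[LHS]/(pushforward P F _) FE; last first.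
      rewrite (_ : [set 0] = @enorm R n @^-1` [set 0%R]).
        by apply: measurable_preimage => //; exact: measurable_enorm.
      by apply/seteqP; split=> s /=; [move=> ->; exact: enorm0|move/eqP; rewrite enorm_eq0 => /eqP].
    apply: ball_uniform_null; last exact: lebesgue_rV_set0.
    rewrite (_ : [set 0] = @enorm R n @^-1` [set 0%R]).
      by apply: measurable_preimage => //; exact: measurable_enorm.
    by apply/seteqP; split=> s /=; [move=> ->; exact: enorm0|move/eqP; rewrite enorm_eq0 => /eqP].
  - by move=> x /= /negP; rewrite negbK => /eqP.
move: F0 TF; apply: filterS2 => x Fx0 TFx /=.
by rewrite KJ//; have [_ F1 _ _] := cF.
Qed.

End score_law.

(** * Invariance and consistency of the rank-based GSC *)

Section rank_gsc_theory.
Local Open Scope ereal_scope.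
Context {R : realType} {d1 d2 m : nat}.
Local Notation V1 := 'rV[R]_d1.
Local Notation V2 := 'rV[R]_d2.
Hypotheses (d1_gt0 : (0 < d1)%N) (d2_gt0 : (0 < d2)%N).
Variables (f1 : m.-tuple V1 -> R) (f2 : m.-tuple V2 -> R).
Hypotheses (f1_kernel : kernel_function f1) (f2_kernel : kernel_function f2).
Variables (J1 J2 : R -> R).
Hypotheses (J1_score : score_function J1) (J2_score : score_function J2).
Variables (F1 : probability V1 R -> V1 -> V1) (F2 : probability V2 R -> V2 -> V2).
Hypotheses (F1_df : center_outward_df F1) (F2_df : center_outward_df F2).
Implicit Types (Q : probability (V1 * V2)%type R).

Lemma measurable_G1 Q : abs_cont (marg1 Q) -> measurable_fun setT (G1 F1 J1 Q).
Proof.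
move=> /F1_df [mF F1lt _ _].
exact: measurable_score_comp.
Qed.

Lemma measurable_G2 Q : abs_cont (marg2 Q) -> measurable_fun setT (G2 F2 J2 Q).
Proof.
move=> /F2_df [mF F2lt _ _].
exact: measurable_score_comp.
Qed.

Lemma ae_marg1 Q (p : V1 -> Prop) : {ae marg1 Q, forall x, p x} ->
  {ae Q, forall z, p z.1}.
Proof.
move=> [N [mN QN Np]]; exists (fst @^-1` N); split => //.
- exact: measurable_preimage measurable_fst mN.
- by move=> z pz; exact: Np.
Qed.

Lemma ae_marg2 Q (p : V2 -> Prop) : {ae marg2 Q, forall x, p x} ->
  {ae Q, forall z, p z.2}.
Proof.
move=> [N [mN QN Np]]; exists (snd @^-1` N); split => //.
- exact: measurable_preimage measurable_snd mN.
- by move=> z pz; exact: Np.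
Qed.

Lemma abs_cont_affine n (P P' : probability 'rV[R]_n R) (O : 'M[R]_n)
    (v : 'rV[R]_n) (a : R) :
  orthogonal_mx O -> (0 < a)%R ->
  (forall A, measurable A -> P' A = P ((fun x => v + a *: (x *m O^T))%R @^-1` A)) ->
  abs_cont P -> abs_cont P'.
Proof.
move=> oO a0 P'E /null_content_dominatesP acP; apply/null_content_dominatesP.
move=> A mA A0; rewrite P'E//.
have MN : ((a *: O^T) *m (a^-1 *: O) = 1%:M)%R.
  by rewrite -scalemxAl -scalemxAr scalerA divff ?gt_eqF// scale1r orthogonal_mxV.
rewrite (_ : _ @^-1` A = (mulmx^~ (a *: O^T) : 'rV[R]_n -> 'rV[R]_n) @^-1`
  ((fun x => x + v)%R @^-1` A)).
  apply: acP.
    by apply: measurable_preimage; [exact: measurable_rVM|exact: measurable_shift].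
  by apply: (lebesgue_rV_linear_null MN); [exact: measurable_shift|rewrite lebesgue_rV_shift].
by apply/seteqP; split=> x /=; rewrite scalemxAr addrC.
Qed.

Lemma rank_gsc_affine (H : {set 'S_m}) Q Q' (O1 : 'M[R]_d1) (O2 : 'M[R]_d2)
    (v1 : V1) (v2 : V2) (a1 a2 : R) :
  orthogonally_invariant f1 -> orthogonally_invariant f2 ->
  abs_cont_marginals Q -> orthogonal_mx O1 -> orthogonal_mx O2 ->
  (0 < a1)%R -> (0 < a2)%R ->
  (forall A, measurable A -> Q' A = pushforward Q (fun x =>
    (v1 + a1 *: (x.1 *m O1^T), v2 + a2 *: (x.2 *m O2^T))%R) A) ->
  rank_gsc F1 F2 J1 J2 f1 f2 H Q = rank_gsc F1 F2 J1 J2 f1 f2 H Q'.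
Proof.
move=> inv1 inv2 [ac1 ac2] oO1 oO2 a10 a20 Q'E.
set g := (fun x : V1 * V2 => _) in Q'E.
have mg1 : measurable_fun setT (fun x : V1 => v1 + a1 *: (x *m O1^T))%R.
  by apply: measurable_rVD => //; apply: measurable_rVZ => //; exact: measurable_rVM.
have mg2 : measurable_fun setT (fun x : V2 => v2 + a2 *: (x *m O2^T))%R.
  by apply: measurable_rVD => //; apply: measurable_rVZ => //; exact: measurable_rVM.
have mg : measurable_fun setT g.
  by apply/measurable_fun_pair; [exact: measurableT_comp mg1 _|exact: measurableT_comp mg2 _].
have m1E A : measurable A ->
    marg1 Q' A = marg1 Q ((fun x : V1 => v1 + a1 *: (x *m O1^T))%R @^-1` A).
  by move=> mA; rewrite /marg1/= /distribution/= /pushforward Q'E//;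
    exact: measurable_preimage measurable_fst mA.
have m2E A : measurable A ->
    marg2 Q' A = marg2 Q ((fun x : V2 => v2 + a2 *: (x *m O2^T))%R @^-1` A).
  by move=> mA; rewrite /marg2/= /distribution/= /pushforward Q'E//;
    exact: measurable_preimage measurable_snd mA.
have ac1' := abs_cont_affine oO1 a10 m1E ac1.
have ac2' := abs_cont_affine oO2 a20 m2E ac2.
have E1 := center_outward_affine_unique oO1 a10 m1E (F1_df ac1) (F1_df ac1').
have E2 := center_outward_affine_unique oO2 a20 m2E (F2_df ac2) (F2_df ac2').
have mG1 := measurable_G1 ac1; have mG2 := measurable_G2 ac2.
have mG1' := measurable_G1 ac1'; have mG2' := measurable_G2 ac2'.
have [mf1 mf2] := (f1_kernel.1, f2_kernel.1).
rewrite /rank_gsc [RHS](gsc_law (Q := Q) (g := g))//; last 2 first.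
- exact: measurableT_comp mG1' _.
- exact: measurableT_comp mG2' _.
rewrite [RHS](@gsc_ae_eq _ _ _ _ _ _ Q f1 f2 H _ (fun z => G1 F1 J1 Q z.1 *m O1^T)%R
   _ (fun z => G2 F2 J2 Q z.2 *m O2^T)%R) //.
- apply: eq_integral => w _; rewrite /gsc_kernel; congr (_ * _)%:E.
    rewrite -[LHS](@signed_sum_invariant R m d1 f1 H _ _ (fun w => esym (inv1 O1 w oO1))).
    by congr signed_sum; apply: eq_from_tnth => i; rewrite !tnth_map.
  rewrite -[LHS](@signed_sum_invariant R m d2 f2 H _ _ (fun w => esym (inv2 O2 w oO2))).
  by congr signed_sum; apply: eq_from_tnth => i; rewrite !tnth_map.
- by apply: measurableT_comp mg; exact: measurableT_comp mG1' _.
- by apply: measurableT_comp mg; exact: measurableT_comp mG2' _.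
- by apply: measurable_rVM; exact: measurableT_comp mG1 _.
- by apply: measurable_rVM; exact: measurableT_comp mG2 _.
- apply: (ae_imp (ae_marg1 E1)) => z /= E.
  by rewrite /G1 E score_map_orthogonal//; exact: orthogonal_mx_tr.
- apply: (ae_imp (ae_marg2 E2)) => z /= E.
  by rewrite /G2 E score_map_orthogonal//; exact: orthogonal_mx_tr.
Qed.

Lemma rank_gsc_I_consistent (H : {set 'S_m}) : balanced H ->
  I_consistent
    [set Q | abs_cont_marginals Q /\ finite_score_means F1 F2 J1 J2 f1 f2 Q]
    (rank_gsc F1 F2 J1 J2 f1 f2 H).
Proof.
move=> bH Q [[ac1 ac2] [fin1 fin2]] iQ.
by apply: gsc_indep => //; [exact: measurable_G1|exact: measurable_G2].
Qed.

Lemma jointly_abs_cont_product Q : jointly_abs_cont Q ->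
  forall A, measurable A -> (lebesgue_rV d1 \x lebesgue_rV d2) A = 0 -> Q A = 0.
Proof.
move=> /null_content_dominatesP acQ A mA A0.
pose s (x : 'rV[R]_(d1 + d2)) := (lsubmx x, rsubmx x).
have ms : measurable_fun setT s.
  apply/measurable_fun_pair; apply: measurable_fun_row => i;
    under eq_fun do rewrite mxE; exact: measurable_coord.
have E : A = (fun z => row_mx z.1 z.2) @^-1` (s @^-1` A).
  by apply/seteqP; split => -[x y]; rewrite /s/= row_mxKl row_mxKr.
have msA := measurable_preimage ms mA.
rewrite [in Q A]E -[LHS]/(pushforward Q (fun z => row_mx z.1 z.2 : 'rV[R]_(d1 + d2)) (s @^-1` A)).
by apply: acQ => //; apply: etrans (esym (lebesgue_rV_row_mx msA)) _; rewrite -E.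
Qed.

Lemma jointly_abs_cont_marginals Q : jointly_abs_cont Q -> abs_cont_marginals Q.
Proof.
move=> /jointly_abs_cont_product acQ; split; apply/null_content_dominatesP => A mA A0.
  apply: acQ; first exact: measurable_preimage measurable_fst mA.
  rewrite (_ : _ @^-1` _ = A `*` setT); last by apply/seteqP; split => -[x y]; [|case].
  by rewrite product_measure1E//= A0 mul0e.
apply: acQ; first exact: measurable_preimage measurable_snd mA.
rewrite (_ : _ @^-1` _ = setT `*` A); last by apply/seteqP; split => -[x y]; [|case].
by rewrite product_measure1E//= A0 mule0.
Qed.

(** The kernels are tested on the law [Q'] of the pair of scores: its plain GSC and kernel means are
    the rank-based ones of [Q], so membership in the class comes down to joint absolute continuity
    of [Q']. *)
Lemma rank_gsc_D_consistent (m4 : (4 <= m)%N) :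
  D_consistent_kernels m4 [set Q | jointly_abs_cont Q /\ finite_means f1 f2 Q] f1 f2 ->
  strictly_monotone J1 -> strictly_monotone J2 ->
  nonsingular_score J1 -> nonsingular_score J2 ->
  D_consistent
    [set Q | jointly_abs_cont Q /\ finite_score_means F1 F2 J1 J2 f1 f2 Q]
    (rank_gsc F1 F2 J1 J2 f1 f2 (Hstar m4)).
Proof.
move=> Df sJ1 sJ2 nJ1 nJ2 Q [acQ [fin1 fin2]] Q0.
have [ac1 ac2] := jointly_abs_cont_marginals acQ.
have mG1 := measurable_G1 ac1; have mG2 := measurable_G2 ac2.
have [mf1 mf2] := (f1_kernel.1, f2_kernel.1).
pose g (z : V1 * V2) := (G1 F1 J1 Q z.1, G2 F2 J2 Q z.2).
have mg : measurable_fun setT g.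
  by apply/measurable_fun_pair; [exact: measurableT_comp mG1 _|exact: measurableT_comp mG2 _].
have [Q' Q'E] := pushforward_probabilityP Q mg.
have Q'A A : measurable A -> Q' A = Q (g @^-1` A).
  by move=> mA; rewrite -[LHS]/((Q' : set _ -> \bar R) A) -Q'E.
have indepQ' : indep Q'.
  have [] // := Df Q'.
    split; last first.
      split; rewrite (kernel_mean_law (Q := Q) (g := g))//.
    apply/null_content_dominatesP => A mA A0.
    have mrow : measurable_fun setT
        (fun z : V1 * V2 => row_mx z.1 z.2 : 'rV[R]_(d1 + d2)).
      apply: measurable_fun_row => i; case: (splitP i) => j ij.
        have -> : i = lshift d2 j by exact: val_inj.
        under eq_fun do rewrite row_mxEl.
        by apply: measurableT_comp (measurable_coord j) _.
      have -> : i = rshift d1 j by exact: val_inj.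
      under eq_fun do rewrite row_mxEr.
      by apply: measurableT_comp (measurable_coord j) _.
    pose E := (fun z : V1 * V2 => row_mx z.1 z.2 : 'rV[R]_(d1 + d2)) @^-1` A.
    have mE : measurable E by exact: measurable_preimage.
    rewrite /pushforward Q'A//.
    apply: (@dominates_product_marginals _ _ _ _ _
      (lebesgue_rV d1) (lebesgue_rV d2) Q (marg1 Q) (marg2 Q)) => //.
    + exact: jointly_abs_cont_product.
    + exact: measurable_preimage.
    + have : (lebesgue_rV d1 \x lebesgue_rV d2) E = 0 by rewrite lebesgue_rV_row_mx.
      rewrite product_measure_sectionE// => int0.
      (* Almost every section of [E] is null, and [N] collects the exceptional first coordinates.
         The first score avoids [N] almost surely, and over any other point the second score misses
         the section almost surely, each by [score_law_null]. *)
      pose N := [set u : V1 | lebesgue_rV d2 [set v | E (u, v)] != 0].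
      have mN : measurable N.
        rewrite -[X in measurable X]setTI; apply: emeasurable_neq => //.
        exact: (measurable_section1 (lebesgue_rV d2)).
      have N0 : lebesgue_rV d1 N = 0.
        have : \int[lebesgue_rV d1]_x `|lebesgue_rV d2 [set y | E (x, y)]| = 0.
          by rewrite -[RHS]int0; apply: eq_integral => x _; rewrite gee0_abs.
        move=> /(ae_eq_integral_abs _ measurableT (measurable_section1 (lebesgue_rV d2) mE)).
        move=> [N' [mN' N'0 NN']]; apply: subset_measure0 N'0 => // x /= Nx.
        by apply: NN' => /= /(_ I); apply/eqP.
      exists [set x | N (G1 F1 J1 Q x)]; split.
      * exact: (measurable_preimage mG1).
      * exact: (score_law_null d1_gt0 (F1_df ac1)).
      * move=> x /= Ex; apply: contrapT => /negP; rewrite negbK => /eqP Ex0; apply: Ex.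
        apply: (score_law_null d2_gt0 (F2_df ac2) J2_score nJ2 _ Ex0).
        exact: (measurable_preimage (measurable_fun_pair
          (measurable_cst (G1 F1 J1 Q x)) (@measurable_id _ _ _)) mE).
  move=> _ _; apply; rewrite -Q0 /rank_gsc (gsc_law (Q := Q) (g := g))//.
have [T1 mT1 T1G] := score_inverse d1_gt0 (F1_df ac1) J1_score sJ1.
have [T2 mT2 T2G] := score_inverse d2_gt0 (F2_df ac2) J2_score sJ2.
move=> A B mA mB.
have mTA := measurable_preimage mT1 mA; have mTB := measurable_preimage mT2 mB.
have := indepQ' _ _ mTA mTB.
rewrite Q'A; last exact: measurableX.
have -> : marg1 Q' (T1 @^-1` A) = marg1 Q A.
  rewrite -[LHS]/(Q' (fst @^-1` _)) Q'A; last exact: measurable_preimage measurable_fst mTA.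
  apply: (@ae_measure_eq _ _ _ Q).
  - by apply: measurable_preimage mg _; exact: measurable_preimage measurable_fst mTA.
  - exact: measurable_preimage measurable_fst mA.
  - by apply: (ae_imp (ae_marg1 T1G)) => z /= E; rewrite /= -[in X in _ <-> X]E.
have -> : marg2 Q' (T2 @^-1` B) = marg2 Q B.
  rewrite -[LHS]/(Q' (snd @^-1` _)) Q'A; last exact: measurable_preimage measurable_snd mTB.
  apply: (@ae_measure_eq _ _ _ Q).
  - by apply: measurable_preimage mg _; exact: measurable_preimage measurable_snd mTB.
  - exact: measurable_preimage measurable_snd mB.
  - by apply: (ae_imp (ae_marg2 T2G)) => z /= E; rewrite /= -[in X in _ <-> X]E.
move=> <-; apply: (@ae_measure_eq _ _ _ Q).
- exact: measurableX.
- by apply: measurable_preimage mg _; exact: measurableX.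
- apply: (ae_imp (ae_and (ae_marg1 T1G) (ae_marg2 T2G))) => z /= [E1' E2'].
  by split=> -[]; rewrite -[in X in _ -> X]/(_ /\ _) /= /G1 /G2 ?E1' ?E2'.
Qed.

End rank_gsc_theory.

(** * Exact distribution-freeness *)

Section finite_tests.

(** The tests have finitely many joint outcomes [beta], so the event is a finite union of finite
    intersections, whatever [p] is. It serves for the [arg min], which is decided by comparisons of
    costs. *)
Lemma measurable_finite_tests d (T : measurableType d) (K : finType)
    (b : K -> T -> bool) (p : {ffun K -> bool} -> Prop) :
  (forall k, measurable [set w | b k w]) ->
  measurable [set w | p [ffun k => b k w]].
Proof.
move=> mb.
rewrite (_ : [set w | _] = \bigcup_(beta in [set beta | p beta])
    \bigcap_(k in [set: K]) [set w | b k w = beta k]); last first.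
  apply/seteqP; split => w /=.
    by move=> pw; exists [ffun k => b k w] => // k _; rewrite /= ffunE.
  move=> [beta /= pb bw]; rewrite (_ : [ffun k => _] = beta)//.
  by apply/ffunP => k; rewrite ffunE; exact: bw.
apply: fin_bigcup_measurable => // beta _.
apply: fin_bigcap_measurable => // k _.
case: (beta k); first exact: mb.
rewrite (_ : [set w | _] = ~` [set w | b k w]); first exact: measurableC.
by apply/seteqP; split => w /=; [move=> ->|move/negP/negbTE].
Qed.

End finite_tests.

(** * Optimal assignments and their ties *)

Section best_permutation.
Context {R : realType} {d n : nat}.
Local Notation V := 'rV[R]_d.
Implicit Types (pts z : 'I_n -> V) (s : 'S_n).

Definition cost pts z s : R := \sum_i enorm (z i - pts (s i)) ^+ 2.

Definition best_perm pts z : 'S_n := [arg min_(s < (1%g : 'S_n)) cost pts z s]%O.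

Lemma best_permP pts z s : cost pts z (best_perm pts z) <= cost pts z s.
Proof. by rewrite /best_perm; case: Order.TotalTheory.arg_minP => // t _; exact. Qed.

Lemma cost_comp pts z (r s : 'S_n) :
  cost pts (z \o r) s = cost pts z (r^-1 * s)%g.
Proof.
rewrite /cost [RHS](reindex_inj (@perm_inj _ r)); apply: eq_bigr => i _ /=.
by rewrite permM permK.
Qed.

(** [best_perm pts z] and the translate by the inverse of [r] of the optimum for [z \o r] both
    minimise the cost of [z]; injectivity makes the minimiser unique, so no tie-breaking rule
    interferes. *)
Lemma best_perm_comp pts z (r : 'S_n) : injective (cost pts z) ->
  best_perm pts (z \o r) = (r * best_perm pts z)%g.
Proof.
move=> inj; apply: (canRL (mulKVg _)); apply: inj; apply/eqP.
rewrite -cost_comp eq_le; apply/andP; split; last first.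
  by rewrite cost_comp; exact: best_permP.
by rewrite -[X in _ <= cost _ _ X](mulKg r) -cost_comp; exact: best_permP.
Qed.

Lemma measurable_best_perm dT (T : measurableType dT) pts (z : 'I_n -> T -> V) s :
  (forall i, measurable_fun setT (z i)) ->
  measurable [set w | best_perm pts (z ^~ w) = s].
Proof.
move=> mz.
have mc t : measurable_fun setT (fun w => cost pts (z ^~ w) t).
  apply: measurable_sum => i; apply: measurable_funX.
  apply: measurableT_comp; first exact: measurable_enorm.
  exact: measurable_rVD.
(* The [arg min] is the permutation picked among those whose cost is at most all others, so it is a
   function of the table of comparisons, with the same default. *)
pose h (beta : {ffun 'S_n * 'S_n -> bool}) : 'S_n :=
  odflt 1%g [pick t | [forall t', beta (t, t')]].
rewrite (_ : [set w | _] = [set w | (fun beta => h beta = s)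
   [ffun k => cost pts (z ^~ w) k.1 <= cost pts (z ^~ w) k.2]]).
  apply: (@measurable_finite_tests _ _ _
    (fun k w => cost pts (z ^~ w) k.1 <= cost pts (z ^~ w) k.2) (fun beta => h beta = s)) => k.
  by rewrite -[X in measurable X]setTI; apply: measurable_fun_ler.
apply/seteqP; split=> w /= <-; rewrite /best_perm /h /Order.arg_min /extremum;
  congr odflt; apply: eq_pick => t /=; apply: eq_forallb => t';
  by rewrite ffunE.
Qed.

(** A line directed by the normal [c] meets the hyperplane in exactly one point, and points are null
    on the line. *)
Lemma dotv_hyperplane_null (c : V) b : c != 0 ->
  lebesgue_rV d [set x | dotv x c = b] = 0%E.
Proof.
move=> c0.
have mE : measurable [set x : V | dotv x c = b].
  rewrite (_ : [set x | _] = (fun x : V => dotv x c) @^-1` [set b])//.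
  by apply: measurable_preimage => //; exact: measurable_dotv.
apply: (lines_null (v := c)) => // x.
rewrite (_ : [set t | _] = [set (b - dotv x c) / dotv c c]) ?lebesgue_measure_set1//.
have cc : dotv c c != 0 by rewrite dotv_eq0.
apply/seteqP; split=> t /=; rewrite dotvDl dotvZl.
  by move=> <-; rewrite addrC addKr mulfK.
by move=> ->; rewrite divfK// subrKC.
Qed.

End best_permutation.

Section finite_law.
Local Open Scope ereal_scope.
Context {R : realType} d (T : measurableType d) (P : {measure set T -> \bar R}).

Lemma measure_finite_values (K : finType) (h : T -> K) (B : K -> Prop) :
  (forall k, measurable [set w | h w = k]) ->
  P [set w | B (h w)] = \sum_(k | `[< B k >]) P [set w | h w = k].
Proof.
move=> mh.
rewrite (_ : [set w | _] = \bigcup_(k in [set k | B k]) [set w | h w = k]); last first.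
  by apply/seteqP; split => w /=; [move=> ?; exists (h w)|move=> [k Bk /= ->]].
rewrite measure_fin_bigcup//; first last.
- by move=> i j _ _ [w [/= <- <-]].
- exact: finite_finset.
rewrite (fsbigE [seq k <- index_enum K | `[< B k >]]).
- rewrite big_filter_cond; apply: eq_bigl => k.
  by apply/andb_idr => /asboolP Bk; rewrite inE.
- by rewrite filter_uniq// index_enum_uniq.
- by move=> k /=; rewrite mem_filter => /andP[/asboolP].
- by move=> k /= Bk; rewrite mem_filter mem_index_enum andbT => /asboolP.
Qed.

End finite_law.

Section power_measure_ties.
Local Open Scope ereal_scope.
Context {R : realType}.

Definition set_coord {T : Type} n (i0 : 'I_n) (z : n.-tuple T) (x : T) : n.-tuple T :=
  [tuple if i == i0 then x else tnth z i | i < n].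

(** A transposition moves the coordinate [i0] to the front; the recursive form of the power measure
    then lets Tonelli integrate it with all others fixed. *)
Lemma power_measure_coord_null d (T : measurableType d) (P : probability T R) n
    (i0 : 'I_n) (E : set (n.-tuple T)) : measurable E ->
  (forall z, P [set x | E (set_coord i0 z x)] = 0) -> power_measure P n E = 0.
Proof.
case: n i0 E => [[]//|n] i0 E mE E0.
pose t := tperm ord0 i0.
rewrite -(power_measure_subtuple P (@perm_inj _ t))//= /pushforward.
have [q ->] := power_measureP P n.
have mE' := measurable_preimage (measurable_subtuple (T := T) t) mE.
have mE'' := measurable_preimage (measurable_cons measurable_fst measurable_snd) mE'.
rewrite (product_measure_sectionE P q mE'') (measure_section_swap P q mE'').
apply: integral0_eq => u _ /=.
(* [point] fills the slot that [set_coord] overwrites. *)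
rewrite -[RHS](E0 (subtuple t [tuple of point :: u])); congr (P _).
apply/seteqP; split => x /=; rewrite (_ : set_coord _ _ _ = subtuple t [tuple of x :: u])//;
  apply: eq_from_tnth => i; rewrite !tnth_mktuple;
  (have [->|ii0] := eqVneq i i0; first by rewrite tpermR);
  (have : t i != ord0 by rewrite -(tpermR ord0 i0) (inj_eq perm_inj));
  by case: (unliftP ord0 (t i)) => [j ->|-> /eqP//]; rewrite !tnthS.
Qed.

Context {d n : nat}.
Local Notation V := 'rV[R]_d.
Variables (P : probability V R) (pts : 'I_n -> V).
Hypotheses (acP : abs_cont P) (pts_inj : injective pts).

Lemma measurable_cost s :
  measurable_fun setT (fun z : n.-tuple V => cost pts (tnth z) s).
Proof.
apply: measurable_sum => i; apply: measurable_funX.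
apply: measurableT_comp; first exact: measurable_enorm.
by apply: measurable_rVD => //; exact: measurable_tnth.
Qed.

Lemma measurable_tie s s' :
  measurable [set z : n.-tuple V | cost pts (tnth z) s = cost pts (tnth z) s'].
Proof.
rewrite (_ : [set z | _] = [set z : n.-tuple V | cost pts (tnth z) s == cost pts (tnth z) s']).
  by rewrite -[X in measurable X]setTI;
    exact: (measurable_fun_eqr (measurable_cost s) (measurable_cost s')).
by apply/seteqP; split => z /= /eqP.
Qed.

(** As functions of the single observation at an index [i0] where the permutations differ, the two
    costs have the same quadratic term; a tie is then an affine equation whose normal is the
    difference of two distinct grid points. *)
Lemma power_measure_tie s s' : s != s' ->
  power_measure P n [set z | cost pts (tnth z) s = cost pts (tnth z) s'] = 0.
Proof.
move=> ss'.
have [i0 i0P] : exists i0, s i0 != s' i0.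
  apply/existsP; rewrite -negb_forall; apply: contra ss' => /forallP ss'.
  by apply/eqP/permP => i; exact/eqP.
apply: (power_measure_coord_null (i0 := i0)).
  exact: measurable_tie.
move=> z.
pose rest (t : 'S_n) := (\sum_(i | i != i0) enorm (tnth z i - pts (t i)) ^+ 2)%R.
have costE t x : cost pts (tnth (set_coord i0 z x)) t =
    (enorm (x - pts (t i0)) ^+ 2 + rest t)%R.
  rewrite /cost (bigD1 i0)//= tnth_mktuple eqxx; congr (_ + _)%R.
  by apply: eq_bigr => i /negbTE ii0; rewrite tnth_mktuple ii0.
pose c := (pts (s' i0) - pts (s i0))%R.
have c0 : c != 0%R by rewrite subr_eq0 (inj_eq pts_inj) eq_sym.
have mH b : measurable [set x : V | dotv x c = b].
  rewrite (_ : [set x | _] = (fun x : V => dotv x c) @^-1` [set b])//.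
  by apply: measurable_preimage => //; exact: measurable_dotv.
have HP b : P [set x : V | dotv x c = b] = 0.
  by apply: (null_content_dominatesP _ _).1 acP _ (mH b) _; exact: dotv_hyperplane_null.
pose b := ((rest s' - rest s + dotv (pts (s' i0)) (pts (s' i0)) -
            dotv (pts (s i0)) (pts (s i0))) / 2)%R.
rewrite (_ : [set x | _] = [set x : V | dotv x c = b])//.
apply/seteqP; split => x /=; rewrite !costE !sqr_enorm /b /c !dotvBr !dotvBl;
  rewrite ![dotv (pts _) x]dotvC; lra.
Qed.

Lemma cost_injective_ae : {ae power_measure P n, forall z, injective (cost pts (tnth z))}.
Proof.
have [q qE] := power_measureP P n.
have : q.-negligible (\bigcup_(k : 'S_n * 'S_n)
    (if k.1 != k.2 then [set z | cost pts (tnth z) k.1 = cost pts (tnth z) k.2] else set0)).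
  apply: negligible_bigcup_count => -[s s'] /=; case: ifPn => ss'; last exact: negligible_set0.
  exists [set z | cost pts (tnth z) s = cost pts (tnth z) s']; split => //.
    exact: measurable_tie.
  by rewrite -[LHS]/((q : set _ -> \bar R) _) -qE; exact: power_measure_tie.
rewrite -qE; apply: negligibleS => z /= nz; apply: contrapT => nt; apply: nz => s s' ss'.
apply/eqP/negPn/negP => nss'; apply: nt; exists (s, s') => //=.
by rewrite nss'.
Qed.

Lemma measurable_best_perm_tuple s :
  measurable [set z : n.-tuple V | best_perm pts (tnth z) = s].
Proof.
apply: (@measurable_best_perm _ _ _ _ _ pts (fun i z => tnth z i) s) => i.
exact: measurable_tnth.
Qed.

(* Exchangeability: permuting z translates best_perm by a permutation. *)
Lemma best_perm_uniform s :
  power_measure P n [set z | best_perm pts (tnth z) = s] = (n`!%:R^-1)%:E.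
Proof.
have [q qE] := power_measureP P n.
have eqv s' : power_measure P n [set z | best_perm pts (tnth z) = s'] =
    power_measure P n [set z | best_perm pts (tnth z) = s].
  pose r := (s' * s^-1)%g.
  rewrite -(power_measure_subtuple P (@perm_inj _ r)); last exact: measurable_best_perm_tuple.
  have aei := cost_injective_ae; rewrite qE in aei *.
  apply: ae_measure_eq.
  - by apply: measurable_preimage; [exact: measurable_subtuple|exact: measurable_best_perm_tuple].
  - exact: measurable_best_perm_tuple.
  - apply: (ae_imp aei) => z iz /=.
    rewrite (_ : tnth (subtuple r z) = tnth z \o r); last first.
      by apply/funext => i; rewrite tnth_mktuple.
    rewrite best_perm_comp//; split=> [rz|->]; last by rewrite /r mulgKV.
    by rewrite -(mulKg r (best_perm _ _)) rz /r invMg invgK mulgKV.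
have : q [set z | True] = 1 by rewrite (_ : [set z | True] = setT)// probability_setT.
rewrite (measure_finite_values q (h := fun z => best_perm pts (tnth z))
  (fun=> True)); last exact: measurable_best_perm_tuple.
rewrite (eq_bigl xpredT); last by move=> k; exact/asboolP.
rewrite (eq_bigr (fun=> power_measure P n [set z | best_perm pts (tnth z) = s])); last first.
  by move=> s' _; rewrite -(eqv s') qE.
rewrite qE; set x := q _.
have : x \is a fin_num by rewrite fin_num_measure//; exact: measurable_best_perm_tuple.
move=> /fineK <-; rewrite sumEFin sumr_const card_Sn.
have fn0 : (n`!%:R : R) != 0%R by rewrite pnatr_eq0 -lt0n fact_gt0.
move=> -[] xE; congr _%:E.
by apply: (mulIf fn0); rewrite mulr_natr xE mulVf.
Qed.

End power_measure_ties.

(** * Grids, random subsets and the law of the configuration *)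

Section grid.
Context {R : realType} {d : nat} (g : grid_scheme R d).
Hypotheses (d_gt0 : (0 < d)%N) (g_adm : admissible_grid g).

Lemma admissible_gridP n : (0 < n)%N ->
  [/\ distinct_unit_vectors (dirs g (q := nS g n)),
      n = (nR g n * nS g n + n0 g n)%N, (n0 g n <= nS g n)%N &
      d = 1%N -> (n0 g n <= 1)%N].
Proof.
move=> n_gt0; have [_ adm1 adm2] := g_adm.
have [d1|d1] := eqVneq d 1%N.
  have [dir2 /(_ n)[nS2 nRE n0E]] := adm1 d1.
  have n01 : (n0 g n <= 1)%N.
    by rewrite n0E mul2n -[X in (X - _)%N]odd_double_half addnK leq_b1.
  split=> //; first by rewrite nS2.
    by rewrite nS2 nRE n0E muln2 mul2n subnKC// -[X in (_ <= X)%N]odd_double_half leq_addl.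
  by rewrite nS2; exact: leq_trans n01 _.
have d2 : (2 <= d)%N by rewrite ltn_neqAle eq_sym d1.
have [_ /(_ n n_gt0)[_ _ n0_lt nE] dir _ _] := adm2 d2.
split=> //; last by move=> dE; rewrite dE in d1.
by apply/ltnW/(leq_trans n0_lt); exact: geq_minr.
Qed.

(** The norm of a main grid point tells its shell, the direction its place there. The extra points
    lie at half of the first radius, on no shell; in dimension 1 the extra point is the origin,
    present at most once. *)
Lemma grid_point_inj n (A : {set 'I_(nS g n)}) :
  #|A| = n0 g n -> injective (grid_point A : 'I_n -> 'rV[R]_d).
Proof.
case: n A => [A _ []//|n'] A; set n := n'.+1 in A * => cardA.
have [[dir_inj dir1] nE _ n01] := @admissible_gridP n isT.
pose N : R := (nR g n).+1%:R.
have N_gt0 : 0 < N by rewrite ltr0n.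
have normdir (c : R) (j : 'I_(nS g n)) : 0 <= c -> enorm (c *: dirs g j) = c.
  by move=> c0; rewrite enormZ dir1 mulr1 ger0_norm.
have scale_inj c : c != 0 -> injective (fun j : 'I_(nS g n) => c *: dirs g j).
  by move=> c0 j j' /(scalerI c0) /dir_inj.
have sz : size (grid_seq A) = n.
  rewrite size_cat size_allpairs size_iota size_enum_ord.
  case: ifPn => _; first by rewrite size_nseq.
  by rewrite size_map -cardE cardA.
have un : uniq (grid_seq A).
  rewrite cat_uniq; apply/and3P; split.
  - apply: allpairs_uniq; [exact: iota_uniq|exact: enum_uniq|].
    move=> [r j] [r' j'] _ _ /= E.
    have rr : r = r'.
      have := congr1 enorm E; rewrite !normdir ?divr_ge0 ?ler0n//.
      by move=> /(divIf (lt0r_neq0 N_gt0))/eqP; rewrite eqr_nat => /eqP[].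
    by rewrite -{}rr in E *; rewrite (scale_inj _ _ _ _ E)// mulf_neq0 ?invr_eq0 ?pnatr_eq0.
  - apply/hasPn => x x2; apply/negP => /allpairsP[[r j]/= [_ _ xE]].
    have : enorm x = r.+1%:R / N by rewrite xE normdir// divr_ge0// ler0n.
    move: x2; case: ifPn => _.
      rewrite mem_nseq => /andP[_ /eqP ->]; rewrite enorm0 => /esym/eqP.
      by rewrite mulf_eq0 invr_eq0 !pnatr_eq0.
    move=> /mapP[j' _ ->]; rewrite normdir ?invr_ge0 ?mulr_ge0 ?ler0n// invfM.
    move=> /(mulIf (invr_neq0 (lt0r_neq0 N_gt0))) /(congr1 ( *%R^~ 2)).
    (* Equality of the norms would force [1 = (r + 1) * 2]. *)
    rewrite mulVf ?pnatr_eq0// -natrM => /eqP; rewrite (eqr_nat R 1).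
    by case: r {xE} => [|r]//; rewrite mulSn.
  - case: ifPn => [/eqP dE|_]; last first.
      rewrite map_inj_uniq ?enum_uniq//; apply: scale_inj.
      by rewrite invr_eq0 mulf_neq0 ?pnatr_eq0.
    by case: (n0 g n) (n01 dE) => [|[|]].
move=> i j /eqP; rewrite /grid_point nth_uniq ?sz ?ltn_ord// => /eqP.
exact: val_inj.
Qed.

End grid.

Section subset_law.
Local Open Scope ereal_scope.
Context {R : realType} d (T : measurableType d) (P : probability T R).

(** [without_replacement] prescribes only the probabilities of the subsets of size [k]. There are
    ['C(q, k)] of them, so their masses add up to 1 and every other subset gets 0. *)
Lemma without_replacement_law q k (S : T -> {set 'I_q}) (A : {set 'I_q}) :
  (k <= q)%N -> without_replacement P k S ->
  P (S @^-1` [set A]) = (if #|A| == k then ('C(q, k)%:R^-1)%:E else 0).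
Proof.
move=> kq wr; case: eqP => [/(wr A).2//|/eqP Ak].
have mS B : measurable [set w | S w = B] by exact: (wr B).1.
have : P [set w | True] = 1 by rewrite (_ : [set w | True] = setT)// probability_setT.
rewrite (measure_finite_values P (h := S) (fun=> True) mS).
rewrite (eq_bigl xpredT); last by move=> B; exact/asboolP.
rewrite (bigID (fun B : {set 'I_q} => #|B| == k))/=.
rewrite (eq_bigr (fun=> ('C(q, k)%:R^-1)%:E)); last by move=> B /eqP /(wr B).2.
rewrite sumEFin sumr_const.
rewrite (_ : #|_| = 'C(q, k)); last first.
  rewrite -[X in 'C(X, _)]card_ord -card_draws -sum1_card -sum1_card.
  by apply: eq_bigl => B; rewrite inE.
have -> : ('C(q, k)%:R^-1 *+ 'C(q, k) = 1 :> R)%R.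
  by rewrite -[LHS]mulr_natl mulfV// pnatr_eq0 -lt0n bin_gt0.
move=> E.
have : \sum_(B : {set 'I_q} | #|B| != k) P [set w | S w = B] = 0.
  move: (\sum_(_ | _) _) E => [r| |]//= -[] /eqP.
  by rewrite -subr_eq0 addrAC subrr add0r => /eqP ->.
rewrite (bigD1 A)//= => /eqP; rewrite padde_eq0//; last by apply: sume_ge0.
by move=> /andP[/eqP].
Qed.

End subset_law.

Section rank_law.
Local Open Scope ereal_scope.
Context {R : realType} {d1 d2 : nat}.
Local Notation V1 := 'rV[R]_d1.
Local Notation V2 := 'rV[R]_d2.
Variables (g1 : grid_scheme R d1) (g2 : grid_scheme R d2) (J1 J2 : R -> R).
Hypotheses (d1_gt0 : (0 < d1)%N) (d2_gt0 : (0 < d2)%N).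
Hypotheses (g1_adm : admissible_grid g1) (g2_adm : admissible_grid g2).
Context {dO} {Omega : measurableType dO} (P : probability Omega R).
Variables (Q : probability (V1 * V2)%type R) (s : sample Omega g1 g2).
Hypotheses (acQ : abs_cont_marginals Q) (sm : sampling_model P Q s).

(** The finite data on which the rank statistic depends: for each component, the random subset and
    the optimal assignment. The law of the statistic is computed from that of this finite-valued
    variable. *)
Definition configuration n : finType :=
  ({set 'I_(nS g1 n)} * 'S_n * ({set 'I_(nS g2 n)} * 'S_n))%type.

Definition config n (w : Omega) : configuration n :=
  (S1 s n w, best_perm (grid_point (S1 s n w)) (fun j : 'I_n => X1 s j w),
   (S2 s n w, best_perm (grid_point (S2 s n w)) (fun j : 'I_n => X2 s j w))).

Definition rank_map1 n (c : configuration n) (i : 'I_n) : V1 :=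
  score_map J1 (grid_point c.1.1 (c.1.2 i)).

Definition rank_map2 n (c : configuration n) (i : 'I_n) : V2 :=
  score_map J2 (grid_point c.2.1 (c.2.2 i)).

Definition observations n (w : Omega) : n.-tuple (V1 * V2)%type :=
  [tuple (X1 s i w, X2 s i w) | i < n].

Lemma measurable_observations n : measurable_fun setT (observations n).
Proof.
have [[mX _ _] _ _ _] := sm; apply/measurable_fun_tnthP => i.
rewrite (_ : _ \o _ = fun w => (X1 s i w, X2 s i w)); first exact: mX.
by apply/funext => w /=; rewrite tnth_mktuple.
Qed.

Lemma law_observations n A : measurable A ->
  P (observations n @^-1` A) = power_measure Q n A.
Proof.
have [[mX XQ Xind] _ _ _] := sm.
apply: law_tuple => [|B mB]; first exact: measurable_observations.
rewrite (eq_bigr (fun i : 'I_n => P [set w | B i (X1 s i w, X2 s i w)])); last first.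
  by move=> i _; rewrite XQ.
rewrite -Xind//.
congr (P _); apply/seteqP; split => w wB i; have := wB i;
  by rewrite /observations tnth_mktuple.
Qed.

Definition config_event n (k : configuration n) : set (n.-tuple (V1 * V2)%type) :=
  (fun z => (map_tuple fst z, map_tuple snd z)) @^-1`
    ([set z | best_perm (grid_point k.1.1) (tnth z) = k.1.2] `*`
     [set z | best_perm (grid_point k.2.1) (tnth z) = k.2.2]).

Lemma measurable_config_event n (k : configuration n) : measurable (config_event k).
Proof.
apply: measurable_preimage.
  by apply/measurable_fun_pair; apply: measurable_map_tuple.
by apply: measurableX; exact: measurable_best_perm_tuple.
Qed.

Lemma config_preimage n (k : configuration n) :
  [set w | config n w = k] =
  observations n @^-1` config_event k `&` S1 s n @^-1` [set k.1.1] `&`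
    S2 s n @^-1` [set k.2.1].
Proof.
have E1 w : tnth (map_tuple fst (observations n w)) = (fun j : 'I_n => X1 s j w).
  by apply/funext => j; rewrite tnth_map tnth_mktuple.
have E2 w : tnth (map_tuple snd (observations n w)) = (fun j : 'I_n => X2 s j w).
  by apply/funext => j; rewrite tnth_map tnth_mktuple.
case: k => -[A1 t1] [A2 t2]; rewrite /config_event; apply/seteqP; split => w.
  by rewrite /preimage /setX /setI/= E1 E2 => -[<- <- <- <-].
rewrite /preimage /setX /setI/= E1 E2.
by move=> [[[t1E t2E] A1E] A2E]; rewrite /config A1E A2E t1E t2E.
Qed.

Lemma measurable_config n (k : configuration n) : (0 < n)%N ->
  measurable [set w | config n w = k].
Proof.
have [_ wr1 wr2 _] := sm => n_gt0; rewrite config_preimage.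
apply: measurableI; last exact: (wr2 n n_gt0 _).1.
apply: measurableI; last exact: (wr1 n n_gt0 _).1.
by apply: measurable_preimage; [exact: measurable_observations|exact: measurable_config_event].
Qed.

(** The right-hand side mentions only [n] and the grid sizes: this is where the laws of the
    observations disappear. *)
Lemma config_law n (k : configuration n) : (0 < n)%N -> indep Q ->
  P [set w | config n w = k] =
  (n`!%:R^-1)%:E * (n`!%:R^-1)%:E *
  (if #|k.1.1| == n0 g1 n then ('C(nS g1 n, n0 g1 n)%:R^-1)%:E else 0) *
  (if #|k.2.1| == n0 g2 n then ('C(nS g2 n, n0 g2 n)%:R^-1)%:E else 0).
Proof.
move=> n_gt0 indQ; have [_ wr1 wr2 ind] := sm; rewrite config_preimage.
have [_ _ n01 _] := admissible_gridP d1_gt0 g1_adm n_gt0.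
have [_ _ n02 _] := admissible_gridP d2_gt0 g2_adm n_gt0.
rewrite (ind n n); last exact: measurable_config_event.
rewrite (without_replacement_law _ n01 (wr1 n n_gt0)).
rewrite (without_replacement_law _ n02 (wr2 n n_gt0)).
(* A subset of the wrong size makes both sides vanish; otherwise the grid points are pairwise
   distinct and the assignments are uniform. *)
case: eqP => [c1|_]; last by rewrite !mule0 !mul0e.
case: eqP => [c2|_]; last by rewrite !mule0.
congr (_ * _ * _).
rewrite -[LHS]/(P (observations n @^-1` _)) law_observations; last exact: measurable_config_event.
have [q1 q1E] := power_measureP (marg1 Q) n.
have [q2 q2E] := power_measureP (marg2 Q) n.
rewrite (power_measure_unzip (P1 := marg1 Q) (P2 := marg2 Q))//; last first.
  by apply: measurableX; exact: measurable_best_perm_tuple.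
rewrite product_measure1E; [|exact: measurable_best_perm_tuple..].
by congr (_ * _); apply: best_perm_uniform; [exact: acQ.1| |exact: acQ.2|];
  exact: grid_point_inj.
Qed.

End rank_law.

Section distribution_free.
Context {R : realType} {d1 d2 : nat}.
Local Notation V1 := 'rV[R]_d1.
Local Notation V2 := 'rV[R]_d2.
Variables (g1 : grid_scheme R d1) (g2 : grid_scheme R d2) (J1 J2 : R -> R).
Hypotheses (d1_gt0 : (0 < d1)%N) (d2_gt0 : (0 < d2)%N).
Hypotheses (g1_adm : admissible_grid g1) (g2_adm : admissible_grid g2).

Lemma rank_gsc_hat_distribution_free m (f1 : m.-tuple V1 -> R)
    (f2 : m.-tuple V2 -> R) (H : {set 'S_m})
    (Q Q' : probability (V1 * V2)%type R) (dO dO' : measure_display)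
    (Omega : measurableType dO) (Omega' : measurableType dO')
    (P : probability Omega R) (P' : probability Omega' R)
    (s : sample Omega g1 g2) (s' : sample Omega' g1 g2) :
  abs_cont_marginals Q -> abs_cont_marginals Q' -> indep Q -> indep Q' ->
  sampling_model P Q s -> sampling_model P' Q' s' ->
  forall (n : nat) (A : set R), measurable A ->
  P (rank_gsc_hat J1 J2 s f1 f2 H n @^-1` A) =
  P' (rank_gsc_hat J1 J2 s' f1 f2 H n @^-1` A).
Proof.
move=> acQ acQ' iQ iQ' sm sm' n A mA.
pose stat (k : configuration g1 g2 n) :=
  gsc_hat f1 f2 H (fun i => (rank_map1 J1 k i, rank_map2 J2 k i)).
(* For an empty sample the model leaves the laws of the random subsets open, but the statistic is
   then a constant. *)
have [n0|n_gt0] := posnP n.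
  have cstE T (f : T -> R) x : (forall w, f w = x) -> f @^-1` A = if x \in A then setT else set0.
    by move=> fE; rewrite (_ : f = cst x) ?preimage_cst//; exact/funext.
  pose c : 'I_n -> V1 * V2 := fun=> 0.
  have cE (z : 'I_n -> V1 * V2) : gsc_hat f1 f2 H z = gsc_hat f1 f2 H c.
    by congr (gsc_hat _ _ _ _); apply/funext => i; exfalso; have := ltn_ord i; rewrite {2}n0.
  rewrite !(cstE _ _ (gsc_hat f1 f2 H c))//; [|by move=> w; exact: cE..].
  by case: ifP => _; rewrite ?probability_setT ?measure0.
rewrite -[LHS]/(P [set w | A (stat (config s n w))]).
rewrite -[RHS]/(P' [set w | A (stat (config s' n w))]).
rewrite (measure_finite_values P (fun k => A (stat k)) (fun k => measurable_config sm k n_gt0)).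
rewrite (measure_finite_values P' (fun k => A (stat k)) (fun k => measurable_config sm' k n_gt0)).
apply: eq_bigr => k _.
apply: etrans (config_law d1_gt0 d2_gt0 g1_adm g2_adm acQ sm k n_gt0 iQ) _.
exact/esym/(config_law d1_gt0 d2_gt0 g1_adm g2_adm acQ' sm').
Qed.

End distribution_free.

(** * Strong consistency *)

Section counting.
Local Open Scope nat_scope.
Variables n m : nat.
Implicit Types (t : m.-tuple 'I_n) (P : pred 'I_n).

Lemma sum_uniq_tuples : \sum_(t : m.-tuple 'I_n | uniq t) 1 = n ^_ m.
Proof.
rewrite sum1_card -[X in X ^_ _]card_ord -card_uniq_tuples -sum1_card.
rewrite -[RHS]sum1_card; apply: eq_bigl => t; rewrite !inE.
by have /allP -> : {in t, forall x, xpredT x}.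
Qed.

(** Transposing two values is a bijection of the tuples, so every value is taken equally often at
    position [j]. The factor [n] keeps the identity in the natural numbers. *)
Lemma sum_uniq_tuples_tnth (j : 'I_m) P :
  n * \sum_(t : m.-tuple 'I_n | uniq t && P (tnth t j)) 1 = #|P| * n ^_ m.
Proof.
pose c b := \sum_(t : m.-tuple 'I_n | uniq t && (tnth t j == b)) 1.
have cE a b : c a = c b.
  rewrite /c (reindex_inj (h := map_tuple (tperm a b))); last first.
    move=> t t' /(congr1 val)/= /inj_map E; apply/val_inj/E; exact: perm_inj.
  apply: eq_bigl => t; rewrite map_inj_uniq; last exact: perm_inj.
  by rewrite tnth_map -[X in _ == X](tpermR a b) (inj_eq perm_inj).
have sumE P' : \sum_(t : m.-tuple 'I_n | uniq t && P' (tnth t j)) 1 = \sum_(b | P' b) c b.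
  rewrite (partition_big (fun t => tnth t j) P')/=; last by move=> t /andP[].
  apply: eq_bigr => b Pb; apply: eq_bigl => t; rewrite -andbA; congr (_ && _).
  by case: eqP => [->|]; rewrite ?Pb ?andbF.
rewrite sumE -sum_uniq_tuples (eq_bigl (fun t => uniq t && predT (tnth t j))); last first.
  by move=> t; rewrite andbT.
rewrite sumE; have [a _|P0] := pickP P; last by rewrite big_pred0// eq_card0 ?muln0.
have sumc P' : \sum_(b | P' b) c b = #|P'| * c a.
  by rewrite -sum_nat_const; apply: eq_bigr => b _; exact: cE.
by rewrite !sumc mulnCA card_ord.
Qed.

Lemma sum_uniq_tuples_meet P :
  n * \sum_(t : m.-tuple 'I_n | uniq t && [exists j, P (tnth t j)]) 1 <=
  m * #|P| * n ^_ m.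
Proof.
rewrite (@leq_trans (n * \sum_(j < m) \sum_(t : m.-tuple 'I_n | uniq t && P (tnth t j)) 1))//.
  rewrite leq_mul2l; apply/orP; right.
  rewrite [leqRHS](exchange_big_dep (fun t => uniq t && [exists j, P (tnth t j)]))/=; last first.
    by move=> j t _ /andP[-> Pt]; apply/existsP; exists j.
  apply: leq_sum => t /andP[tu /existsP[j Pj]].
  by rewrite (bigD1 j)/= ?tu.
rewrite big_distrr/= (eq_bigr (fun=> #|P| * n ^_ m)) ?sum_nat_const ?card_ord ?mulnA//.
by move=> j _; exact: sum_uniq_tuples_tnth.
Qed.

(** Pairs of tuples with a common index are a fraction at most [m * m / n] of all pairs; this is the
    source of the [1 / n] in the variance. *)
Lemma sum_uniq_tuples_pair_meet :
  n * \sum_(t : m.-tuple 'I_n | uniq t)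
        \sum_(t' : m.-tuple 'I_n | uniq t' && [exists j, tnth t' j \in t]) 1 <=
  m * m * (n ^_ m) ^ 2.
Proof.
rewrite big_distrr/= -[X in _ * X ^ 2]sum_uniq_tuples {1}sum_uniq_tuples expnS expn1.
rewrite -{1}sum_uniq_tuples big_distrl big_distrr/=; apply: leq_sum => t tu.
rewrite mul1n.
apply: leq_trans (sum_uniq_tuples_meet (mem t)) _.
by rewrite (card_uniqP tu) size_tuple.
Qed.

End counting.

Section tuple_sums.
Context {R : realType} {V : Type} {m : nat}.
Variable g : m.-tuple V -> R.

(** Ordered tuples of distinct indices replace increasing tuples with a symmetrised kernel;
    [gsc_hatE] shows that the averages agree. *)
Definition tuple_sum n (z : 'I_n -> V) : R :=
  \sum_(t : m.-tuple 'I_n | uniq t) g (map_tuple z t).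

Definition ustat n (z : 'I_n -> V) : R := (n ^_ m)%:R^-1 * tuple_sum z.

Lemma tuple_sum_widen n N (nN : (n <= N)%N) (z : 'I_N -> V) : (0 < n)%N ->
  tuple_sum (z \o widen_ord nN) =
  \sum_(t : m.-tuple 'I_N | uniq t && ~~ [exists j, n <= tnth t j]%N)
    g (map_tuple z t).
Proof.
case: n nN => // n nN _.
rewrite (reindex_onto (map_tuple (widen_ord nN)) 
    (map_tuple (fun i : 'I_N => inord i)))/=; last first.
  move=> t /andP[_ /existsPn tn]; apply: eq_from_tnth => j; rewrite !tnth_map.
  by apply: val_inj; rewrite /= inordK// ltnNge; exact: tn.
apply: eq_big => [t|t _]; last by congr g; apply: eq_from_tnth => j; rewrite !tnth_map.
rewrite map_inj_uniq; last by move=> i j /(congr1 val)/= /val_inj.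
rewrite (_ : [exists j, _] = false)/=; last first.
  by apply/existsP => -[j]; rewrite tnth_map/= leqNgt ltn_ord.
rewrite andbT; apply/esym/andb_idr => _; apply/eqP/eq_from_tnth => j.
by rewrite !tnth_map; apply: val_inj; rewrite /= inordK//.
Qed.

(** Tuples inside the first [n] indices contribute the shorter statistic with a smaller factor;
    those reaching beyond are a fraction at most [m * (N - n) / N] by [sum_uniq_tuples_meet], each
    term bounded by [M]. *)
Lemma ustat_interpolate n N (nN : (n <= N)%N) (z : 'I_N -> V) (M : R) :
  (0 < n)%N -> (m <= n)%N -> 0 <= M -> (forall x, `|g x| <= M) ->
  `|ustat z| <= `|ustat (z \o widen_ord nN)| + M * (m * (N - n))%:R / N%:R.
Proof.
move=> n_gt0 mn M0 gM.
have N_gt0 : (0 < N)%N by exact: leq_trans nN.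
have nm_gt0 : 0 < (n ^_ m)%:R :> R by rewrite ltr0n ffact_gt0.
have Nm_gt0 : 0 < (N ^_ m)%:R :> R by rewrite ltr0n ffact_gt0 (leq_trans mn).
have nmNm : (n ^_ m <= N ^_ m)%N.
  by rewrite -!bin_ffact leq_mul2r leq_bin2l// orbT.
rewrite /ustat !normrM !normfV !normr_nat.
rewrite {1}/tuple_sum (bigID (fun t : m.-tuple 'I_N => [exists j, n <= tnth t j]%N))/=.
rewrite -(tuple_sum_widen nN z n_gt0).
apply: le_trans (ler_wpM2l _ (ler_normD _ _)) _; first by rewrite invr_ge0 ler0n.
rewrite mulrDr addrC lerD//.
  by rewrite ler_wpM2r// lef_pV2// ler_nat.
rewrite ler_pdivrMl// mulrA ler_pdivlMr ?ltr0n// [leRHS]mulrCA.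
apply: le_trans (ler_wpM2r _ (ler_norm_sum _ _ _)) _; first exact: ler0n.
apply: le_trans (ler_wpM2r _ (ler_sum _ (fun t _ => gM _))) _; first exact: ler0n.
rewrite (eq_bigr (fun=> M * (1%N)%:R)); last by move=> t _; rewrite mulr1.
rewrite -mulr_sumr -natr_sum -mulrA ler_wpM2l// -!natrM ler_nat.
rewrite mulnC [leqRHS]mulnC.
have -> : (m * (N - n) = m * #|[pred i : 'I_N | n <= i]|)%N.
  congr (_ * _)%N; rewrite -sum1_card big_mkcond/=.
  rewrite -(big_mkord xpredT (fun i => if (n <= i)%N then 1%N else 0%N)).
  rewrite (big_cat_nat (leq0n n) nN)/= [X in (X + _)%N]big_nat_cond big1 ?add0n; last first.
    by move=> i; rewrite andbT => /andP[_ i_n]; rewrite leqNgt i_n.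
  rewrite big_nat_cond (eq_bigr (fun=> 1%N)); last by move=> i /andP[/andP[->]].
  by rewrite -big_nat_cond sum_nat_const_nat muln1.
exact: (@sum_uniq_tuples_meet N m [pred i : 'I_N | n <= i]%N).
Qed.

End tuple_sums.

Section bounded_functions.
Local Open Scope ereal_scope.
Context {R : realType}.

Lemma bounded_integrable d' (T' : measurableType d') (P : probability T' R)
    (h : T' -> R) (B : R) : measurable_fun setT h -> (forall x, `|h x| <= B)%R ->
  P.-integrable setT (EFin \o h).
Proof.
move=> mh hB; apply: measurable_bounded_integrable => //.
  by rewrite -ge0_fin_numE// fin_num_measure.
exists B; split; first exact: num_real.
by move=> x Bx y _; exact: le_trans (hB y) (ltW Bx).
Qed.

End bounded_functions.

Section ustat_second_moment.
Local Open Scope ereal_scope.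
Context {R : realType} d (T : measurableType d) (Q : probability T R) (m : nat).
Variables (g : m.-tuple T -> R) (M : R).
Hypotheses (mg : measurable_fun setT g) (gM : forall x, (`|g x| <= M)%R).

Lemma measurable_tuple_sum n :
  measurable_fun setT (fun u : n.-tuple T => tuple_sum g (tnth u)).
Proof.
rewrite /tuple_sum.
rewrite (_ : (fun _ => _) = fun u : n.-tuple T => (\sum_(t : m.-tuple 'I_n)
  if uniq t then g (subtuple (tnth t) u) else 0)%R); last first.
  apply/funext => u; rewrite big_mkcond; apply: eq_bigr => t _; case: ifP => // _.
  by congr g; apply: eq_from_tnth => i; rewrite tnth_map tnth_mktuple.
apply: measurable_sum => t; case: (uniq t) => //.
by apply: measurableT_comp => //; exact: measurable_subtuple.
Qed.

Lemma integral_le_bound d' (T' : measurableType d') (P : probability T' R)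
    (h : T' -> R) (B : R) : measurable_fun setT h -> (forall x, `|h x| <= B)%R ->
  \int[P]_x (h x)%:E <= B%:E.
Proof.
move=> mh hB.
rewrite -[leRHS]mule1 -(@probability_setT _ _ _ P) -integral_cst//.
apply: le_integral => //; first exact: bounded_integrable hB.
- apply: (@bounded_integrable _ _ _ _ (cst B) `|B|%R) => // x; exact: lexx.
- by move=> x _; rewrite lee_fin (le_trans (ler_norm _)).
Qed.

Hypothesis g0 : \int[power_measure Q m]_x (g x)%:E = 0.

(** Disjoint blocks of coordinates are independent, and each factor has mean zero. *)
Lemma integral_disjoint n (t t' : m.-tuple 'I_n) : uniq t -> uniq t' ->
  ~~ [exists j, tnth t' j \in t] ->
  \int[power_measure Q n]_u (g (subtuple (tnth t) u) * g (subtuple (tnth t') u))%:E = 0.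
Proof.
move=> /tuple_uniqP tI /tuple_uniqP tI' /existsPn tt'.
have [q qE] := power_measureP Q m; have [qn qnE] := power_measureP Q n.
pose h (z : m.-tuple T * m.-tuple T) := (g z.1 * g z.2)%:E.
have mh : measurable_fun setT h.
  by apply/measurable_EFinP/measurable_funM; apply: measurableT_comp.
have g0' : \int[q]_x (g x)%:E = 0 by rewrite -g0 qE.
rewrite qnE.
rewrite -(@integral_law _ _ _ _ _ qn (q \x q)
  (fun u => (subtuple (tnth t) u, subtuple (tnth t') u)) h)//; last 2 first.
- by apply/measurable_fun_pair; exact: measurable_subtuple.
- move=> A mA; rewrite -[RHS]/((qn : set _ -> \bar R) _) -qnE.
  rewrite (power_measure_subtuple2 Q tI tI' _ mA)//; last first.
    by move=> i j; apply: contraNneq (tt' j) => <-; exact: mem_tnth.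
  by rewrite qE.
rewrite -integral12_prod_meas1.
  rewrite /fubini_F integral0_eq// => x _; rewrite /h/=.
  under eq_integral do rewrite EFinM.
  by rewrite integralZl// ?g0' ?mule0//; exact: bounded_integrable gM.
apply: (@bounded_integrable _ _ _ (q \x q) (fun z => g z.1 * g z.2)%R (M * M)%R).
  by apply/measurable_EFinP.
by move=> z; rewrite normrM ler_pM.
Qed.

(** In the expanded square only pairs of tuples with a common index survive; each contributes at
    most [M ^+ 2], and [sum_uniq_tuples_pair_meet] counts them. *)
Lemma tuple_sum_second_moment n : (0 < n)%N ->
  \int[power_measure Q n]_u ((tuple_sum g (tnth u)) ^+ 2)%:E <=
  (M ^+ 2 * (m * m * (n ^_ m) ^ 2)%:R / n%:R)%:E.
Proof.
move=> n_gt0; have [qn qnE] := power_measureP Q n.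
pose G (t : m.-tuple 'I_n) u := g (subtuple (tnth t) u).
have GE (u : n.-tuple T) : ((tuple_sum g (tnth u)) ^+ 2)%R =
    (\sum_(t : m.-tuple 'I_n | uniq t) \sum_(t' : m.-tuple 'I_n | uniq t') G t u * G t' u)%R.
  rewrite expr2 mulr_suml; apply: eq_bigr => t _; rewrite mulr_sumr; apply: eq_bigr => t' _.
  by congr (g _ * g _)%R; apply: eq_from_tnth => i; rewrite tnth_map tnth_mktuple.
have mG t t' : measurable_fun setT (fun u => G t u * G t' u)%R.
  by apply: measurable_funM; apply: measurableT_comp => //; exact: measurable_subtuple.
have GM t t' u : (`|G t u * G t' u| <= M * M)%R.
  by rewrite normrM; apply: ler_pM => //; exact: gM.
have IG t t' : qn.-integrable setT (fun u => (G t u * G t' u)%:E).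
  exact: bounded_integrable (GM t t').
rewrite qnE; under eq_integral do rewrite GE -sumEFin.
rewrite integral_sum//; last first.
  move=> t.
  rewrite (_ : (fun _ => _) = (fun u => \sum_(t' : m.-tuple 'I_n | uniq t')
    (G t u * G t' u)%:E)).
    exact: integrable_sum.
  by apply/funext => u; rewrite sumEFin.
rewrite (@le_trans _ _ (\sum_(t : m.-tuple 'I_n | uniq t)
    \sum_(t' : m.-tuple 'I_n | uniq t' && [exists j, tnth t' j \in t]) (M * M)%:E))//.
  apply: lee_sum => t tu.
  under eq_integral do rewrite -sumEFin.
  rewrite integral_sum//.
  rewrite [leRHS]big_mkcondr/=; apply: lee_sum => t' tu'; case: ifPn => tt'.
    exact: integral_le_bound.
  by rewrite -[X in integral X]qnE integral_disjoint.
under eq_bigr do rewrite sumEFin.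
rewrite sumEFin lee_fin ler_pdivlMr ?ltr0n//.
rewrite (eq_bigr (fun t : m.-tuple 'I_n => (M ^+ 2 *
  (\sum_(t' : m.-tuple 'I_n | uniq t' && [exists j, tnth t' j \in t])
    1%N)%N%:R)%R)); last first.
  by move=> t _; rewrite natr_sum mulr_sumr; apply: eq_bigr => t' _; rewrite mulr1 expr2.
rewrite -mulr_sumr -natr_sum -mulrA ler_wpM2l ?sqr_ge0// -natrM ler_nat mulnC.
exact: sum_uniq_tuples_pair_meet.
Qed.

End ustat_second_moment.

(** * From perfect squares to all sample sizes *)

Section subsequence.
Context {R : realType}.

Lemma summable_cvg0 (a : nat -> R) : (forall k, 0 <= a k) ->
  (\sum_(0 <= k <oo) (a k)%:E < +oo)%E -> a k @[k --> \oo] --> 0.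
Proof.
move=> a0 suma; have aE k : (0 <= (a k)%:E)%E by rewrite lee_fin.
have tail0 := nneseries_tail_cvg suma (fun k _ => aE k).
apply/cvgr0Pnorm_lt => e e0.
have [fin /cvgr0Pnorm_lt /(_ e e0) near_e] := (fine_cvgP _ _).1 tail0.
near=> N.
rewrite ger0_norm//.
have finN : (\sum_(N <= k <oo) (a k)%:E)%E \is a fin_num by near: N.
have ltNe : `|fine (\sum_(N <= k <oo) (a k)%:E)%E| < e by near: N.
apply: le_lt_trans ltNe; rewrite -lee_fin; apply: (@le_trans _ _ (\sum_(N <= k <oo) (a k)%:E)%E).
  rewrite (nneseries_split _ 1)//= addn1 big_nat1 leeDl//.
  by apply: nneseries_ge0.
rewrite -[leLHS]fineK// lee_fin; exact: ler_norm.
Unshelve. all: by end_near.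
Qed.

(** The induction carries the sharper bound [2 - 1 / K] for [K] terms, since [1 / (x + 1) ^ 2] is at
    most [1 / x - 1 / (x + 1)]. *)
Lemma sum_inv_squares (K : nat) : \sum_(0 <= k < K) ((k.+1 ^ 2)%:R^-1 : R) <= 2.
Proof.
suff : \sum_(0 <= k < K.+1) ((k.+1 ^ 2)%:R^-1 : R) <= 2 - K.+1%:R^-1.
  rewrite big_nat_recr//= => KE.
  have x0 : 0 <= (K.+1 ^ 2)%:R^-1 :> R by rewrite invr_ge0.
  have y0 : 0 <= K.+1%:R^-1 :> R by rewrite invr_ge0.
  move: (\sum_(_ <= _ < _) _) (_ ^-1) (_ ^-1) KE x0 y0 => S x y; lra.
elim: K => [|K IHK]; first by rewrite big_nat1 exp1n invr1; lra.
rewrite big_nat_recr//=; apply: le_trans (lerD IHK (lexx _)) _.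
have K1 : 0 < K.+1%:R :> R by rewrite ltr0n.
rewrite natrX -addrA lerD2l -(natr1 K.+1).
move: K1; move: (K.+1%:R : R) => x x0.
have x1 : 0 < x + 1 by rewrite addr_gt0.
rewrite -subr_ge0 (_ : _ - _ = (x * (x + 1) ^+ 2)^-1).
  by rewrite invr_ge0 mulr_ge0 ?sqr_ge0// ltW.
by field; rewrite !gt_eqF.
Qed.

Lemma square_bracket N : (0 < N)%N -> exists k, (k.+1 ^ 2 <= N < k.+2 ^ 2)%N.
Proof.
case: N => // N _; elim: N => [|N [k /andP[kN Nk]]]; first by exists 0%N.
have [Nk2|kN2] := ltnP N.+2 (k.+2 ^ 2).
  by exists k; rewrite Nk2 (leq_trans kN).
exists k.+1; rewrite kN2/=; apply: leq_ltn_trans Nk _.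
by rewrite ltn_exp2r.
Qed.

(** Before the next square, [N] exceeds [(k + 1) ^ 2] by at most [2 * (k + 1)], so the correction
    term is at most [2 * c / (k + 1)]. *)
Lemma cvg_square_subsequence (u : nat -> R) (n0 : nat) (c : R) : 0 <= c ->
  (forall n N, (0 < n)%N -> (n0 <= n)%N -> (n <= N)%N ->
    `|u N| <= `|u n| + c * (N - n)%:R / N%:R) ->
  u (k.+1 ^ 2)%N @[k --> \oo] --> 0 -> u n @[n --> \oo] --> 0.
Proof.
move=> c0 uN /cvgr0Pnorm_lt u0; apply/cvgr0Pnorm_lt => e e0.
have [|K1 _ uK1] := u0 (e / 2); first by rewrite divr_gt0.
(* For [k >= K2] the correction [2 * c / (k + 1)] is below [e / 2]. *)
pose K2 := Num.Def.archi_bound (4 * c / e).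
pose K := maxn n0 (maxn K1 K2).
near=> N; have N_gt0 : (0 < N)%N by near: N; exists 1%N.
have [k /andP[kN Nk]] := square_bracket N_gt0.
have Kk : (K <= k)%N.
  have : (K.+1 ^ 2 <= N)%N by near: N; exists (K.+1 ^ 2)%N.
  move=> /leq_ltn_trans/(_ Nk); rewrite ltn_exp2r//.
move: Kk; rewrite !geq_max => /and3P[n0k K1k K2k].
have n0k2 : (n0 <= k.+1 ^ 2)%N.
  by apply: (leq_trans n0k); apply: (leq_trans (leqnSn k)); rewrite -{1}(expn1 k.+1) leq_pexp2l.
apply: le_lt_trans (uN _ _ _ n0k2 kN) _; first by rewrite expn_gt0.
rewrite (splitr e) ltrD//; first exact: uK1.
rewrite ltr_pdivrMr ?ltr0n//.
have kc : 4 * c < e * k.+1%:R.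
  rewrite -ltr_pdivrMl// mulrC.
  apply: lt_le_trans (archi_boundP _) _; first by rewrite divr_ge0 ?mulr_ge0// ltW.
  by rewrite ler_nat (leq_trans K2k).
apply: (@le_lt_trans _ _ (c * (2 * k.+1%:R))).
  rewrite ler_wpM2l// -natrM ler_nat leq_subLR -ltnS (leq_trans Nk)//.
  by rewrite -[k.+2]addn1 sqrnD exp1n muln1 -[leqRHS]addn1 addnAC.
apply: (@lt_le_trans _ _ (e / 2 * (k.+1 ^ 2)%:R)); last first.
  by rewrite ler_wpM2l ?ler_nat// ltW// divr_gt0.
have k1 : 0 < k.+1%:R :> R by rewrite ltr0n.
rewrite natrX expr2 [e / 2 * _]mulrA [c * _]mulrA ltr_pM2r//.
lra.
Unshelve. all: by end_near.
Qed.

End subsequence.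

Section ustat_slln.
Local Open Scope ereal_scope.
Context {R : realType} d (T : measurableType d) (Q : probability T R) (m : nat).
Variables (g : m.-tuple T -> R) (M : R).
Hypotheses (mg : measurable_fun setT g) (gM : forall x, (`|g x| <= M)%R).
Hypothesis g0 : \int[power_measure Q m]_x (g x)%:E = 0.
Context {dO} {Omega : measurableType dO} (P : probability Omega R).
Variable Z : nat -> Omega -> T.
Let obs n w : n.-tuple T := [tuple Z i w | i < n].
Hypothesis mobs : forall n, measurable_fun setT (obs n).
Hypothesis law_obs : forall n A, measurable A ->
  P (obs n @^-1` A) = power_measure Q n A.

Let U n w : R := ustat g (fun i : 'I_n => Z i w).

Let UE n w : U n w = ((n ^_ m)%:R^-1 * tuple_sum g (tnth (obs n w)))%R.
Proof.
rewrite /U /ustat; congr (_ * tuple_sum _ _)%R.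
by apply/funext => i; rewrite tnth_mktuple.
Qed.

Let measurable_U n : measurable_fun setT (U n).
Proof.
rewrite (_ : U n = fun w => ((n ^_ m)%:R^-1 * tuple_sum g (tnth (obs n w)))%R); last first.
  by apply/funext => w; rewrite UE.
apply: measurable_funM => //.
exact: (measurableT_comp (measurable_tuple_sum mg (n := n)) (@mobs n)).
Qed.

Let U_second_moment n : (0 < n)%N ->
  \int[P]_w ((U n w) ^+ 2)%:E <= (M ^+ 2 * (m * m)%:R / n%:R)%:E.
Proof.
move=> n_gt0; under eq_integral do rewrite UE exprMn EFinM.
have mS : measurable_fun setT (fun u : n.-tuple T => ((tuple_sum g (tnth u)) ^+ 2)%:E).
  by apply/measurable_EFinP/measurable_funX; exact: measurable_tuple_sum.
have [qn qnE] := power_measureP Q n.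
rewrite ge0_integralZl//; last 2 first.
- exact: (measurableT_comp mS (@mobs n)).
- by move=> w _; rewrite lee_fin sqr_ge0.
rewrite -(@integral_law _ _ _ _ _ P qn (obs n)
  (fun u => ((tuple_sum g (tnth u)) ^+ 2)%:E))//; first last.
- by move=> A mA; rewrite -[LHS]/((qn : set _ -> \bar R) _) -qnE; exact/esym/law_obs.
- exact: mobs.
have := tuple_sum_second_moment mg gM g0 n_gt0; rewrite qnE => moment.
apply: le_trans (lee_wpmul2l _ moment) _; first by rewrite lee_fin sqr_ge0.
rewrite -EFinM lee_fin natrM natrX.
have [->|nm0] := eqVneq ((n ^_ m)%:R : R)%R 0%R.
  by rewrite invr0 expr0n/= !mul0r divr_ge0// mulr_ge0 ?sqr_ge0.
rewrite le_eqVlt; apply/orP; left; apply/eqP; field.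
by rewrite nm0 pnatr_eq0 -lt0n n_gt0.
Qed.

(** Along the squares the second moments are summable, so almost surely the squared statistics have
    a finite sum and tend to 0; [ustat_interpolate] fills the gaps. *)
Lemma ustat_slln : {ae P, forall w,
  ustat g (fun i : 'I_n => Z i w) @[n --> \oo] --> (0 : R)%R}.
Proof.
pose h k w := ((U (k.+1 ^ 2) w) ^+ 2)%R.
have mh k : measurable_fun setT (EFin \o h k).
  by apply/measurable_EFinP; apply: measurable_funX; exact: measurable_U.
have h0 k w : 0 <= (h k w)%:E by rewrite lee_fin sqr_ge0.
have M0 : (0 <= M)%R by exact: le_trans (gM [tuple point | _ < m]).
have mM0 : (0 <= M ^+ 2 * (m * m)%:R)%R by rewrite mulr_ge0 ?sqr_ge0.
have fin_sum : \int[P]_w (\sum_(0 <= k <oo) (h k w)%:E) < +oo.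
  rewrite integral_nneseries//.
  apply: le_lt_trans (_ : _ <= (M ^+ 2 * (m * m)%:R * 2)%:E) (ltry _).
  apply: lime_le; first by apply: is_cvg_nneseries => k _ _; exact: integral_ge0.
  near=> K.
  apply: le_trans (lee_sum _ (fun k _ => U_second_moment (_ : 0 < k.+1 ^ 2)%N)) _ => [k|].
    by rewrite expn_gt0.
  rewrite sumEFin lee_fin -mulr_sumr ler_wpM2l//.
  exact: sum_inv_squares.
have msum : measurable_fun setT (fun w => \sum_(0 <= k <oo) (h k w)%:E).
  exact: (@ge0_emeasurable_sum _ _ _ setT (fun k w => (h k w)%:E) xpredT
    (fun k w _ _ => h0 k w) (fun k _ => mh k)).
have sum0 w : 0 <= \sum_(0 <= k <oo) (h k w)%:E by exact: nneseries_ge0.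
have Isum : P.-integrable setT (fun w => \sum_(0 <= k <oo) (h k w)%:E).
  apply/integrableP; split => //.
  by under eq_integral do rewrite gee0_abs//.
apply: (ae_imp (integrable_ae measurableT Isum)) => w /(_ I).
rewrite ge0_fin_numE// => sumw.
have hw0 : h k w @[k --> \oo] --> (0 : R)%R.
  by apply: summable_cvg0 => // k; exact: sqr_ge0.
apply: (@cvg_square_subsequence _ (U ^~ w) m (M * m%:R)%R).
- by rewrite mulr_ge0.
- move=> n N n_gt0 mn nN; rewrite -[(M * _ * _)%R]mulrA -natrM.
  exact: (ustat_interpolate nN (fun i : 'I_N => Z i w) n_gt0 mn M0 gM).
apply/cvgr0Pnorm_lt => e e0.
have /cvgr0Pnorm_lt/(_ (e ^+ 2)%R) := hw0.
rewrite exprn_gt0// => /(_ isT); apply: filterS => k.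
by rewrite ger0_norm ?sqr_ge0// /h -real_normK ?num_real// ltr_pXn2r// nnegrE ltW.
Unshelve. all: by end_near.
Qed.

End ustat_slln.

(** * The sample GSC as a U-statistic, and its stability *)

Section symmetrisation.
Context {R : realType} {d1 d2 m : nat}.
Local Notation V1 := 'rV[R]_d1.
Local Notation V2 := 'rV[R]_d2.
Variables (f1 : m.-tuple V1 -> R) (f2 : m.-tuple V2 -> R) (H : {set 'S_m}).

Let sorted_ord n (t : m.-tuple 'I_n) := sorted ltn (map val t).

Lemma permute_tuple_sorted_inj n :
  {in [set p : m.-tuple 'I_n * 'S_m | sorted_ord p.1]%SET &,
    injective (fun p => permute_tuple p.2 p.1)}.
Proof.
move=> [t s] [t' s']; rewrite !inE/= => ts ts' E.
have tu : uniq t by rewrite -(map_inj_uniq val_inj) (sorted_uniq ltn_trans ltnn).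
have perm (u : m.-tuple 'I_n) (r : 'S_m) : perm_eq (permute_tuple r u) u.
  by apply/tuple_permP; exists r.
have tt' : t = t'.
  apply/val_inj/(inj_map val_inj)/(irr_sorted_eq ltn_trans ltnn ts ts') => i.
  apply/perm_mem/perm_map.
  by apply: perm_trans (perm t' s'); rewrite -E perm_sym.
rewrite -tt' in E *; congr (_, _); apply/permP => i.
have := congr1 (fun u => tnth u i) E; rewrite !tnth_mktuple.
by apply/tuple_uniqP.
Qed.

Lemma permute_tuple_sorted_image n :
  [set permute_tuple p.2 p.1 | p in [set p : m.-tuple 'I_n * 'S_m | sorted_ord p.1]]%SET =
  [set t : m.-tuple 'I_n | uniq t]%SET.
Proof.
apply/setP => t; rewrite inE; apply/imsetP/idP => [[[u s]]|tu].
  rewrite inE/= => us ->.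
  have uu : uniq u by rewrite -(map_inj_uniq val_inj) (sorted_uniq ltn_trans ltnn).
  rewrite (perm_uniq (s2 := u))//.
  by apply/tuple_permP; exists s.
pose le (i j : 'I_n) := (i <= j)%N.
have u_size : size (sort le t) == m by rewrite size_sort size_tuple.
pose u : m.-tuple 'I_n := Tuple u_size.
have /tuple_permP[s tE] : perm_eq t u by rewrite perm_sym perm_sort.
exists (u, s); last by apply: val_inj.
rewrite inE /sorted_ord /= ltn_sorted_uniq_leq map_inj_uniq ?sort_uniq ?tu//=; last exact: val_inj.
rewrite sorted_map; apply: sort_sorted => i j; exact: leq_total.
Qed.

(** A tuple of distinct indices is, in exactly one way, a permutation of an increasing one; the
    normalisations agree since [n ^_ m] is the binomial coefficient times the number of
    permutations. *)
Lemma gsc_hatE n (z : 'I_n -> V1 * V2) : (m <= n)%N ->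
  gsc_hat f1 f2 H z = ustat (gsc_kernel f1 f2 H) z.
Proof.
move=> mn; rewrite /gsc_hat /ustat /sym_gsc_kernel -mulr_sumr mulrA -invfM -natrM bin_ffact.
congr (_ * _); rewrite /tuple_sum pair_big_dep/=.
rewrite (eq_bigr (fun p : m.-tuple 'I_n * 'S_m =>
    gsc_kernel f1 f2 H (map_tuple z (permute_tuple p.2 p.1)))); last first.
  by move=> p _; rewrite map_permute_tuple.
rewrite -(eq_bigl _ _ (fun p : m.-tuple 'I_n * 'S_m =>
  _ : (p \in [set p | sorted_ord p.1]%SET) = _)); last first.
  by move=> p; rewrite inE andbT.
rewrite -(big_imset (fun t => gsc_kernel f1 f2 H (map_tuple z t)) (@permute_tuple_sorted_inj n)).
by rewrite permute_tuple_sorted_image; apply: eq_bigl => t; rewrite inE.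
Qed.

Lemma signed_sum_bound d (f : m.-tuple 'rV[R]_d -> R) (C : R) x :
  (forall s : 'S_m, `|f (permute_tuple s x)| <= C) -> `|signed_sum f H x| <= #|H|%:R * C.
Proof.
move=> fC; apply: le_trans (ler_norm_sum _ _ _) _.
rewrite mulr_natl -sumr_const; apply: ler_sum => s _.
by rewrite normrM normrX normrN1 expr1n mul1r.
Qed.

Lemma signed_sum_dist d (f : m.-tuple 'rV[R]_d -> R) x y :
  `|signed_sum f H x - signed_sum f H y| <=
  \sum_(s in H) `|f (permute_tuple s x) - f (permute_tuple s y)|.
Proof.
rewrite /signed_sum -sumrB; apply: le_trans (ler_norm_sum _ _ _) _.
by apply: ler_sum => s _; rewrite -mulrBr normrM normrX normrN1 expr1n mul1r.
Qed.

Lemma sum_permute_tuple n d (f : m.-tuple 'rV[R]_d -> R) (x y : 'I_n -> 'rV[R]_d) (s : 'S_m) :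
  \sum_(t : m.-tuple 'I_n | uniq t)
    `|f (permute_tuple s (map_tuple x t)) - f (permute_tuple s (map_tuple y t))| =
  \sum_(t : m.-tuple 'I_n | uniq t) `|f (map_tuple x t) - f (map_tuple y t)|.
Proof.
rewrite [RHS](reindex_inj (h := permute_tuple s)); last first.
  move=> t t' E; apply: eq_from_tnth => i.
  have := congr1 (fun u => tnth u (s^-1 i)%g) E.
  by rewrite !tnth_mktuple permKV.
apply: eq_big => [t|t _]; last by rewrite !map_permute_tuple.
by apply/esym/perm_uniq/tuple_permP; exists s.
Qed.

(** In [a * b - a' * b' = (a - a') * b + a' * (b - b')] one factor of each product is bounded, which
    is why [C] bounds [f1] along [y1] and [f2] along [x2]. One factor [#|H|%:R] bounds a signed sum;
    the other counts the terms of the differences, which are equal once summed over tuples. *)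
Lemma ustat_gsc_kernel_dist n (x1 y1 : 'I_n -> V1) (x2 y2 : 'I_n -> V2) (C : R) :
  0 <= C -> (forall t : m.-tuple 'I_n, uniq t ->
    [/\ `|f1 (map_tuple y1 t)| <= C & `|f2 (map_tuple x2 t)| <= C]) ->
  `|ustat (gsc_kernel f1 f2 H) (fun i => (x1 i, x2 i)) -
    ustat (gsc_kernel f1 f2 H) (fun i => (y1 i, y2 i))| <=
  (#|H|%:R * C) * #|H|%:R *
  ((n ^_ m)%:R^-1 *
     (\sum_(t : m.-tuple 'I_n | uniq t)
        `|f1 (map_tuple x1 t) - f1 (map_tuple y1 t)|) +
   (n ^_ m)%:R^-1 *
     (\sum_(t : m.-tuple 'I_n | uniq t)
        `|f2 (map_tuple x2 t) - f2 (map_tuple y2 t)|)).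
Proof.
move=> C0 fC; rewrite /ustat -mulrBr -mulrDr normrM normfV normr_nat mulrCA.
rewrite ler_wpM2l ?invr_ge0 ?ler0n// /tuple_sum -sumrB.
apply: le_trans (ler_norm_sum _ _ _) _.
have permuteC k (f : m.-tuple 'rV[R]_k -> R) (x : 'I_n -> 'rV[R]_k) (t : m.-tuple 'I_n) :
    (forall t : m.-tuple 'I_n, uniq t -> `|f (map_tuple x t)| <= C) -> uniq t ->
    forall s : 'S_m, `|f (permute_tuple s (map_tuple x t))| <= C.
  move=> fxC tu s; rewrite -map_permute_tuple; apply: fxC.
  by rewrite (perm_uniq (s2 := t))//; apply/tuple_permP; exists s.
pose D1 t : R := \sum_(s in H)
  `|f1 (permute_tuple s (map_tuple x1 t)) - f1 (permute_tuple s (map_tuple y1 t))|.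
pose D2 t : R := \sum_(s in H)
  `|f2 (permute_tuple s (map_tuple x2 t)) - f2 (permute_tuple s (map_tuple y2 t))|.
apply: (@le_trans _ _ (\sum_(t : m.-tuple 'I_n | uniq t) (#|H|%:R * C) * (D1 t + D2 t))).
  apply: ler_sum => t tu; rewrite /gsc_kernel.
  have fstE (x : 'I_n -> V1) (y : 'I_n -> V2) :
      map_tuple fst (map_tuple (fun i => (x i, y i)) t) = map_tuple x t.
    by apply: eq_from_tnth => i; rewrite !tnth_map.
  have sndE (x : 'I_n -> V1) (y : 'I_n -> V2) :
      map_tuple snd (map_tuple (fun i => (x i, y i)) t) = map_tuple y t.
    by apply: eq_from_tnth => i; rewrite !tnth_map.
  rewrite !fstE !sndE.
  have b1 : `|signed_sum f1 H (map_tuple y1 t)| <= #|H|%:R * C.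
    by apply/signed_sum_bound/permuteC => // u /fC[].
  have b2 : `|signed_sum f2 H (map_tuple x2 t)| <= #|H|%:R * C.
    by apply/signed_sum_bound/permuteC => // u /fC[].
  have c1 : `|signed_sum f1 H (map_tuple x1 t) - signed_sum f1 H (map_tuple y1 t)| <= D1 t.
    exact: signed_sum_dist.
  have c2 : `|signed_sum f2 H (map_tuple x2 t) - signed_sum f2 H (map_tuple y2 t)| <= D2 t.
    exact: signed_sum_dist.
  move: b1 b2 c1 c2; move: (signed_sum f1 H _) (signed_sum f1 H _).
  move: (signed_sum f2 H _) (signed_sum f2 H _).
  move=> b' b a a' b1 b2 c1 c2.
  have -> : a * b - a' * b' = (a - a') * b + a' * (b - b') by ring.
  apply: le_trans (ler_normD _ _) _; rewrite !normrM mulrDr lerD//.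
    by rewrite mulrC ler_pM.
  by rewrite ler_pM.
rewrite -mulr_sumr -[leRHS]mulrA ler_wpM2l ?mulr_ge0//.
rewrite big_split/= mulrDr lerD// mulr_natl -sumr_const exchange_big/=;
  by apply: ler_sum => s _; rewrite sum_permute_tuple.
Qed.

End symmetrisation.

Section almost_sure.
Context {R : realType} d (T : measurableType d).

Lemma ae_forall_count (mu : {measure set T -> \bar R}) (I : countType) (p : I -> T -> Prop) :
  (forall i, {ae mu, forall x, p i x}) -> {ae mu, forall x, forall i, p i x}.
Proof.
move=> ap; have := @negligible_bigcup_count _ _ _ mu I (fun i => ~` [set x | p i x]) ap.
by apply: negligibleS => x /= /existsNP[i px]; exists i.
Qed.

Lemma probability1_ae (P : probability T R) (A : set T) : measurable A ->
  P A = 1%E -> {ae P, forall x, A x}.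
Proof.
move=> mA PA; exists (~` A); split => //; first exact: measurableC.
by rewrite probability_setC// PA subee.
Qed.

Lemma measurable_finite_values (K : finType) (h : T -> K) (B : K -> Prop) :
  (forall k, measurable [set w | h w = k]) -> measurable [set w | B (h w)].
Proof.
move=> mh.
rewrite (_ : [set w | _] = \bigcup_(k in [set k | B k]) [set w | h w = k]).
  by apply: fin_bigcup_measurable => // k _; exact: mh.
by apply/seteqP; split => w /=; [move=> ?; exists (h w)|move=> [k Bk /= ->]].
Qed.

End almost_sure.

(** On an empty index set the only permutation is the identity, which is even, so a group there has
    no odd element to match it. *)
Lemma balanced_gt0 m (H : {group 'S_m}) : balanced H -> (0 < m)%N.
Proof.
case: m H => // H /eqP; apply: contraLR => _.
have p1 (s : 'S_0) : s = 1%g by apply/permP => -[].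
rewrite eq_sym (_ : [set s in H | odd_perm s]%SET = finset.set0); last first.
  by apply/setP => s; rewrite !inE (p1 s) odd_perm1 andbF.
rewrite cards0 cards_eq0; apply/set0Pn; exists 1%g.
by rewrite !inE group1 odd_perm1.
Qed.

(** * Comparison with the U-statistic at the population scores *)

Section strong_consistency.
Context {R : realType} {d1 d2 m : nat}.
Local Notation V1 := 'rV[R]_d1.
Local Notation V2 := 'rV[R]_d2.
Variables (f1 : m.-tuple V1 -> R) (f2 : m.-tuple V2 -> R).
Hypotheses (f1_kernel : kernel_function f1) (f2_kernel : kernel_function f2).
Variables (J1 J2 : R -> R).
Hypotheses (J1_score : score_function J1) (J2_score : score_function J2).
Variables (F1 : probability V1 R -> V1 -> V1) (F2 : probability V2 R -> V2 -> V2).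
Hypotheses (F1_df : center_outward_df F1) (F2_df : center_outward_df F2).
Variables (g1 : grid_scheme R d1) (g2 : grid_scheme R d2).
Variables (H : {set 'S_m}) (m_gt0 : (0 < m)%N).
Variables (Q : probability (V1 * V2)%type R) (dO : measure_display).
Variables (Omega : measurableType dO) (P : probability Omega R).
Variables (s : sample Omega g1 g2) (C : R).
Hypotheses (acQ : abs_cont_marginals Q) (sm : sampling_model P Q s).

Let Y1 (z : V1 * V2) := G1 F1 J1 Q z.1.
Let Y2 (z : V1 * V2) := G2 F2 J2 Q z.2.
Let Z i w := (X1 s i w, X2 s i w).

Let mY1 : measurable_fun setT Y1.
Proof. by apply: measurableT_comp => //; exact: (measurable_G1 J1_score F1_df acQ.1). Qed.

Let mY2 : measurable_fun setT Y2.
Proof. by apply: measurableT_comp => //; exact: (measurable_G2 J2_score F2_df acQ.2). Qed.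

Hypothesis bounded : forall (n : nat) (t : m.-tuple 'I_n), uniq t ->
  P [set w | `|f1 (map_tuple (G1n J1 s n w) t)| <= C] = 1%E /\
  P [set w | `|f1 (map_tuple (fun i : 'I_n => G1 F1 J1 Q (X1 s i w)) t)| <= C]
    = 1%E /\
  P [set w | `|f2 (map_tuple (G2n J2 s n w) t)| <= C] = 1%E /\
  P [set w | `|f2 (map_tuple (fun i : 'I_n => G2 F2 J2 Q (X2 s i w)) t)| <= C]
    = 1%E.

Let bound_ge0 : 0 <= C.
Proof.
have u : uniq (ord_tuple m) by rewrite val_ord_tuple enum_uniq.
have [E _] := bounded u; rewrite leNgt; apply/negP => C0; move/eqP: E.
rewrite (_ : [set w | _] = set0); first by rewrite measure0 eq_sym onee_eq0.
by apply/seteqP; split => w //=; rewrite leNgt (lt_le_trans C0).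
Qed.

Let measurable_statistic k (f : m.-tuple 'rV[R]_k -> R) (Y : V1 * V2 -> 'rV[R]_k) n
    (t : m.-tuple 'I_n) : measurable_fun setT f -> measurable_fun setT Y ->
  measurable [set w | `|f (map_tuple (fun i : 'I_n => Y (Z i w)) t)| <= C].
Proof.
move=> mf mY.
rewrite (_ : [set w | _] = (fun w => f (map_tuple Y (subtuple (tnth t) (observations s n w))))
    @^-1` [set x | `|x| <= C]); last first.
  have E w : map_tuple (fun i : 'I_n => Y (Z i w)) t =
      map_tuple Y (subtuple (tnth t) (observations s n w)).
    by apply: eq_from_tnth => i; rewrite tnth_map [RHS]tnth_map !tnth_mktuple.
  by apply/seteqP; split => w /=; rewrite E.
apply: measurable_preimage; last first.
  rewrite (_ : [set x | _] = Num.norm @^-1` `]-oo, C]).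
    by apply: measurable_preimage => //; exact: measurable_itv.
  by apply/seteqP; split => x /=; rewrite in_itv.
apply: measurableT_comp => //; apply: measurableT_comp; first exact: measurable_map_tuple.
apply: measurableT_comp; first exact: measurable_subtuple.
exact: (measurable_observations sm).
Qed.

(** There are countably many pairs of [n] and [t], so one null set serves them all. Passing from
    probability one to almost surely uses measurability of the events: sample ranks take finitely
    many values, and population scores are measurable. *)
Let bounded_ae : {ae P, forall w, forall n (t : m.-tuple 'I_n), uniq t ->
  [/\ `|f1 (map_tuple (G1n J1 s n w) t)| <= C,
      `|f2 (map_tuple (G2n J2 s n w) t)| <= C,
      `|f1 (map_tuple (fun i : 'I_n => Y1 (Z i w)) t)| <= C &
      `|f2 (map_tuple (fun i : 'I_n => Y2 (Z i w)) t)| <= C]}.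
Proof.
apply: ae_forall_count => n; apply: ae_forall_count => t.
have [tu|ntu] := boolP (uniq t); last by apply: aeW => w.
have n_gt0 : (0 < n)%N.
  by apply: leq_trans m_gt0 _; rewrite -[n]card_ord -(size_tuple t) -(card_uniqP tu) max_card.
have [p1 [p2 [p3 p4]]] := bounded tu.
have := ae_and (ae_and (probability1_ae _ p1) (probability1_ae _ p2))
               (ae_and (probability1_ae _ p3) (probability1_ae _ p4)).
move=> ae4; have {}ae4 := ae4
  (measurable_finite_values
    (fun k => `|f1 (map_tuple (rank_map1 J1 k) t)| <= C)
    (fun k => measurable_config sm k n_gt0))
  (measurable_statistic t f1_kernel.1 mY1)
  (measurable_finite_values
    (fun k => `|f2 (map_tuple (rank_map2 J2 k) t)| <= C)
    (fun k => measurable_config sm k n_gt0))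
  (measurable_statistic t f2_kernel.1 mY2).
by apply: (ae_imp ae4) => w [[] ? ? []].
Qed.

Let X (z : V1 * V2) := (Y1 z, Y2 z).
Let h (z : m.-tuple (V1 * V2)) := gsc_kernel f1 f2 H (map_tuple X z).
Let B : R := (#|H|%:R * C) * (#|H|%:R * C).
(** Truncation to [[- B, B]]: [h] is bounded by [B] only almost surely, while [ustat_slln] asks for
    a kernel bounded everywhere. *)
Let clip (x : R) : R := Num.max (- B) (Num.min B x).

Let mh : measurable_fun setT h.
Proof.
apply: measurableT_comp; first exact: measurable_gsc_kernel f1_kernel.1 f2_kernel.1.
by apply: measurable_map_tuple; exact/measurable_fun_pair.
Qed.

Let clip_bound x : `|clip x| <= B.
Proof.
have B0 : 0 <= B by rewrite mulr_ge0// mulr_ge0.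
rewrite ler_norml /clip le_max lexx/= ge_max ge_min lexx andbT.
by rewrite (le_trans _ B0)// oppr_le0.
Qed.

Let clip_id x : `|x| <= B -> clip x = x.
Proof.
rewrite ler_norml => /andP[Bx xB]; rewrite /clip.
by rewrite (min_idPr xB) (max_idPr Bx).
Qed.

Let kernel_bound (z : m.-tuple (V1 * V2)) :
  (forall p : 'S_m, `|f1 (permute_tuple p (map_tuple Y1 z))| <= C) ->
  (forall p : 'S_m, `|f2 (permute_tuple p (map_tuple Y2 z))| <= C) -> `|h z| <= B.
Proof.
move=> b1 b2; rewrite /h /gsc_kernel normrM.
have -> : map_tuple fst (map_tuple X z) = map_tuple Y1 z.
  by apply: eq_from_tnth => i; rewrite !tnth_map.
have -> : map_tuple snd (map_tuple X z) = map_tuple Y2 z.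
  by apply: eq_from_tnth => i; rewrite !tnth_map.
by apply: ler_pM => //; exact: signed_sum_bound.
Qed.

Let sample_bound w : (forall n (t : m.-tuple 'I_n), uniq t ->
  [/\ `|f1 (map_tuple (G1n J1 s n w) t)| <= C,
      `|f2 (map_tuple (G2n J2 s n w) t)| <= C,
      `|f1 (map_tuple (fun i : 'I_n => Y1 (Z i w)) t)| <= C &
      `|f2 (map_tuple (fun i : 'I_n => Y2 (Z i w)) t)| <= C]) ->
  forall n (t : m.-tuple 'I_n), uniq t ->
    `|h (map_tuple (fun i : 'I_n => Z i w) t)| <= B.
Proof.
move=> bw n t tu.
have pu (p : 'S_m) : uniq (permute_tuple p t).
  by rewrite (perm_uniq (s2 := t))//; apply/tuple_permP; exists p.
have mapE k (Y : V1 * V2 -> 'rV[R]_k) (p : 'S_m) :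
    permute_tuple p (map_tuple Y (map_tuple (fun i : 'I_n => Z i w) t)) =
    map_tuple (fun i : 'I_n => Y (Z i w)) (permute_tuple p t).
  by rewrite map_permute_tuple; congr permute_tuple; apply: eq_from_tnth => i; rewrite !tnth_map.
by apply: kernel_bound => p; rewrite mapE; have [] := bw n _ (pu p).
Qed.

Let mclip : measurable_fun setT (fun z => clip (h z)).
Proof. by apply: measurable_maxr => //; exact: measurable_minr. Qed.

(** The bound is known on [Omega]; it is carried over because the law of the first [m] observations
    is the [m]-th power of [Q]. *)
Let clip_ae : {ae power_measure Q m, forall z, clip (h z) = h z}.
Proof.
pose A := [set z | clip (h z) != h z].
have mA : measurable A.
  rewrite (_ : A = ~` [set z | clip (h z) == h z]); last first.
    by apply/seteqP; split => z /= /negP.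
  by apply: measurableC; rewrite -[X in measurable X]setTI; exact: (measurable_fun_eqr mclip mh).
exists A; split => //; last by move=> z /= /eqP.
rewrite -[LHS]/(power_measure Q m A) -(law_observations sm mA).
have [N [mN PN Nsub]] := bounded_ae.
apply: (subset_measure0 _ mN _ PN) => //.
  by apply: measurable_preimage => //; exact: (measurable_observations sm).
move=> w /= Aw; apply: Nsub => /= bw; move/eqP: Aw; apply; apply: clip_id.
have := sample_bound bw (t := ord_tuple m).
rewrite val_ord_tuple enum_uniq => /(_ isT).
by congr (`|h _| <= B).
Qed.

Let mu : R := fine (\int[power_measure Q m]_z (clip (h z))%:E)%E.

Let Iclip : (power_measure Q m).-integrable setT (fun z => (clip (h z))%:E).
Proof.
have [q ->] := power_measureP Q m.
exact: (bounded_integrable (h := fun z => clip (h z)) q mclip (fun z => clip_bound _)).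
Qed.

Let muE : rank_gsc F1 F2 J1 J2 f1 f2 H Q = mu%:E.
Proof.
rewrite fineK; last exact: integrable_fin_num.
apply: ae_eq_integral => //; [exact/measurable_EFinP|exact/measurable_EFinP|].
by move: clip_ae; apply: filterS => z /= + _ => ->.
Qed.

Let g z := clip (h z) - mu.

Let mg : measurable_fun setT g.
Proof. exact: measurable_funB. Qed.

Let gB z : `|g z| <= B + `|mu|.
Proof. by apply: le_trans (ler_normB _ _) _; rewrite lerD2r. Qed.

Let g0 : (\int[power_measure Q m]_z (g z)%:E = 0)%E.
Proof.
have Imu : (power_measure Q m).-integrable setT (EFin \o cst mu).
  have [q ->] := power_measureP Q m.
  exact: (bounded_integrable (h := cst mu) q (measurable_cst _) (fun=> lexx `|mu|)).
under eq_integral do rewrite EFinB.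
rewrite integralB_EFin//.
rewrite -[X in (X - _)%E]fineK; last exact: integrable_fin_num.
rewrite -/mu [X in (_ - X)%E](integral_cst _ measurableT mu%:E).
apply: etrans (congr1 (fun x => mu%:E - mu%:E * x)%E (power_measure_setT Q m)) _.
by rewrite mule1 subee.
Qed.

Lemma rank_gsc_hat_consistent :
  {ae P, forall w,
    ((n - m)`!)%:R / n`!%:R * (\sum_(t : m.-tuple 'I_n | uniq t)
      `|f1 (map_tuple (G1n J1 s n w) t) -
        f1 (map_tuple (fun i : 'I_n => G1 F1 J1 Q (X1 s i w)) t)|)
    @[n --> \oo] --> (0 : R)} ->
  {ae P, forall w,
    ((n - m)`!)%:R / n`!%:R * (\sum_(t : m.-tuple 'I_n | uniq t)
      `|f2 (map_tuple (G2n J2 s n w) t) -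
        f2 (map_tuple (fun i : 'I_n => G2 F2 J2 Q (X2 s i w)) t)|)
    @[n --> \oo] --> (0 : R)} ->
  {ae P, forall w,
    (rank_gsc_hat J1 J2 s f1 f2 H n w)%:E @[n --> \oo] -->
      rank_gsc F1 F2 J1 J2 f1 f2 H Q}.
Proof.
move=> D1 D2.
have slln := @ustat_slln _ _ _ Q m g _ mg gB g0 _ _ P Z
  (fun n => @measurable_observations _ _ _ _ _ _ _ P Q s sm n)
  (fun n A mA => law_observations sm mA).
apply: (ae_imp (ae_and (ae_and D1 D2) (ae_and slln bounded_ae))) => w [[D1w D2w] [gw bw]].
rewrite muE; apply: cvg_EFin; first exact: nearW.
pose e n := rank_gsc_hat J1 J2 s f1 f2 H n w - (ustat g (fun i : 'I_n => Z i w) + mu).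
suff e0 : e n @[n --> \oo] --> (0 : R).
  rewrite (_ : _ \o _ = fun n => e n + (ustat g (fun i : 'I_n => Z i w) + mu)); last first.
    by apply/funext => n; rewrite /e subrK.
  rewrite -[X in _ --> X]add0r -[X in _ + X]add0r.
  by apply: cvgD => //; apply: cvgD => //; exact: cvg_cst.
apply/norm_cvg0P.
pose K := (#|H|%:R * C) * #|H|%:R.
apply: (squeeze_cvgr (f := cst 0) (h := fun n => K *
  (((n - m)`!)%:R / n`!%:R * (\sum_(t : m.-tuple 'I_n | uniq t)
      `|f1 (map_tuple (G1n J1 s n w) t) -
        f1 (map_tuple (fun i : 'I_n => G1 F1 J1 Q (X1 s i w)) t)|) +
   ((n - m)`!)%:R / n`!%:R * (\sum_(t : m.-tuple 'I_n | uniq t)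
      `|f2 (map_tuple (G2n J2 s n w) t) -
        f2 (map_tuple (fun i : 'I_n => G2 F2 J2 Q (X2 s i w)) t)|)))); last 2 first.
- exact: cvg_cst.
- by rewrite -[X in _ --> X](mulr0 K); apply: cvgMr; rewrite -[X in _ --> X]addr0; exact: cvgD.
near=> n; rewrite normr_ge0/=.
have mn : (m <= n)%N by near: n; exists m.
have facE : ((n - m)`!)%:R / n`!%:R = (n ^_ m)%:R^-1 :> R.
  by rewrite -(ffact_fact mn) natrM invfM mulrCA mulfV ?mulr1.
rewrite facE /e /rank_gsc_hat gsc_hatE//.
(* Clipping is inactive along this sample, and averaging the constant [mu] returns [mu], so only the
   U-statistic at the population scores remains. *)
rewrite (_ : ustat g _ + mu = ustat (gsc_kernel f1 f2 H)
    (fun i : 'I_n => (Y1 (Z i w), Y2 (Z i w)))).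
  apply: ustat_gsc_kernel_dist => // t tu.
  by have [] := bw n t tu.
rewrite /ustat /tuple_sum (eq_bigr (fun t : m.-tuple 'I_n =>
  gsc_kernel f1 f2 H (map_tuple (fun i : 'I_n => (Y1 (Z i w), Y2 (Z i w))) t) - mu)); last first.
  move=> t tu; rewrite /g clip_id; last exact: sample_bound.
  by congr (gsc_kernel _ _ _ _ - _); apply: eq_from_tnth => i; rewrite !tnth_map.
rewrite sumrB mulrBr.
rewrite [X in _ - _ * X](eq_bigr (fun=> mu * (1%N)%:R)); last by move=> t _; rewrite mulr1.
rewrite -mulr_sumr -natr_sum sum_uniq_tuples mulrCA mulVf ?mulr1 ?subrK//.
by rewrite pnatr_eq0 -lt0n ffact_gt0.
Unshelve. all: by end_near.
Qed.

End strong_consistency.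

Theorem proposition4p2 (R : realType) (d1 d2 m : nat)
    (d1_gt0 : (0 < d1)%N) (d2_gt0 : (0 < d2)%N)
    (f1 : m.-tuple 'rV[R]_d1 -> R) (f2 : m.-tuple 'rV[R]_d2 -> R)
    (f1_kernel : kernel_function f1) (f2_kernel : kernel_function f2)
    (H : {group 'S_m}) (H_balanced : balanced H)
    (J1 J2 : R -> R)
    (J1_score : score_function J1) (J2_score : score_function J2)
    (F1 : probability 'rV[R]_d1 R -> 'rV[R]_d1 -> 'rV[R]_d1)
    (F2 : probability 'rV[R]_d2 R -> 'rV[R]_d2 -> 'rV[R]_d2)
    (F1_df : center_outward_df F1) (F2_df : center_outward_df F2)
    (g1 : grid_scheme R d1) (g2 : grid_scheme R d2)
    (g1_adm : admissible_grid g1) (g2_adm : admissible_grid g2) :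
  (forall (Q Q' : probability ('rV[R]_d1 * 'rV[R]_d2)%type R)
      (dO dO' : measure_display)
      (Omega : measurableType dO) (Omega' : measurableType dO')
      (P : probability Omega R) (P' : probability Omega' R)
      (s : sample Omega g1 g2)
      (s' : sample Omega' g1 g2),
    abs_cont_marginals Q -> abs_cont_marginals Q' ->
    indep Q -> indep Q' ->
    sampling_model P Q s -> sampling_model P' Q' s' ->
    forall (n : nat) (A : set R), measurable A ->
      P (rank_gsc_hat J1 J2 s f1 f2 H n @^-1` A) =
      P' (rank_gsc_hat J1 J2 s' f1 f2 H n @^-1` A)) /\
  (orthogonally_invariant f1 -> orthogonally_invariant f2 ->
   forall (Q Q' : probability ('rV[R]_d1 * 'rV[R]_d2)%type R)
      (O1 : 'M[R]_d1) (O2 : 'M[R]_d2) (v1 : 'rV[R]_d1) (v2 : 'rV[R]_d2)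
      (a1 a2 : R),
    abs_cont_marginals Q ->
    orthogonal_mx O1 -> orthogonal_mx O2 -> 0 < a1 -> 0 < a2 ->
    (forall A, measurable A ->
      Q' A = pushforward Q (fun x =>
        (v1 + a1 *: (x.1 *m O1^T), v2 + a2 *: (x.2 *m O2^T))) A) ->
    rank_gsc F1 F2 J1 J2 f1 f2 H Q = rank_gsc F1 F2 J1 J2 f1 f2 H Q') /\
  I_consistent
    [set Q : probability ('rV[R]_d1 * 'rV[R]_d2)%type R |
      abs_cont_marginals Q /\ finite_score_means F1 F2 J1 J2 f1 f2 Q]
    (rank_gsc F1 F2 J1 J2 f1 f2 H) /\
  (forall m4 : (4 <= m)%N,
    D_consistent_kernels m4
      [set Q : probability ('rV[R]_d1 * 'rV[R]_d2)%type R |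
        jointly_abs_cont Q /\ finite_means f1 f2 Q] f1 f2 ->
    strictly_monotone J1 -> strictly_monotone J2 ->
    nonsingular_score J1 -> nonsingular_score J2 ->
    D_consistent
      [set Q : probability ('rV[R]_d1 * 'rV[R]_d2)%type R |
        jointly_abs_cont Q /\ finite_score_means F1 F2 J1 J2 f1 f2 Q]
      (rank_gsc F1 F2 J1 J2 f1 f2 (Hstar m4))) /\
  (forall (Q : probability ('rV[R]_d1 * 'rV[R]_d2)%type R)
      (dO : measure_display) (Omega : measurableType dO)
      (P : probability Omega R) (s : sample Omega g1 g2) (C : R),
    abs_cont_marginals Q -> sampling_model P Q s ->
    (forall (n : nat) (t : m.-tuple 'I_n), uniq t ->
      P [set w | `|f1 (map_tuple (G1n J1 s n w) t)| <= C] = 1%E /\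
      P [set w | `|f1 (map_tuple (fun i : 'I_n => G1 F1 J1 Q (X1 s i w)) t)| <= C]
        = 1%E /\
      P [set w | `|f2 (map_tuple (G2n J2 s n w) t)| <= C] = 1%E /\
      P [set w | `|f2 (map_tuple (fun i : 'I_n => G2 F2 J2 Q (X2 s i w)) t)| <= C]
        = 1%E) ->
    {ae P, forall w,
      ((n - m)`!)%:R / n`!%:R * (\sum_(t : m.-tuple 'I_n | uniq t)
        `|f1 (map_tuple (G1n J1 s n w) t) -
          f1 (map_tuple (fun i : 'I_n => G1 F1 J1 Q (X1 s i w)) t)|)
      @[n --> \oo] --> (0 : R)} ->
    {ae P, forall w,
      ((n - m)`!)%:R / n`!%:R * (\sum_(t : m.-tuple 'I_n | uniq t)
        `|f2 (map_tuple (G2n J2 s n w) t) -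
          f2 (map_tuple (fun i : 'I_n => G2 F2 J2 Q (X2 s i w)) t)|)
      @[n --> \oo] --> (0 : R)} ->
    {ae P, forall w,
      (rank_gsc_hat J1 J2 s f1 f2 H n w)%:E @[n --> \oo] -->
        rank_gsc F1 F2 J1 J2 f1 f2 H Q}).
Proof.
split; first exact: rank_gsc_hat_distribution_free.
split; first by move=> oi1 oi2 Q Q' O1 O2 v1 v2 a1 a2; exact: rank_gsc_affine.
split; first exact: rank_gsc_I_consistent.
split; first exact: rank_gsc_D_consistent.
move=> Q dO Omega P s C acQ sm bounded.
exact: (rank_gsc_hat_consistent f1_kernel f2_kernel J1_score J2_score F1_df F2_df _
  (balanced_gt0 H_balanced) acQ sm bounded).
Qed.
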